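(* Let $V$ be a complex Hilbert space with a real structure $\alpha$. The algebra of smooth vectors $\mathrm{Cl}(V)^{\infty}$ is a rigged $C^*$-algebra, and it carries a smooth representation of the Banach Lie group $\mathrm{O}(V)$ (by Bogoliubov automorphisms $a\mapsto\theta_g(a)$).
   Context: A rigged $C^*$-algebra is a Fréchet algebra $A$ (a Fréchet space with a continuous algebra multiplication) equipped with a continuous norm and a continuous complex anti-linear involution $*$ such that the completion with respect to the norm is a $C^*$-algebra. A morphism of rigged $C^*$-algebras is a continuous algebra homomorphism which is bounded for the norms and intertwines the involutions; it is isometric if it preserves the norms. A smooth representation of a (Fréchet or Banach) Lie group $\mathcal{G}$ on $A$ is an action by isometric morphisms of rigged $C^*$-algebras such that $\mathcal{G}\times A\to A$ is smooth. A real structure is an anti-unitary involution $\alpha:V\to V$; inner products are linear in the first slot. $\mathrm{Cl}(V)$ is the universal unital $C^*$-algebra with a linear map $\iota:V\to\mathrm{Cl}(V)$ satisfying $\iota(v)\iota(w)+\iota(w)\iota(v)=2\langle v,\alpha(w)\rangle1$ and $\iota(v)^*=\iota(\alpha(v))$. $\mathrm{O}(V)$ is the group of unitaries of $V$ commuting with $\alpha$, a Banach Lie group with the operator norm topology and Lie algebra $\mathfrak{o}(V)=\{Y\in\mathcal{B}(V):[Y,\alpha]=0,\ Y^*=-Y\}$. For $g\in\mathrm{O}(V)$, $\theta_g$ is the automorphism of $\mathrm{Cl}(V)$ with $\theta_g\circ\iota=\iota\circ g$. $\mathrm{Cl}(V)^\infty:=\{a\in\mathrm{Cl}(V):\ \mathrm{O}(V)\to\mathrm{Cl}(V),\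 g\mapsto\theta_g(a)\text{ is smooth}\}$. For $Y\in\mathfrak{o}(V)$, $a\in\mathrm{Cl}(V)^\infty$, put $Ya=\frac{d}{dt}|_{t=0}\theta_{\exp(tY)}(a)$. The topology of $\mathrm{Cl}(V)^\infty$ is given by the seminorms $r_n(a)=\sup\{r(Y_1\cdots Y_na):Y_i\in\mathfrak{o}(V),\|Y_i\|\le1\}$ for all continuous seminorms $r$ on $\mathrm{Cl}(V)$ and $n\in\mathbb{N}_0$; norm, product and involution are restricted from $\mathrm{Cl}(V)$. *)

(* Defs.v *)
From HB Require Import structures.
From mathcomp Require Import all_boot all_order all_algebra.
From mathcomp Require Import sesquilinear.
From mathcomp Require Import all_classical all_reals all_analysis.
From mathcomp Require Import complex.

Set Implicit Arguments.
Unset Strict Implicit.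
Unset Printing Implicit Defensive.

Import Order.TTheory GRing.Theory Num.Theory.
Import numFieldNormedType.Exports.
Local Open Scope classical_set_scope.
Local Open Scope complex_scope.
Local Open Scope ring_scope.

(* Norms of a [normedModType R[i]] take their values in [R[i]]; this is the
   same norm as an element of [R]. *)
Definition normR {R : realType} {E : normedModType R[i]} (x : E) : R :=
  complex.Re `|x|.

Lemma Re_norm_ge0 {R : realType} (c : R[i]) : 0 <= complex.Re `|c|.
Proof. by have := normr_ge0 c; rewrite lecE => /andP[]. Qed.

Lemma normcRe {R : realType} (c : R[i]) : `|c| = (complex.Re `|c|)%:C.
Proof.
case: `|c| (normr_ge0 c) => a b.
by rewrite lecE /= => /andP[/eqP -> _].
Qed.

Section normR_theory.
Context {R : realType} {E : normedModType R[i]}.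
Implicit Types x y : E.

Lemma normRE x : `|x| = (normR x)%:C.
Proof.
rewrite /normR; case: `|x| (normr_ge0 x) => a b.
by rewrite lecE /= => /andP[/eqP -> _].
Qed.

Lemma normR_ge0 x : 0 <= normR x.
Proof. by rewrite -ler0c -normRE. Qed.

Lemma normRD x y : normR (x + y) <= normR x + normR y.
Proof. have := ler_normD x y; rewrite !normRE lecE /= => /andP[_].
by [].
Qed.

Lemma normRZ (c : R[i]) x : normR (c *: x) = complex.Re `|c| * normR x.
Proof.
rewrite {1}/normR normrZ (normRE x); case: `|c| => a b /=.
by rewrite mulr0 subr0.
Qed.

End normR_theory.

Section BoundedOperators.
Context {R : realType} (V : normedModType R[i]).

Definition bounded_linear (f : V -> V) :=
  linear f /\ exists M : R, forall x, normR (f x) <= M * normR x.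

Definition bounded_linear_pred : {pred V -> V} := fun f => `[< bounded_linear f >].

Lemma bounded_linear_submod : submod_closed bounded_linear_pred.
Proof.
split.
  apply/asboolP; split; first by move=> a x y; rewrite /= scaler0 addr0.
  by exists 0 => x; rewrite mul0r /normR normr0.
move=> a f g /asboolP[lf [M fM]] /asboolP[lg [N gN]]; apply/asboolP; split.
  move=> b x y /=.
  rewrite -[(a *: f + g) (b *: x + y)]/(a *: f (b *: x + y) + g (b *: x + y)).
  rewrite lf lg -[(a *: f + g) x]/(a *: f x + g x).
  rewrite -[(a *: f + g) y]/(a *: f y + g y).
  by rewrite !scalerDr !scalerA mulrC -!addrA; congr (_ + _); rewrite addrCA.
exists (complex.Re `|a| * M + N) => x.
rewrite -[(a *: f + g) x]/(a *: f x + g x).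
apply: (le_trans (normRD _ _)); rewrite normRZ mulrDl lerD// -mulrA ler_wpM2l//.
exact: Re_norm_ge0.
Qed.

HB.instance Definition _ :=
  GRing.isSubmodClosed.Build R[i] (V -> V) bounded_linear_pred bounded_linear_submod.

Record bop := Bop {
  bop_fun :> V -> V;
  bop_funP : bop_fun \in bounded_linear_pred }.

HB.instance Definition _ := [isSub for bop_fun].
HB.instance Definition _ := [Choice of bop by <:].
HB.instance Definition _ := [SubChoice_isSubLmodule of bop by <:].

Implicit Types f g : bop.

Lemma bop_linear f : linear f.
Proof. by have /asboolP[] := bop_funP f. Qed.

Lemma bop_bounded f : exists M : R, forall x, normR (f x) <= M * normR x.
Proof. by have /asboolP[] := bop_funP f. Qed.

Definition opnorm f : R := sup [set normR (f x) | x in [set x | normR x <= 1]].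

Lemma opnorm_has_sup f :
  has_sup [set normR (f x) | x in [set x | normR x <= 1]].
Proof.
split; first by exists (normR (f 0)); exists 0 => //=; rewrite /normR normr0.
have [M fM] := bop_bounded f; exists (Num.max M 0) => _ [x /= x1 <-].
apply: (le_trans (fM x)).
apply: (@le_trans _ _ (Num.max M 0 * normR x)).
  by rewrite ler_wpM2r ?normR_ge0// le_max lexx.
by rewrite -[leRHS]mulr1 ler_wpM2l// le_max lexx orbT.
Qed.

Lemma opnorm_ub f x : normR x <= 1 -> normR (f x) <= opnorm f.
Proof.
move=> x1; apply: sup_upper_bound; first exact: opnorm_has_sup.
by exists x.
Qed.

Lemma opnorm_le f (M : R) :
  (forall x, normR x <= 1 -> normR (f x) <= M) -> opnorm f <= M.
Proof.
move=> fM; apply: ge_sup; first by case: (opnorm_has_sup f).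
by move=> _ [x /= x1 <-]; exact: fM.
Qed.

Lemma opnormD f g : opnorm (f + g) <= opnorm f + opnorm g.
Proof.
apply: opnorm_le => x x1; apply: (le_trans (normRD (f x) (g x))).
by rewrite lerD ?opnorm_ub.
Qed.

Lemma opnormZ_le (c : R[i]) f : opnorm (c *: f) <= complex.Re `|c| * opnorm f.
Proof.
apply: opnorm_le => x x1; rewrite -[(c *: f) x]/(c *: f x) normRZ.
by rewrite ler_wpM2l ?Re_norm_ge0 ?opnorm_ub.
Qed.

Lemma opnormZ (c : R[i]) f : opnorm (c *: f) = complex.Re `|c| * opnorm f.
Proof.
apply/eqP; rewrite eq_le opnormZ_le andTb.
have [->|c0] := eqVneq c 0.
  rewrite normr0 mul0r.
  apply: (le_trans (normR_ge0 ((0 *: f : bop) 0))).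
  by apply: opnorm_ub; rewrite /normR normr0.
have n0 : 0 < complex.Re `|c|.
  have : 0 < `|c| by rewrite normr_gt0.
  by rewrite ltcE => /andP[].
have nV : complex.Re `|c^-1| = (complex.Re `|c|)^-1.
  apply: (mulIf (lt0r_neq0 n0)); rewrite mulVf ?lt0r_neq0//.
  apply: (@complexI R); transitivity (`|c^-1| * `|c|).
    by rewrite [RHS](congr2 *%R (normcRe c^-1) (normcRe c)) -rmorphM.
  by rewrite -normrM mulVf// normr1.
rewrite -ler_pdivlMl// -nV.
by have := opnormZ_le c^-1 (c *: f); rewrite scalerA mulVf// scale1r.
Qed.

Lemma opnorm0_eq0 f : opnorm f = 0 -> f = 0.
Proof.
move=> f0; apply: val_inj; apply/funext => x; change (f x = 0).
have lf0 (a : R[i]) y : f (a *: y) = a *: f y.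
  have /= := bop_linear f a y 0; rewrite !addr0 => ->.
  by have /= := bop_linear f (-1) 0 0; rewrite !scaleN1r oppr0 add0r addNr => ->; rewrite addr0.
have [->|x0] := eqVneq x 0; first by rewrite -(scale0r (0 : V)) lf0 !scale0r.
have nx : normR (`|x|^-1 *: x) <= 1.
  by rewrite /normR normrZ normfV normr_id mulVf ?normr_eq0.
have := opnorm_ub f nx; rewrite f0 => fx.
have : `|f (`|x|^-1 *: x)| = 0.
  by rewrite normRE; congr (_ %:C); apply/eqP; rewrite eq_le fx normR_ge0.
move/normr0_eq0; rewrite lf0 => /eqP; rewrite scaler_eq0 invr_eq0 normr_eq0.
by rewrite (negPf x0) => /eqP.
Qed.

Lemma bop_normD f g : (opnorm (f + g))%:C <= (opnorm f)%:C + (opnorm g)%:C.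
Proof. by have := opnormD f g; rewrite lecE /= addr0 eqxx. Qed.

Lemma bop_normZ (c : R[i]) f : (opnorm (c *: f))%:C = `|c| * (opnorm f)%:C.
Proof.
rewrite opnormZ; have := normr_ge0 c; rewrite lecE; case: `|c| => a b /=.
by case/andP => /eqP -> _; apply/eqP; rewrite eq_complex /= !mulr0 mul0r subr0 addr0 !eqxx.
Qed.

Lemma bop_norm0_eq0 f : (opnorm f)%:C = 0 -> f = 0.
Proof. by move=> [] /opnorm0_eq0. Qed.

HB.instance Definition _ :=
  Lmodule_isNormed.Build R[i] bop bop_normD bop_normZ bop_norm0_eq0.

Lemma bop_comp_subproof f g : (f \o g) \in bounded_linear_pred.
Proof.
apply/asboolP; split.
  by move=> a x y /=; rewrite (bop_linear g) (bop_linear f).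
have [M fM] := bop_bounded f; have [N gN] := bop_bounded g.
exists (Num.max M 0 * N) => x /=; apply: (le_trans (fM _)).
apply: (@le_trans _ _ (Num.max M 0 * normR (g x))).
  by rewrite ler_wpM2r ?normR_ge0// le_max lexx.
by rewrite -mulrA ler_wpM2l// le_max lexx orbT.
Qed.

Definition bop_comp f g : bop := Bop (bop_comp_subproof f g).

Lemma bop_id_subproof : idfun \in bounded_linear_pred.
Proof. by apply/asboolP; split => //; exists 1 => x; rewrite mul1r. Qed.

Definition bop_id : bop := Bop bop_id_subproof.

Definition bop_exp f : bop :=
  limn (series (fun k => (k`!%:R)^-1 *: iter k (bop_comp f) bop_id)).

End BoundedOperators.

Record hilbertSpace (R : realType) := HilbertSpace {
  hilbert_car :> completeNormedModType R[i];
  (* linear in the first slot, conjugate linear in the second *)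
  hdot : {dot hilbert_car for (Num.conj : R[i] -> R[i])};
  hdotE : forall v, `|v| ^+ 2 = hdot v v }.

Section OrthogonalGroup.
Context {R : realType} {V : hilbertSpace R}.

Definition antilinear (E F : lmodType R[i]) (f : E -> F) :=
  forall (c : R[i]) x y, f (c *: x + y) = Num.conj c *: f x + f y.

Record real_structure (alpha : V -> V) : Prop := RealStructure {
  real_antilinear : antilinear alpha;
  real_antiunitary : forall v w, hdot V (alpha v) (alpha w) = hdot V w v;
  real_involutive : involutive alpha }.

Definition is_adjoint (X Y : bop V) :=
  forall v w, hdot V (X v) w = hdot V v (Y w).

Definition unitary (g : bop V) :=
  exists h, [/\ is_adjoint g h, bop_comp g h = bop_id V & bop_comp h g = bop_id V].

Definition orthogonal_group (alpha : V -> V) : set (bop V) :=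
  [set g | unitary g /\ forall v, g (alpha v) = alpha (g v)].

Definition orthogonal_lie_algebra (alpha : V -> V) : set (bop V) :=
  [set Y | is_adjoint Y (- Y) /\ forall v, Y (alpha v) = alpha (Y v)].

End OrthogonalGroup.

(* Directional-derivative (Michal-Bastiani) calculus with real parameter.
   The domain of [f] is a relatively open subset [U] of a real linear subspace
   [L] of [E], with the topology induced by [E]; the values of [f] outside [U]
   and of [df] outside [U `*` L] are irrelevant.  [L] need not be a complex
   subspace, which is what o(V) in B(V) requires. *)
Fixpoint Cn {R : realType} (n : nat) {E F : tvsType R[i]} (L U : set E)
    (f : E -> F) {struct n} : Prop :=
  {within U, continuous f} /\
  match n with
  | 0%N => True
  | m.+1 => exists df : E * E -> F,
      (forall x v, U x -> L v ->
        (fun t : R => (t%:C)^-1 *: (f (x + t%:C *: v) - f x)) @ 0^' --> df (x, v))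
      /\ Cn m (L `*` L) (U `*` L) df
  end.

Definition smooth_map {R : realType} {E F : tvsType R[i]} (L U : set E)
  (f : E -> F) := forall n, Cn n L U f.

Section SmoothOnOrthogonalGroup.
Context {R : realType} {V : hilbertSpace R} (alpha : V -> V).

(* The manifold structure of O(V) has the charts [Y |-> g exp(Y)], for Y in a
   small ball of o(V) around 0. *)
Definition lie_ball (r : R) : set (bop V) :=
  [set Y | orthogonal_lie_algebra alpha Y /\ normR Y < r].

Definition smooth_on_O {F : tvsType R[i]} (f : bop V -> F) :=
  forall g, orthogonal_group alpha g -> exists2 r : R, 0 < r &
    smooth_map (orthogonal_lie_algebra alpha) (lie_ball r)
      (fun Y => f (bop_comp g (bop_exp Y))).

Definition smooth_on_Ox {E F : tvsType R[i]} (f : bop V -> E -> F) :=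
  forall g, orthogonal_group alpha g -> exists2 r : R, 0 < r &
    smooth_map (orthogonal_lie_algebra alpha `*` [set: E])
      (lie_ball r `*` [set: E])
      (fun p : bop V * E => f (bop_comp g (bop_exp p.1)) p.2).

End SmoothOnOrthogonalGroup.

Definition bilinear_mul {R : realType} (A : lmodType R[i]) (mul : A -> A -> A) :=
  (forall a, linear (mul a)) /\ (forall b, linear (mul ^~ b)).

Record cstarAlgebra (R : realType) := CstarAlgebra {
  cs_car :> completeNormedModType R[i];
  cs_mul : cs_car -> cs_car -> cs_car;
  cs_star : cs_car -> cs_car;
  cs_mul_bilinear : bilinear_mul cs_mul;
  cs_mulA : associative cs_mul;
  cs_starL : antilinear cs_star;
  cs_starK : involutive cs_star;
  cs_starM : forall a b, cs_star (cs_mul a b) = cs_mul (cs_star b) (cs_star a);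
  cs_normM : forall a b, `|cs_mul a b| <= `|a| * `|b|;
  cs_normE : forall a, `|cs_mul (cs_star a) a| = `|a| ^+ 2 }.

Record unitalCstarAlgebra (R : realType) := UnitalCstarAlgebra {
  ucs_car :> cstarAlgebra R;
  ucs_one : ucs_car;
  ucs_mul1 : left_id ucs_one (@cs_mul R ucs_car);
  ucs_mulr1 : right_id ucs_one (@cs_mul R ucs_car) }.

Arguments cs_mul {R _} _ _.
Arguments cs_star {R _} _.
Arguments ucs_one {R} _.

Record unital_star_morphism {R : realType} {A B : unitalCstarAlgebra R}
    (f : A -> B) : Prop := UnitalStarMorphism {
  usm_linear : linear f;
  usm_mul : forall a b, f (cs_mul a b) = cs_mul (f a) (f b);
  usm_one : f (ucs_one A) = ucs_one B;
  usm_star : forall a, f (cs_star a) = cs_star (f a) }.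

(* Cauchy filters for the translation-invariant uniformity of the topological
   vector space [E].  (A [tvsType] also carries a uniform structure inducing its
   topology, but nothing in that interface makes it translation invariant.) *)
Definition tvs_cauchy {R : realType} {E : tvsType R[i]} (F : set_system E) :=
  (fun p : E * E => p.1 - p.2) @ (F, F) --> (0 : E).

Record frechet_space {R : realType} (E : tvsType R[i]) : Prop := FrechetSpace {
  frechet_hausdorff : hausdorff_space E;
  frechet_countable : exists B : nat -> set E,
    (forall n, nbhs (0 : E) (B n)) /\
    forall U, nbhs (0 : E) U -> exists n, B n `<=` U;
  frechet_complete : forall F : set_system E,
    ProperFilter F -> tvs_cauchy F -> exists x : E, F --> x }.

Record is_seminorm {R : realType} (E : lmodType R[i]) (p : E -> R) : Prop :=
  IsSeminorm {
  seminormD : forall x y, p (x + y) <= p x + p y;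
  seminormZ : forall (c : R[i]) x, p (c *: x) = complex.Re `|c| * p x }.

(* [rc_completion]: a complete normed space containing the normed space
   [(A, rc_norm)] isometrically as a dense subspace is its completion; its
   multiplication and involution extend those of [A]. *)
Record riggedCstarAlgebra (R : realType) := RiggedCstarAlgebra {
  rc_car :> tvsType R[i];
  rc_mul : rc_car -> rc_car -> rc_car;
  rc_norm : rc_car -> R;
  rc_star : rc_car -> rc_car;
  rc_frechet : frechet_space rc_car;
  rc_mul_bilinear : bilinear_mul rc_mul;
  rc_mulA : associative rc_mul;
  rc_mul_continuous : continuous (fun p : rc_car * rc_car => rc_mul p.1 p.2);
  rc_norm_seminorm : is_seminorm rc_norm;
  rc_norm0 : forall a, rc_norm a = 0 -> a = 0;
  rc_norm_continuous : continuous rc_norm;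
  rc_starL : antilinear rc_star;
  rc_starK : involutive rc_star;
  rc_star_continuous : continuous rc_star;
  rc_completion : exists (B : cstarAlgebra R) (j : rc_car -> B),
    [/\ linear j, (forall a, normR (j a) = rc_norm a),
        closure (range j) = [set: B],
        (forall a b, j (rc_mul a b) = cs_mul (j a) (j b)) &
        (forall a, j (rc_star a) = cs_star (j a))] }.

Arguments rc_mul {R _} _ _.
Arguments rc_norm {R _} _.
Arguments rc_star {R _} _.

Record rigged_morphism {R : realType} {A B : riggedCstarAlgebra R}
    (f : A -> B) : Prop := RiggedMorphism {
  rm_linear : linear f;
  rm_mul : forall a b, f (rc_mul a b) = rc_mul (f a) (f b);
  rm_continuous : continuous f;
  rm_bounded : exists M : R, forall a, rc_norm (f a) <= M * rc_norm a;
  rm_star : forall a, f (rc_star a) = rc_star (f a) }.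

Definition isometric_rigged_morphism {R : realType} {A B : riggedCstarAlgebra R}
    (f : A -> B) :=
  rigged_morphism f /\ forall a, rc_norm (f a) = rc_norm a.

(* The action is a function on all of [bop V]; only its values on O(V) matter. *)
Record smooth_representation_of_O {R : realType} {V : hilbertSpace R}
    (alpha : V -> V) {A : riggedCstarAlgebra R} (rho : bop V -> A -> A) : Prop :=
  SmoothRepresentationOfO {
  rep_one : forall a, rho (bop_id V) a = a;
  rep_mul : forall g h a, orthogonal_group alpha g -> orthogonal_group alpha h ->
    rho (bop_comp g h) a = rho g (rho h a);
  rep_isometric : forall g, orthogonal_group alpha g ->
    isometric_rigged_morphism (rho g);
  rep_smooth : smooth_on_Ox alpha rho }.

Section Clifford.
Context {R : realType} {V : hilbertSpace R} (alpha : V -> V).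

Record clifford_map (B : unitalCstarAlgebra R) (iota : V -> B) : Prop :=
  CliffordMap {
  clifford_linear : linear iota;
  clifford_rel : forall v w,
    cs_mul (iota v) (iota w) + cs_mul (iota w) (iota v) =
    (2%:R * hdot V v (alpha w)) *: ucs_one B;
  clifford_star : forall v, cs_star (iota v) = iota (alpha v) }.

Record clifford_algebra (C : unitalCstarAlgebra R) (iota : V -> C) : Prop :=
  CliffordAlgebra {
  clifford_algebra_map : clifford_map iota;
  clifford_universal : forall (B : unitalCstarAlgebra R) (f : V -> B),
    clifford_map f ->
    exists! F : C -> B, unital_star_morphism F /\ forall v, F (iota v) = f v }.

Section Bogoliubov.
Variables (C : unitalCstarAlgebra R) (iota : V -> C).

Record is_bogoliubov (g : bop V) (theta : C -> C) : Prop := IsBogoliubov {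
  bogoliubov_morphism : unital_star_morphism theta;
  bogoliubov_bij : bijective theta;
  bogoliubov_iota : forall v, theta (iota v) = iota (g v) }.

Definition bogoliubov (g : bop V) : C -> C := get (is_bogoliubov g).

Lemma clifford_map_orthogonal (g : bop V) : clifford_map iota ->
  orthogonal_group alpha g -> clifford_map (fun v => iota (g v)).
Proof.
move=> [il ir ist] [[h [gh _ hg]] ga]; split.
- by move=> c v w; rewrite bop_linear il.
- move=> v w; rewrite ir -ga gh.
  by rewrite (_ : h (g (alpha w)) = bop_comp h g (alpha w))// hg.
- by move=> v; rewrite ist ga.
Qed.

Lemma orthogonal_inverse (g : bop V) : orthogonal_group alpha g ->
  exists h, [/\ orthogonal_group alpha h, bop_comp g h = bop_id V
              & bop_comp h g = bop_id V].
Proof.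
move=> [[h [agh gh hg]] ga]; exists h.
have ghv v : g (h v) = v by rewrite -[LHS]/(bop_comp g h v) gh.
have hgv v : h (g v) = v by rewrite -[LHS]/(bop_comp h g v) hg.
split=> //; split; last by move=> v; rewrite -[v in LHS]ghv -ga hgv.
exists g; split=> // v w.
by rewrite hermC /= expr0 mul1r -agh [RHS]hermC /= expr0 mul1r.
Qed.

Lemma bogoliubovP (g : bop V) : clifford_algebra iota ->
  orthogonal_group alpha g -> is_bogoliubov g (bogoliubov g).
Proof.
move=> [icl univ] Og; apply: getPex.
have [h [Oh gh hg]] := orthogonal_inverse Og.
have [F [[Fm Fi] _]] := univ _ _ (clifford_map_orthogonal icl Og).
have [G [[Gm Gi] _]] := univ _ _ (clifford_map_orthogonal icl Oh).
have comp_morph (f k : C -> C) : unital_star_morphism f ->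
    unital_star_morphism k -> unital_star_morphism (f \o k).
  move=> [fl fm f1 fs] [kl km k1 ks]; split=> /=.
  - by move=> c x y /=; rewrite kl fl.
  - by move=> a b; rewrite km fm.
  - by rewrite k1 f1.
  - by move=> a; rewrite ks fs.
have id_of (f : C -> C) : unital_star_morphism f ->
    (forall v, f (iota v) = iota v) -> f = idfun.
  have [I [_ uI]] := univ _ _ icl.
  by move=> fm fi; rewrite -(uI f)// -(uI idfun).
have FG : F \o G = idfun.
  apply: id_of; first exact: comp_morph.
  by move=> v; rewrite /= Gi Fi -[g (h v)]/(bop_comp g h v) gh.
have GF : G \o F = idfun.
  apply: id_of; first exact: comp_morph.
  by move=> v; rewrite /= Fi Gi -[h (g v)]/(bop_comp h g v) hg.
exists F; split=> //; exists G => x.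
  by rewrite -[LHS]/((G \o F) x) GF.
by rewrite -[LHS]/((F \o G) x) FG.
Qed.

Definition smooth_vectors : set C :=
  [set a | smooth_on_O alpha (fun g => bogoliubov g a)].

(* The infinitesimal action [Y a = d/dt|_{t=0} theta_{exp(tY)}(a)]. *)
Definition lie_action (Y : bop V) (a : C) : C :=
  lim ((fun t : R => (t%:C)^-1 *: (bogoliubov (bop_exp (t%:C *: Y)) a - a)) @ 0^').

Definition lie_actions (Ys : seq (bop V)) (a : C) : C := foldr lie_action a Ys.

(* Extended-real supremum: its finiteness is not part of the definition. *)
Definition smooth_seminorm (r : C -> R) (n : nat) (a : C) : \bar R :=
  ereal_sup [set (r (lie_actions Ys a))%:E | Ys in
    [set Ys : n.-tuple (bop V) | forall i,
      orthogonal_lie_algebra alpha (tnth Ys i) /\ normR (tnth Ys i) <= 1]].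

(* [A] is the algebra of smooth vectors, [j] being its inclusion into [C]:
   norm, product and involution are restricted from [C], and the topology is the
   one defined by the family of all [smooth_seminorm r n]. *)
Record is_smooth_vector_algebra (A : riggedCstarAlgebra R) (j : A -> C) : Prop :=
  IsSmoothVectorAlgebra {
  sva_inj : injective j;
  sva_range : range j = smooth_vectors;
  sva_linear : linear j;
  sva_mul : forall a b, j (rc_mul a b) = cs_mul (j a) (j b);
  sva_star : forall a, j (rc_star a) = cs_star (j a);
  sva_norm : forall a, rc_norm a = normR (j a);
  sva_nbhs : forall (a : A) (U : set A), nbhs a U <->
    exists (m : nat) (r : 'I_m -> C -> R) (n : 'I_m -> nat) (e : R),
      [/\ 0 < e, (forall i, is_seminorm (r i) /\ continuous (r i)) &
          forall b, (forall i,
            (smooth_seminorm (r i) (n i) (j b - j a)%R < e%:E)%E) -> U b] }.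

End Bogoliubov.
End Clifford.

(* Main.v *)
Require Import Defs.
From HB Require Import structures.
From mathcomp Require Import all_boot all_order all_algebra.
From mathcomp Require Import sesquilinear.
From mathcomp Require Import all_classical all_reals all_analysis.
From mathcomp Require Import complex.
From mathcomp Require Import ring lra.

Set Implicit Arguments.
Unset Strict Implicit.
Unset Printing Implicit Defensive.

Import Order.TTheory GRing.Theory Num.Theory.
Import numFieldNormedType.Exports.
Local Open Scope classical_set_scope.
Local Open Scope complex_scope.
Local Open Scope ring_scope.

(** Write th g for the Bogoliubov automorphism of g, G for O(V) and o(V) for its Lie
    algebra.
    Every th g is isometric, because a unital star morphism of C*-algebras is contractive
    ([usm_contractive]); hence the one-parameter groups t |-> th (exp (tY)) have
    generators Y that obey exact mean value estimates and are closed operators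
    ([orbit_lip], [orbit_taylor], [act_closed]).

    The proof works with an infinitesimal description of smoothness.  A vector a is
    Lie-smooth ([lie_smooth]) when all iterated derivatives Y_1 ... Y_n a exist, the
    outermost derivative is additive in its direction, and they are bounded for Y_i in
    the unit ball.  The norms [lie_norm] n a are the suprema of |Y_1 ... Y_k a| over
    k <= n and |Y_i| <= 1.  Then:
    - Lie-smooth vectors form a star algebra stable under G and o(V), the seminorms being
      submultiplicative up to the factor 2^n by the Leibniz rule ([P_mul]), invariant
      under G ([Pg]), and complete by closedness of the generators ([Sm_limit]).  This
      gives the rigged C*-algebra [smooth_algebra]; its C*-completion is the closure of
      the Lie-smooth vectors.
    - The commutator relation [act_commutator] gives, by induction on n,
      |th (exp Y) a - a|_n <= K |Y| |a|_(n+1) and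
      |th (exp Y) a - a - Y a|_n <= K |Y|^2 |a|_(n+2) for |Y| <= 1 ([P_lip], [P_taylor]).
      With a logarithm on a neighbourhood of 1 in G ([group_log]), this differentiates orbits
      along all curves through 1, in every seminorm ([P_curve_deriv]).
    - The map f (X, a) = th (g exp X) a is therefore differentiable, with derivative
      th (g exp X) (ldexp (X, Z) a + b) in the direction (Z, b), where ldexp (X, Z) is the
      logarithmic derivative exp (- X) d exp_X (Z).  This is f composed with a map built
      from smooth and continuous bilinear maps, so f of class C^n implies f of class
      C^(n+1), and f is smooth ([rho_smooth_at]).  In particular Lie-smooth vectors are
      smooth vectors ([Sm_smooth_vectors]).
    - Conversely let a be a smooth vector.  Near X = 0 the map Z |-> ldexp (X, Z) of o(V)
      is invertible with smooth inverse ([ldexp_inverse]), so that X |-> th (exp X) (Y a) is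
      a directional derivative of X |-> th (exp X) a, composed with a smooth map.  Hence
      Y a is smooth jointly in Y, and this can be iterated; continuity at Y = 0 bounds the
      iterated derivatives ([family_step], [family_bound], [smooth_vectors_Sm]).

    The exponential is smooth because its derivative at x is the second component of the
    exponential of x + eps z in the dual numbers, which is again an exponential
    ([Cn_bexp]).  *)

(** * Mean value estimates *)

Section RealParameter.
Context {R : realType}.

Lemma realC_eq0 (t : R) : (t%:C == 0 :> R[i]) = (t == 0).
Proof. by rewrite -(rmorph0 (real_complex R)) (inj_eq (@complexI R)). Qed.

Lemma near0P (P : R -> Prop) :
  (\forall h \near (0 : R)^', P h) <->
  exists2 d, 0 < d & forall h, `|h| < d -> h != 0 -> P h.
Proof.
split.
  rewrite /dnbhs /within /= => /nbhs_ballP[d /= d0 H]; exists d => // h hd h0.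
  by apply: H => //; rewrite -ball_normE /= sub0r normrN.
move=> [d d0 H]; rewrite /dnbhs /within; apply/nbhs_ballP; exists d => //= h.
by rewrite -ball_normE /= sub0r normrN => hd h0; exact: H.
Qed.

(** Convexity along real segments, the form in which convex neighbourhoods of a complex
    space enter the mean value estimates. *)
Definition convex_real (E : lmodType R[i]) (K : set E) :=
  forall x y (t : R), 0 <= t -> t <= 1 -> K x -> K y ->
    K (t%:C *: x + (1 - t)%:C *: y).

Definition slope (E : lmodType R[i]) (phi : R -> E) (a b : R) : E :=
  ((b - a)%:C)^-1 *: (phi b - phi a).

(** The slope over a union of two adjacent intervals is a convex combination of the two
    slopes. *)
Lemma slope_split (E : lmodType R[i]) (phi : R -> E) (a c b : R) :
  a < c -> c < b ->
  slope phi a b = ((c - a) / (b - a))%:C *: slope phi a c +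
     (1 - (c - a) / (b - a))%:C *: slope phi c b.
Proof.
move=> ac cb; rewrite /slope !scalerA.
have h1 : (c - a)%:C != 0 :> R[i] by rewrite realC_eq0 subr_eq0 gt_eqF.
have h2 : (b - c)%:C != 0 :> R[i] by rewrite realC_eq0 subr_eq0 gt_eqF.
have h3 : (b - a)%:C != 0 :> R[i].
  by rewrite realC_eq0 subr_eq0 gt_eqF// (lt_trans ac).
rewrite rmorphM fmorphV mulrAC mulfV// mul1r.
have -> : (1 - (c - a) / (b - a))%:C = (b - c)%:C / (b - a)%:C :> R[i].
  rewrite -fmorphV -rmorphM; congr (_ %:C); field.
  by rewrite subr_eq0 gt_eqF// (lt_trans ac).
rewrite mulrAC mulfV// mul1r -scalerDr; congr (_ *: _).
by rewrite [RHS]addrC subrKA.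
Qed.

(** The slope over an interval around c is a convex combination of the difference
    quotients at c towards its endpoints. *)
Lemma straddle (E : lmodType R[i]) (phi : R -> E) (K : set E) (c d : R) :
  convex_real K ->
  (forall h, `|h| < d -> h != 0 -> K ((h%:C)^-1 *: (phi (c + h) - phi c))) ->
  forall a b, a < b -> a <= c -> c <= b -> c - a < d -> b - c < d ->
    K (slope phi a b).
Proof.
move=> cK H a b ab ac cb ca bc.
have Kcb : c < b -> K (slope phi c b).
  move=> cb'; have /= := H (b - c); rewrite gtr0_norm ?subr_gt0// subr_eq0 gt_eqF//.
  by rewrite (_ : c + (b - c) = b); [move=> /(_ bc isT)|ring].
have Kac : a < c -> K (slope phi a c).
  move=> ac'; have /= := H (a - c); rewrite ltr0_norm ?subr_lt0// opprB subr_eq0 lt_eqF//.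
  rewrite (_ : c + (a - c) = a); [move=> /(_ ca isT); rewrite /slope|ring].
  rewrite -[X in _ *: X]opprB scalerN -scaleNr -invrN.
  by rewrite -[in X in X -> _](opprB c a) rmorphN opprK.
have [ac'|] := ltP a c; last first.
  by move=> ca'; have e : a = c; [apply/eqP; rewrite eq_le ac|subst a; exact: Kcb].
have [cb'|] := ltP c b; last first.
  by move=> bc'; have e : b = c; [apply/eqP; rewrite eq_le cb bc'|subst b; exact: Kac].
rewrite (slope_split phi ac' cb'); apply: (cK).
- by rewrite divr_ge0// subr_ge0// ltW.
- by rewrite ler_pdivrMr ?subr_gt0// mul1r lerB// ltW.
- exact: Kac.
- exact: Kcb.
Qed.

(** Stated for difference quotients that lie in a convex set, which in a locally convex
    space is what a neighbourhood of the derivative provides. The proof takes the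
    supremum of the s for which the slope over [0, s] lies in K and crosses it by
    [straddle]. *)
Lemma mean_value (E : lmodType R[i]) (phi : R -> E) (K : set E) :
  convex_real K ->
  (forall s, 0 <= s -> s <= 1 ->
     \forall h \near (0 : R)^', K ((h%:C)^-1 *: (phi (s + h) - phi s))) ->
  K (phi 1 - phi 0).
Proof.
move=> cK H.
suff : K (slope phi 0 1) by rewrite /slope subr0 rmorph1 invr1 scale1r.
pose T := [set s : R | 0 < s <= 1 /\ K (slope phi 0 s)].
have [d0 d00 H0] := (near0P _).1 (H 0 (lexx _) ler01).
have T0 : T !=set0.
  pose b := Num.min (d0 / 2) 1.
  have b0 : 0 < b by rewrite lt_min ltr01 divr_gt0.
  exists b; split; first by rewrite b0 ge_min lexx orbT.
  apply: (straddle cK H0) => //; rewrite ?ltW// subr0//.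
  by rewrite /b gt_min ltr_pdivrMr// ltr_pMr// ltr1n.
have Tub : has_ubound T by exists 1 => s [/andP[]].
have supT : has_sup T by split.
pose c := sup T.
have c0 : 0 <= c.
  have [t Tt] := T0; have [/andP[t0 _] _] := Tt.
  by rewrite (le_trans (ltW t0))//; exact: sup_upper_bound.
have c1 : c <= 1 by apply: ge_sup => // s [/andP[]].
have [d dg Hd] := (near0P _).1 (H c c0 c1).
have [a Ta ca] := sup_adherent dg supT.
have {}ca : c - a < d by move: ca; rewrite -/c ltrBlDr addrC -ltrBlDr.
have ac : a <= c by exact: sup_upper_bound.
have [/andP[a0 a1] Ka] := Ta.
(* A point beyond the supremum c, unless c = 1. *)
pose b := Num.min 1 (c + d / 2).
have bK : a < b -> c <= b -> K (slope phi 0 b).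
  move=> ab cb; rewrite (slope_split phi a0 ab); apply: (cK) => //.
  - by rewrite divr_ge0// subr_ge0// ltW// (lt_trans a0).
  - by rewrite ler_pdivrMr ?subr_gt0 ?(lt_trans a0)// mul1r lerB// ltW.
  - apply: (straddle cK Hd) => //.
    rewrite ltrBlDl (@le_lt_trans _ _ (c + d / 2))//.
      by rewrite /b ge_min lexx orbT.
    by rewrite ltrD2l ltr_pdivrMr// ltr_pMr// ltr1n.
have cb : c <= b by rewrite /b le_min c1 lerDl divr_ge0// ltW.
have [ab|ba] := ltP a b.
  have Tb : T b.
    split; last exact: bK.
    by rewrite (lt_trans a0 ab)/= /b ge_min lexx.
  have bc : b <= c by exact: sup_upper_bound.
  have [e|ne] := eqVneq b 1; first by rewrite -e; exact: bK.
  have eb : b = c + d / 2.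
    by move: ne; rewrite /b; case: leP => //; rewrite eqxx.
  by move: bc; rewrite eb gerDl leNgt divr_gt0.
have e : a = 1.
  have e1 : a = b by apply/eqP; rewrite eq_le ba (le_trans ac).
  have e2 : b = c by apply/eqP; rewrite eq_le cb andbT -e1.
  rewrite e1; move: e2; rewrite /b; case: leP => // _ /eqP.
  by rewrite -subr_eq0 addrC addKr gt_eqF// divr_gt0.
by rewrite -e.
Qed.

End RealParameter.

(** * Directional calculus on open subsets of real subspaces *)

Section TvsLimits.
Context {R : realType} {E : tvsType R[i]}.

Lemma tvs_cvgD (T : Type) (F : set_system T) (FF : Filter F) (f g : T -> E) a b :
  f @ F --> a -> g @ F --> b -> (fun x => f x + g x) @ F --> a + b.
Proof. by move=> fa gb; apply: (cvg_comp2 fa gb (@add_continuous E (a, b))). Qed.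

Lemma tvs_cvgN (T : Type) (F : set_system T) (FF : Filter F) (f : T -> E) a :
  f @ F --> a -> (fun x => - f x) @ F --> - a.
Proof. by move=> fa; apply: (cvg_comp _ _ fa (@opp_continuous E a)). Qed.

Lemma tvs_cvgB (T : Type) (F : set_system T) (FF : Filter F) (f g : T -> E) a b :
  f @ F --> a -> g @ F --> b -> (fun x => f x - g x) @ F --> a - b.
Proof. by move=> fa gb; apply: tvs_cvgD => //; exact: tvs_cvgN. Qed.

Lemma tvs_cvgZ (T : Type) (F : set_system T) (FF : Filter F) (k : T -> R[i]) (f : T -> E) c a :
  k @ F --> (c : R[i]^o) -> f @ F --> a -> (fun x => k x *: f x) @ F --> c *: a.
Proof. by move=> kc fa; apply: (cvg_comp2 kc fa (@scale_continuous R[i] E (c, a))). Qed.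

Lemma real_complex_continuous : continuous (fun t : R => (t%:C : R[i]^o)).
Proof.
move=> t; apply/cvgrPdist_lt => /= -[a b]; rewrite ltcE /= => /andP[/eqP -> a0].
near=> s; rewrite -rmorphB normc_def /= expr0n /= addr0 sqrtr_sqr ltcR.
near: s; exact: cvgr_dist_lt.
Unshelve. all: by end_near. Qed.

Lemma real_complex_cvg (T : Type) (F : set_system T) (FF : Filter F) (k : T -> R) (c : R) :
  k @ F --> c -> (fun x => (k x)%:C : R[i]^o) @ F --> (c%:C : R[i]^o).
Proof. by move=> kc; apply: (cvg_comp _ _ kc (@real_complex_continuous c)). Qed.

Lemma convex_set_real (K : set E) : convex_set K -> convex_real K.
Proof.
move=> cK x y t t0 t1 Kx Ky.
have t0c : 0 <= t%:C by rewrite ler0c.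
have t1c : t%:C <= 1 by rewrite -(rmorph1 (real_complex R)) lecR.
have /set_mem := cK x y (Itv01 t0c t1c) (mem_set Kx) (mem_set Ky).
by rewrite rmorphB rmorph1.
Qed.

(** Local convexity, in the form needed by [mean_value]. *)
Lemma tvs_convex_nbhs (x : E) (N : set E) : nbhs x N ->
  exists K, [/\ open K, K x, convex_real K & K `<=` N].
Proof.
have [B Bc [Bo Bx]] := @locally_convex _ E.
move=> /(Bx x)[K [BK Kx] KN]; exists K; split => //; first exact: Bo.
by apply: convex_set_real; apply: Bc; exact: mem_set.
Qed.

End TvsLimits.

Section Domains.
Context {R : realType}.

(** The domains of the calculus: U relatively open in a closed real subspace L.
    Closedness of L puts derivatives of L-valued maps back in L. *)
Record real_domain (E : tvsType R[i]) (L U : set E) : Prop := RealDomain {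
  rd0 : L 0;
  rdD : forall x y, L x -> L y -> L (x + y);
  rdZ : forall (t : R) x, L x -> L (t%:C *: x);
  rd_closed : closed L;
  rd_sub : U `<=` L;
  rd_open : forall x, U x -> exists2 N, nbhs x N & forall y, N y -> L y -> U y }.

Lemma closedM (E F : topologicalType) (A : set E) (B : set F) :
  closed A -> closed B -> closed (A `*` B).
Proof.
move=> cA cB [x y] h; split => /=.
  apply: cA => N Nx; have [] := h (N `*` setT).
    by exists (N, setT) => //=; split => //; exact: filterT.
  by move=> [a b] [[Aa _] [Na _]]; exists a.
apply: cB => N Nx; have [] := h (setT `*` N).
  by exists (setT, N) => //=; split => //; exact: filterT.
by move=> [a b] [[_ Bb] [_ Nb]]; exists b.
Qed.

Lemma real_domainM (E F : tvsType R[i]) (L U : set E) (M W : set F) :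
  real_domain L U -> real_domain M W -> real_domain (L `*` M) (U `*` W).
Proof.
move=> [L0 LD LZ Lc LU Lo] [M0 MD MZ Mc MU Mo]; split.
- by split.
- by move=> [x x'] [y y'] [/= Lx Mx] [/= Ly My]; split => /=; [exact: LD|exact: MD].
- by move=> t [x x'] [/= Lx Mx]; split => /=; [exact: LZ|exact: MZ].
- exact: closedM.
- by move=> [x y] [/= Ux Wy]; split; [exact: LU|exact: MU].
- move=> [x y] [/= Ux Wy]; have [N Nx NU] := Lo _ Ux; have [N' Nx' NU'] := Mo _ Wy.
  exists (N `*` N'); first by exists (N, N').
  by move=> [a b] [/= Na Nb] [/= La Lb]; split => /=; [exact: NU|exact: NU'].
Qed.

Lemma real_domainT (E : tvsType R[i]) : real_domain [set: E] [set: E].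
Proof. by split => // x _; exists setT => //; exact: filterT. Qed.

Lemma real_domain_full (E : tvsType R[i]) (L U : set E) :
  real_domain L U -> real_domain L L.
Proof. by case=> *; split => // x Lx; exists setT => //; exact: filterT. Qed.

Definition cont_on (E F : topologicalType) (U : set E) (f : E -> F) :=
  forall x, U x -> f @ within U (nbhs x) --> f x.

Definition deriv_on (E F : tvsType R[i]) (L U : set E) (f : E -> F) (df : E * E -> F) :=
  forall x v, U x -> L v ->
    (fun t : R => (t%:C)^-1 *: (f (x + t%:C *: v) - f x)) @ 0^' --> df (x, v).

Lemma CnS n (E F : tvsType R[i]) (L U : set E) (f : E -> F) :
  Cn n.+1 L U f <-> cont_on U f /\ exists2 df, deriv_on L U f df & Cn n (L `*` L) (U `*` L) df.
Proof.
split=> -[/subspace_continuousP c]; first by move=> [df [d h]]; split => //; exists df.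
by move=> [df d h]; split => //; exists df.
Qed.

Lemma Cn_cont n (E F : tvsType R[i]) (L U : set E) (f : E -> F) :
  Cn n L U f -> cont_on U f.
Proof. by case: n => [|n] /= [/subspace_continuousP]. Qed.

Lemma Cn_0 (E F : tvsType R[i]) (L U : set E) (f : E -> F) :
  cont_on U f -> Cn 0 L U f.
Proof. by move=> /subspace_continuousP. Qed.

Lemma Cn_le n (E F : tvsType R[i]) (L U : set E) (f : E -> F) :
  Cn n.+1 L U f -> Cn n L U f.
Proof.
elim: n E L U f => [|n IH] E L U f; first by move=> /Cn_cont; exact: Cn_0.
by move=> /CnS[cf [df d h]]; apply/CnS; split => //; exists df => //; exact: IH.
Qed.

(** Segments between a point near x and a short displacement in a direction near w stay
    in the domain, uniformly in the segment parameter. *)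
Lemma near_segment (E : tvsType R[i]) (L U : set E) (X W : R -> E) x w :
  real_domain L U -> U x -> L w ->
  (\forall t \near (0 : R)^', L (X t)) -> (\forall t \near (0 : R)^', L (W t)) ->
  X @ 0^' --> x -> W @ 0^' --> w -> forall N, nbhs x N ->
  \forall t \near (0 : R)^', forall s, 0 <= s -> s <= 1 ->
     U (X t + (s * t)%:C *: W t) /\ N (X t + (s * t)%:C *: W t).
Proof.
move=> [L0 LD LZ Lc LU Lo] Ux Lw LX LW Xx Ww N Nx.
have [N' N'x N'U] := Lo _ Ux.
have h : (fun p : R^o * (E * E) => p.2.1 + (p.1%:C) *: p.2.2) @ (0 : R^o, (x, w)) --> x.
  have e : x = x + 0%:C *: w by rewrite rmorph0 scale0r addr0.
  rewrite [X in _ --> X]e.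
  apply: tvs_cvgD; first by apply: (@cvg_comp _ _ _ snd fst); [exact: cvg_snd|exact: cvg_fst].
  apply: tvs_cvgZ.
    by apply: real_complex_cvg; exact: cvg_fst.
  by apply: (@cvg_comp _ _ _ snd snd); [exact: cvg_snd|exact: cvg_snd].
have [[A B] /= [A0 [[B1 B2] /= [B1x B2w] B12]] AB] := h _ (filterI N'x Nx).
have [d /= d0 Ad] := (nbhs_ballP _ _).1 A0.
near=> t => s s0 s1.
have Lt : L (X t + (s * t)%:C *: W t).
  by apply: LD; [near: t|apply: LZ; near: t].
have [Nt N't] : (N' `&` N) (X t + (s * t)%:C *: W t).
  apply: (AB (s * t, (X t, W t))); split => /=.
    apply: Ad; rewrite -ball_normE /= sub0r normrN normrM (ger0_norm s0).
    rewrite (@le_lt_trans _ _ `|t|)//; first by rewrite ler_piMl.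
    by near: t; apply/near0P; exists d.
  by apply: B12; split => /=; near: t; [exact: Xx|exact: Ww].
by split => //; exact: N'U.
Unshelve. all: by end_near. Qed.

Lemma dnbhs_scale (t : R) : t != 0 -> (fun h : R => h * t) @ 0^' --> (0 : R)^'.
Proof.
move=> t0 P /near0P[d d0 H]; apply/near0P; exists (d / `|t|).
  by rewrite divr_gt0// normr_gt0.
move=> h hd h0; apply: H; last by rewrite mulf_neq0.
by rewrite normrM -ltr_pdivlMr// normr_gt0.
Qed.

(** Base point and direction may move with t: by the mean value estimate the difference
    quotient lies in every closed convex neighbourhood which contains df at all points
    of the segment, and df is continuous. The chain rule, the additivity of derivatives
    and the derivatives along curves in the group all rest on this. *)
Lemma strict_derivative (E F : tvsType R[i]) (L U : set E) (f : E -> F) df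
    (X W : R -> E) x w :
  real_domain L U -> deriv_on L U f df -> cont_on (U `*` L) df ->
  U x -> L w ->
  (\forall t \near (0 : R)^', L (X t)) -> (\forall t \near (0 : R)^', L (W t)) ->
  X @ 0^' --> x -> W @ 0^' --> w ->
  (fun t : R => (t%:C)^-1 *: (f (X t + t%:C *: W t) - f (X t))) @ 0^' --> df (x, w).
Proof.
move=> dom d cd Ux Lw LX LW Xx Ww N Ndf.
have [K [Ko Kx cK KN]] := tvs_convex_nbhs Ndf.
have [[A B] /= [Ax Bw] AB] := cd (x, w) (conj Ux Lw) K (open_nbhs_nbhs (conj Ko Kx)).
have seg := near_segment dom Ux Lw LX LW Xx Ww Ax.
suff : \forall t \near (0 : R)^', N ((t%:C)^-1 *: (f (X t + t%:C *: W t) - f (X t))) by [].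
near=> t.
have t0 : t != 0 by near: t; apply/near0P; exists 1.
have Lt : L (W t) by near: t.
have Bt : B (W t) by near: t; exact: Ww.
have segt : forall s, 0 <= s -> s <= 1 -> U (X t + (s * t)%:C *: W t) /\
  A (X t + (s * t)%:C *: W t).
  by near: t; exact: seg.
apply: KN.
pose phi s := (t%:C)^-1 *: f (X t + (s * t)%:C *: W t).
have -> : t%:C^-1 *: (f (X t + t%:C *: W t) - f (X t)) = phi 1 - phi 0.
  by rewrite /phi mul1r mul0r rmorph0 scale0r addr0 scalerBr.
apply: mean_value => // s s0 s1.
have [Us As] := segt s s0 s1.
have Ks : K (df (X t + (s * t)%:C *: W t, W t)) by apply: (AB (_, _)).
pose y := X t + (s * t)%:C *: W t.
have H : \forall h \near (0 : R)^', K (((h * t)%:C)^-1 *: (f (y + (h * t)%:C *: W t) - f y)).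
  exact: (cvg_comp _ _ (dnbhs_scale t0) (d _ _ Us Lt) _ (open_nbhs_nbhs (conj Ko Ks))).
apply: filterS H => h.
rewrite /phi -scalerBr scalerA rmorphM invfM mulrDl [(s * t + _)%:C]rmorphD scalerDl addrA.
by rewrite /y rmorphM.
Unshelve. all: by end_near. Qed.

End Domains.

Section CnTheory.
Context {R : realType}.
Implicit Types E F G : tvsType R[i].

Lemma cvg_incr E (x v : E) : (fun t : R => x + t%:C *: v) @ 0^' --> x.
Proof.
rewrite [X in _ --> X](_ : x = x + 0%:C *: v); last by rewrite rmorph0 scale0r addr0.
apply: tvs_cvgD; first exact: cvg_cst.
apply: tvs_cvgZ; last exact: cvg_cst.
by apply: real_complex_cvg; apply: cvg_within.
Qed.

Lemma cvg_cst0 E (x : E) : (fun _ : R => x) @ 0^' --> x.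
Proof. exact: cvg_cst. Qed.

Lemma near_incr E (L U : set E) x v : real_domain L U -> U x -> L v ->
  \forall t \near (0 : R)^', U (x + t%:C *: v).
Proof.
move=> dom Ux Lv.
have nx : \forall t \near (0 : R)^', L x by apply: filterE => t; exact: rd_sub dom _ Ux.
have nv : \forall t \near (0 : R)^', L v by exact: filterE.
have h := near_segment dom Ux Lv nx nv (@cvg_cst0 E x) (@cvg_cst0 E v)
  (@filterT _ (nbhs x) (nbhs_filter x)).
apply: filterS h => t /(_ 1 ler01 (lexx _)) [].
by rewrite mul1r.
Unshelve. all: by end_near.
Qed.

Lemma cont_on_comp (E F G : topologicalType) (U : set E) (W : set F) (f : F -> G) (g : E -> F) :
  cont_on U g -> cont_on W f -> (forall x, U x -> W (g x)) -> cont_on U (f \o g).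
Proof.
move=> cg cf gU x Ux A Afx.
have := cg x Ux _ (cf _ (gU _ Ux) A Afx).
rewrite /fmap /within /= !nbhs_simpl /=.
by apply: filterS => y h Uy; apply: h => //; exact: gU.
Qed.

Lemma cont_on_pair (E F G : topologicalType) (U : set E) (f : E -> F) (g : E -> G) :
  cont_on U f -> cont_on U g -> cont_on U (fun x => (f x, g x)).
Proof. by move=> cf cg x Ux; apply: cvg_pair; [exact: cf|exact: cg]. Qed.

Lemma cont_onS (E F : topologicalType) (U V : set E) (f : E -> F) :
  V `<=` U -> cont_on U f -> cont_on V f.
Proof.
move=> VU cf x Vx A /(cf x (VU _ Vx)).
rewrite /fmap /within /= !nbhs_simpl /=.
by apply: filterS => y h Vy; apply: h; exact: VU.
Qed.

Lemma continuous_cont_on (E F : topologicalType) (U : set E) (f : E -> F) :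
  continuous f -> cont_on U f.
Proof. by move=> cf x _; apply: cvg_within_filter; exact: cf. Qed.

Lemma CnW n E F (L U L' U' : set E) (f : E -> F) :
  L' `<=` L -> U' `<=` U -> Cn n L U f -> Cn n L' U' f.
Proof.
elim: n E L U L' U' f => [|n IH] E L U L' U' f LL UU.
  by move=> /Cn_cont c; apply: Cn_0; exact: cont_onS c.
move=> /CnS[c [df d h]]; apply/CnS; split; first exact: cont_onS c.
exists df; first by move=> x v /UU Ux /LL; exact: d.
by apply: IH h => -[x v] [/= a b]; split => /=; [exact: LL|exact: LL|exact: UU|exact: LL].
Qed.

Lemma deriv_on_ext E F (L U : set E) (f g : E -> F) df : real_domain L U ->
  (forall x, U x -> f x = g x) -> deriv_on L U f df -> deriv_on L U g df.
Proof.
move=> dom fg d x v Ux Lv; apply: cvg_trans (d x v Ux Lv); apply: near_eq_cvg.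
near do (rewrite -?fg//).
by apply: near_incr dom Ux Lv.
Unshelve. all: by end_near. Qed.

Lemma cont_on_ext (E F : topologicalType) (U : set E) (f g : E -> F) :
  (forall x, U x -> f x = g x) -> cont_on U f -> cont_on U g.
Proof.
move=> fg c x Ux; rewrite -fg//; apply: cvg_trans (c x Ux).
apply: near_eq_cvg; rewrite near_withinE; near=> y => Uy; exact: fg.
Unshelve. all: by end_near.
Qed.

Lemma Cn_ext n E F (L U : set E) (f g : E -> F) : real_domain L U ->
  (forall x, U x -> f x = g x) -> Cn n L U f -> Cn n L U g.
Proof.
move=> dom fg; case: n => [|n].
  by move=> /Cn_cont c; apply: Cn_0; exact: cont_on_ext c.
move=> /CnS[c [df d h]]; apply/CnS; split; first exact: cont_on_ext c.
by exists df => //; exact: deriv_on_ext d.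
Qed.

Lemma Cn_pair n E F G (L U : set E) (f : E -> F) (g : E -> G) :
  Cn n L U f -> Cn n L U g -> Cn n L U (fun x => (f x, g x)).
Proof.
elim: n E L U F G f g => [|n IH] E L U F G f g.
  by move=> /Cn_cont cf /Cn_cont cg; apply: Cn_0; exact: cont_on_pair.
move=> /CnS[cf [df d h]] /CnS[cg [dg e k]]; apply/CnS; split; first exact: cont_on_pair.
exists (fun p => (df p, dg p)); last exact: IH.
move=> x v Ux Lv; apply: (@cvg_trans _
  ((fun t : R => ((t%:C)^-1 *: (f (x + t%:C *: v) - f x),
  (t%:C)^-1 *: (g (x + t%:C *: v) - g x))) @ 0^')).
  exact: cvg_refl.
by apply: cvg_pair; [exact: d|exact: e].
Qed.

Definition real_linear_on E F (L : set E) (f : E -> F) :=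
  forall x v (t : R), L x -> L v -> f (x + t%:C *: v) = f x + t%:C *: f v.

Lemma cvg_dq E (a b : E) (h : R -> E) :
  (\forall t \near (0 : R)^', h t = a + t%:C *: b) ->
  (fun t : R => (t%:C)^-1 *: (h t - a)) @ 0^' --> b.
Proof.
move=> hE; apply: cvg_near_cst; near=> t.
have t0 : t != 0 by near: t; apply/near0P; exists 1.
rewrite (_ : h t = a + t%:C *: b); last by near: t.
rewrite addrC addKr scalerA mulVf ?scale1r//.
by rewrite realC_eq0.
Unshelve. all: by end_near. Qed.

Lemma Cn_linear n E F (L U : set E) (f : E -> F) :
  real_domain L U -> real_linear_on L f -> cont_on L f -> Cn n L U f.
Proof.
elim: n E L U f => [|n IH] E L U f dom lf cf.
  by apply: Cn_0; exact: cont_onS (rd_sub dom) cf.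
apply/CnS; split; first exact: cont_onS (rd_sub dom) cf.
exists (f \o snd).
  move=> x v Ux Lv; apply: cvg_dq; apply: filterE => t; rewrite lf//.
  exact: rd_sub dom _ Ux.
apply: IH.
- by apply: real_domainM => //; exact: real_domain_full dom.
- by move=> [x x'] [v v'] t [/= _ Lx'] [/= _ Lv'] /=; exact: lf.
- apply: (cont_on_comp (W := L)) => //; last by move=> ? [].
  by apply: continuous_cont_on => x; exact: cvg_snd.
Qed.

Lemma Cn_cst n E F (L U : set E) (c : F) : Cn n L U (fun _ : E => c).
Proof.
have cc (E' : tvsType R[i]) (V : set E') (b : F) : cont_on V (fun _ : E' => b).
  by move=> x _; exact: cvg_cst.
elim: n E L U c => [|n IH] E L U c; first exact: Cn_0.
apply/CnS; split => //; exists (fun=> 0) => // x v _ _.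
by apply: cvg_dq; apply: filterE => t; rewrite scaler0 addr0.
Qed.

Lemma Cn_fst n E F (L U : set E) (M W : set F) :
  real_domain L U -> real_domain M W -> Cn n (L `*` M) (U `*` W) (@fst E F).
Proof.
move=> dL dM; apply: Cn_linear => //; first exact: real_domainM.
by apply: continuous_cont_on => x; exact: cvg_fst.
Qed.

Lemma Cn_snd n E F (L U : set E) (M W : set F) :
  real_domain L U -> real_domain M W -> Cn n (L `*` M) (U `*` W) (@snd E F).
Proof.
move=> dL dM; apply: Cn_linear => //; first exact: real_domainM.
by apply: continuous_cont_on => x; exact: cvg_snd.
Qed.

(** A map with values in a real subspace has its difference quotients, hence its
    derivatives, in this subspace. *)
Lemma deriv_on_closed E F (L U : set E) (M W : set F) (f : E -> F) df :
  real_domain L U -> real_domain M W -> deriv_on L U f df ->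
  (forall x, U x -> W (f x)) -> forall x v, U x -> L v ->
  (\forall t \near (0 : R)^', M ((t%:C)^-1 *: (f (x + t%:C *: v) - f x))) /\ M (df (x, v)).
Proof.
move=> dL dM d fW x v Ux Lv.
have near_M : \forall t \near (0 : R)^', M ((t%:C)^-1 *: (f (x + t%:C *: v) - f x)).
  have := near_incr dL Ux Lv; apply: filterS => t Ut.
  rewrite -fmorphV; apply: (rdZ dM); apply: (rdD dM).
    exact: (rd_sub dM) (fW _ Ut).
  rewrite -scaleN1r -(rmorph1 (real_complex R)) -rmorphN; apply: (rdZ dM).
  exact: (rd_sub dM) (fW _ Ux).
split => //.
by apply: closed_cvg (d x v Ux Lv) => //; exact: rd_closed dM.
Qed.

Lemma deriv_on_comp E F G (L U : set E) (M W : set F) (f : F -> G) (g : E -> F) df dg :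
  real_domain L U -> real_domain M W -> (forall x, U x -> W (g x)) ->
  cont_on U g -> deriv_on L U g dg -> deriv_on M W f df -> cont_on (W `*` M) df ->
  deriv_on L U (f \o g) (fun p => df (g p.1, dg p)).
Proof.
move=> dL dM gW cg dgP dfP cdf x v Ux Lv.
have [nM Mdg] := deriv_on_closed dL dM dgP gW Ux Lv.
have nM' : \forall t \near (0 : R)^', M (g x).
  by apply: filterE => t; exact: (rd_sub dM) (gW _ Ux).
have := strict_derivative dM dfP cdf (gW _ Ux) Mdg nM' nM (@cvg_cst0 F (g x)) (dgP x v Ux Lv).
apply: cvg_trans; apply: near_eq_cvg; near=> t => /=.
have t0 : t != 0 by near: t; apply/near0P; exists 1.
rewrite scalerA mulfV ?scale1r; first by rewrite (addrC (g x)) subrK.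
by rewrite realC_eq0.
Unshelve. all: by end_near. Qed.

(** The derivative of a composite is df composed with (g x, dg (x, v)), a map of the
    same form with one derivative less. *)
Lemma Cn_comp n E F G (L U : set E) (M W : set F) (f : F -> G) (g : E -> F) :
  real_domain L U -> real_domain M W -> (forall x, U x -> W (g x)) ->
  Cn n M W f -> Cn n L U g -> Cn n L U (f \o g).
Proof.
elim: n E F G L U M W f g => [|n IH] E F G L U M W f g dL dM gW.
  by move=> /Cn_cont cf /Cn_cont cg; apply: Cn_0; exact: cont_on_comp gW.
move=> /CnS[cf [df d hdf]] Cg; have /CnS[cg [dg e hdg]] := Cg.
apply/CnS; split; first exact: cont_on_comp gW.
exists (fun p => df (g p.1, dg p)).
  exact: deriv_on_comp gW cg e d (Cn_cont hdf).
have dLL := real_domain_full dL; have dMM := real_domain_full dM.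
apply: (IH _ _ _ _ _ _ _ df (fun p => (g p.1, dg p)) _ (real_domainM dM dMM)) => //.
- exact: real_domainM.
- move=> [x v] [/= Ux Lv]; split; first exact: gW.
  by have [] := deriv_on_closed dL dM e gW Ux Lv.
- apply: Cn_pair => //.
  apply: (IH _ _ _ _ _ _ _ g fst (real_domainM dL dLL) dL) => //.
  + by move=> x [].
  + exact: Cn_le Cg.
  + exact: Cn_fst.
Qed.

Lemma Cn_add n E F (L U : set E) (f g : E -> F) : real_domain L U ->
  Cn n L U f -> Cn n L U g -> Cn n L U (fun x => f x + g x).
Proof.
move=> dom Cf Cg.
have dT := @real_domainT R (F * F)%type.
apply: (@Cn_comp n E _ F L U setT setT (fun p : F * F => p.1 + p.2) (fun x => (f x, g x))) => //.
  apply: Cn_linear => //.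
    by move=> [x x'] [v v'] t _ _ /=; rewrite scalerDr addrACA.
  by apply: continuous_cont_on; exact: add_continuous.
exact: Cn_pair.
Qed.

Definition real_bilinear_on E F G (L : set E) (M : set F) (b : E * F -> G) :=
  (forall y, M y -> real_linear_on L (fun x => b (x, y))) /\
  (forall x, L x -> real_linear_on M (fun y => b (x, y))).

(** The derivative of b at (x, y) in direction (v, w) is b (x, w) + b (v, y), again made
    of b and linear maps. *)
Lemma Cn_bilinear n E F G (L : set E) (M : set F) (b : E * F -> G) :
  real_domain L L -> real_domain M M -> real_bilinear_on L M b -> cont_on (L `*` M) b ->
  Cn n (L `*` M) (L `*` M) b.
Proof.
elim: n => [|n IH] dL dM [b1 b2] cb; first exact: Cn_0.
apply/CnS; split => //.
have dLM := real_domainM dL dM; have dLMM := real_domainM dLM dLM.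
exists (fun p : (E * F) * (E * F) => b (p.1.1, p.2.2) + b (p.2.1, p.1.2)).
  move=> [x y] [v w] [/= Lx My] [/= Lv Mw].
  have e t : b (x + t%:C *: v, y + t%:C *: w) - b (x, y) =
     t%:C *: (b (x, w) + b (v, y)) + (t * t)%:C *: b (v, w).
    have Mw' : M (y + t%:C *: w) by apply: (rdD dM) => //; exact: (rdZ dM).
    rewrite b1// !b2// rmorphM -scalerA !scalerDr.
    by rewrite addrAC [_ + _ - b (x, y)]addrAC subrr add0r addrA.
  apply: (@cvg_trans _ ((fun t : R => (b (x, w) + b (v, y)) + t%:C *: b (v, w)) @ 0^')).
    apply: near_eq_cvg; near=> t; rewrite /= e.
    have t0 : t%:C != 0 :> R[i].
      rewrite realC_eq0.
      by near: t; apply/near0P; exists 1.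
    by rewrite scalerDr rmorphM !scalerA mulVf// scale1r mulrA mulVf// mul1r.
  exact: cvg_incr.
have lin (k : (E * F) * (E * F) -> E * F) :
    (forall x v (t : R), k (x + t%:C *: v) = k x + t%:C *: k v) -> continuous k ->
    (forall x, ((L `*` M) `*` (L `*` M)) x -> (L `*` M) (k x)) ->
    Cn n ((L `*` M) `*` (L `*` M)) ((L `*` M) `*` (L `*` M)) (b \o k).
  move=> kl kc kLM; apply: (Cn_comp _ dLM) => //; first exact: IH.
  apply: Cn_linear => //; exact: continuous_cont_on.
apply: Cn_add => //; apply: (lin (fun p => (_, _))).
- by [].
- move=> x; apply: cvg_pair.
    by apply: (@cvg_comp _ _ _ fst fst); [exact: cvg_fst|exact: cvg_fst].
  by apply: (@cvg_comp _ _ _ snd snd); [exact: cvg_snd|exact: cvg_snd].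
- by move=> [[x y] [v w]] [[/= a c] [/= d e]].
- by [].
- move=> x; apply: cvg_pair.
    by apply: (@cvg_comp _ _ _ snd fst); [exact: cvg_snd|exact: cvg_fst].
  by apply: (@cvg_comp _ _ _ fst snd); [exact: cvg_fst|exact: cvg_snd].
- by move=> [[x y] [v w]] [[/= a c] [/= d e]].
Unshelve. all: by end_near. Qed.

(** A map of class C^n for every n has one derivative for each n; they agree because
    limits are unique. *)
Lemma smooth_deriv E F (L U : set E) (f : E -> F) : hausdorff_space F ->
  real_domain L U -> smooth_map L U f ->
  exists2 df, deriv_on L U f df & smooth_map (L `*` L) (U `*` L) df.
Proof.
move=> hF dom sf; have /CnS[c [df d _]] := sf 1%N; exists df => // n.
have /CnS[_ [dg e h]] := sf n.+1.
apply: Cn_ext h; first by apply: real_domainM => //; exact: real_domain_full dom.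
by move=> [x v] [/= Ux Lv]; apply: cvg_unique (e x v Ux Lv) (d x v Ux Lv).
Qed.

(** Split the increment t (v + w) at x + t v; the second half is a difference quotient
    with moving base point. *)
Lemma deriv_on_additive E F (L U : set E) (f : E -> F) df : hausdorff_space F ->
  real_domain L U -> deriv_on L U f df -> cont_on (U `*` L) df ->
  forall x v w, U x -> L v -> L w -> df (x, v + w) = df (x, v) + df (x, w).
Proof.
move=> hF dom d cdf x v w Ux Lv Lw.
suff : (fun t : R => (t%:C)^-1 *: (f (x + t%:C *: (v + w)) - f x)) @ 0^' --> df (x, v) + df (x, w).
  by move=> k; apply: cvg_unique (d x (v + w) Ux (rdD dom Lv Lw)) k.
have n1 : \forall t \near (0 : R)^', L (x + t%:C *: v).
  by apply: filterE => t; apply: (rdD dom); [exact: (rd_sub dom)|exact: (rdZ dom)].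
have n2 : \forall t \near (0 : R)^', L w by exact: filterE.
have h := strict_derivative dom d cdf Ux Lw n1 n2 (@cvg_incr E x v) (@cvg_cst0 E w).
have k := tvs_cvgD _ (d x v Ux Lv) h.
apply: cvg_trans (k _).
apply: near_eq_cvg; apply: filterE => t.
rewrite -scalerDr [_ *: (v + w)]scalerDr; congr (_ *: _).
by rewrite addrC subrKA [x + (_ + _)]addrA.
Qed.

End CnTheory.

(** * Series and fixed points in normed spaces *)

Section NormR.
Context {R : realType}.
Implicit Types E : normedModType R[i].

Lemma normR0 E : normR (0 : E) = 0.
Proof. by rewrite /normR normr0. Qed.

Lemma normRN E (x : E) : normR (- x) = normR x.
Proof. by rewrite /normR normrN. Qed.

Lemma normRBC E (x y : E) : normR (x - y) = normR (y - x).
Proof. by rewrite -normRN opprB. Qed.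

Lemma normRB E (x y : E) : normR (x - y) <= normR x + normR y.
Proof. by rewrite -(normRN y); exact: normRD. Qed.

Lemma normR_eq0 E (x : E) : normR x = 0 -> x = 0.
Proof. by move=> x0; apply: normr0_eq0; rewrite normRE x0. Qed.

Lemma Re_normr_real (t : R) : complex.Re `|t%:C| = `|t|.
Proof. by rewrite normc_def /= expr0n /= addr0 sqrtr_sqr. Qed.

Lemma normRZr E (t : R) (x : E) : normR (t%:C *: x) = `|t| * normR x.
Proof. by rewrite normRZ Re_normr_real. Qed.

Lemma normR_sub_le E (x y : E) : normR x - normR y <= normR (x - y).
Proof. by rewrite lerBlDr -{1}(subrK y x); exact: normRD. Qed.

Lemma normR_dist3 E (x y z : E) : normR (x - z) <= normR (x - y) + normR (y - z).
Proof. by rewrite -(subrKA y x (- z)); exact: normRD. Qed.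

Lemma normR_sum E (u : nat -> E) m n :
  normR (\sum_(m <= k < n) u k) <= \sum_(m <= k < n) normR (u k).
Proof.
elim/big_ind2 : _ => //; first by rewrite normR0.
by move=> x1 x2 y1 y2 a b; apply: le_trans (normRD _ _) _; exact: lerD.
Qed.

Lemma cvg_normRP E (T : Type) (F : set_system T) (FF : Filter F) (f : T -> E) (l : E) :
  f @ F --> l <-> forall e : R, 0 < e -> \forall x \near F, normR (f x - l) < e.
Proof.
split=> [/cvgrPdist_lt h e e0|h].
  have e0c : 0 < e%:C by rewrite ltcE /= eqxx.
  have := h _ e0c; apply: filterS => x.
  by rewrite normRE ltcR normRBC.
apply/cvgrPdist_lt => -[a b]; rewrite ltcE /= => /andP[/eqP -> a0].
have := h _ a0; apply: filterS => x.
by rewrite normRE ltcR normRBC.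
Qed.

Lemma nbhs_normRP E (x : E) (P : set E) :
  nbhs x P <-> exists2 e : R, 0 < e & forall y, normR (y - x) < e -> P y.
Proof.
split.
  move=> /nbhs_ballP[[a b]] /=; rewrite ltcE /= => /andP[/eqP b0 a0] H.
  exists a => // y ya; apply: H; rewrite -ball_normE /= b0 normRE ltcR normRBC//.
move=> [e e0 H]; apply/nbhs_ballP; exists (e%:C) => /=; first by rewrite ltcE /= eqxx.
by move=> y; rewrite -ball_normE /= normRE ltcR normRBC; exact: H.
Qed.

Lemma normR_cvg E (T : Type) (F : set_system T) (FF : Filter F) (f : T -> E) (l : E) :
  f @ F --> l -> (fun x => normR (f x)) @ F --> normR l.
Proof.
move=> /cvg_normRP h; apply/cvgrPdist_lt => e e0.
have := h e e0; apply: filterS => x; apply: le_lt_trans.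
rewrite distrC ler_norml normR_sub_le andbT lerNl opprB normRBC.
exact: normR_sub_le.
Qed.

Lemma normR_lim_le E (T : Type) (F : set_system T) (FF : ProperFilter F) (f : T -> E)
  (l : E) (M : R) :
  f @ F --> l -> (\forall x \near F, normR (f x) <= M) -> normR l <= M.
Proof.
move=> fl fM; apply/ler_addgt0Pr => e e0.
near F => x.
have h1 : normR (f x) <= M by near: x.
have h2 : normR (f x - l) < e by near: x; apply/cvg_normRP: e e0.
have := le_trans (normR_sub_le l (f x)); move=> /(_ _ (lexx _)).
rewrite lerBlDr => h; apply: (le_trans h); rewrite addrC lerD//.
by rewrite normRBC ltW.
Unshelve. all: by end_near. Qed.

Lemma normR_pair (E F : normedModType R[i]) (p : E * F) :
  normR p = Num.max (normR p.1) (normR p.2).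
Proof.
rewrite /normR prod_normE /= !normRE.
by rewrite !maxEle lecR /=; case: ifP.
Qed.

(** Completeness as convergence of series dominated by a convergent real series. This
    form passes to products and to spaces of operators, and the exponential and the
    fixed point theorem use completeness through series. *)
Definition abs_complete E := forall (u : nat -> E) (b : nat -> R),
  (forall k, normR (u k) <= b k) -> cvgn (series b) -> cvgn (series u).

Lemma complete_abs (E : completeNormedModType R[i]) : abs_complete E.
Proof.
move=> u b ub /cauchy_cvgP/cauchy_seriesP cb.
apply/cauchy_cvgP/cauchy_seriesP => -[e1 e2]; rewrite ltcE /= => /andP[/eqP -> e0].
have := cb _ e0; apply: filterS => -[m n] /= h.
rewrite normRE ltcR; apply: le_lt_trans h.
apply: (le_trans (normR_sum _ _ _)); apply: le_trans (ler_norm _).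
exact: ler_sum.
Qed.

Lemma series_fst (E F : normedModType R[i]) (u : nat -> E * F) n :
  (series u n).1 = series (fun k => (u k).1) n.
Proof. by apply: (big_morph fst). Qed.

Lemma series_snd (E F : normedModType R[i]) (u : nat -> E * F) n :
  (series u n).2 = series (fun k => (u k).2) n.
Proof. by apply: (big_morph snd). Qed.

Lemma abs_complete_pair (E F : normedModType R[i]) :
  abs_complete E -> abs_complete F -> abs_complete (E * F)%type.
Proof.
move=> aE aF u b ub cb.
have [c1 c2] : cvgn (series (fun k => (u k).1)) /\ cvgn (series (fun k => (u k).2)).
  split; [apply: aE cb|apply: aF cb] => k; apply: le_trans (ub k);
    by rewrite normR_pair le_max lexx ?orbT.
have -> : series u = fun n => (series (fun k => (u k).1) n, series (fun k => (u k).2) n).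
  by apply/funext => n; rewrite -series_fst -series_snd; case: (series u n).
by apply/cvg_ex; exists (limn (series (fun k => (u k).1)), limn (series (fun k => (u k).2)));
  apply: cvg_pair.
Qed.

(** The product with its normed module structure, named so that constructions for a
    normed module E apply to pairs. *)
Definition prodN (E F : normedModType R[i]) : normedModType R[i] := (E * F)%type.

Lemma series_lim_pair (E F : normedModType R[i]) (u : nat -> prodN E F) :
  cvgn (series u) -> limn (series u) =
   (limn (series (fun k => (u k).1)), limn (series (fun k => (u k).2))) :> E * F.
Proof.
move=> cu.
have h1 : series (fun k => (u k).1) @ \oo --> (limn (series u)).1.
  rewrite (_ : series (fun k => (u k).1) = fst \o (series u)); last first.
    by apply/funext => n /=; rewrite -series_fst.
  by apply: (cvg_comp _ _ cu); exact: cvg_fst.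
have h2 : series (fun k => (u k).2) @ \oo --> (limn (series u)).2.
  rewrite (_ : series (fun k => (u k).2) = snd \o (series u)); last first.
    by apply/funext => n /=; rewrite -series_snd.
  by apply: (cvg_comp _ _ cu); exact: cvg_snd.
rewrite (cvg_lim (@norm_hausdorff _ _) h1) (cvg_lim (@norm_hausdorff _ _) h2).
by case: (limn _).
Qed.

Lemma series_tail E (u : nat -> E) (b : nat -> R) n : abs_complete E ->
  (forall k, normR (u k) <= b k) -> cvgn (series b) ->
  normR (limn (series u) - series u n) <= limn (series b) - series b n.
Proof.
move=> aE ub cb; have cu := aE _ _ ub cb.
have h : (fun m => series u m - series u n) @ \oo --> limn (series u) - series u n.
  by apply: cvgB => //; exact: cvg_cst.
apply: (normR_lim_le _ h).
near=> m; have nm : (n <= m)%N by near: m; exact: nbhs_infty_ge.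
rewrite sub_series_geq//; apply: (le_trans (normR_sum _ _ _)).
apply: (@le_trans _ _ (series b m - series b n)).
  by rewrite sub_series_geq//; exact: ler_sum.
rewrite lerB//; apply: nondecreasing_cvgn_le => //.
apply/nondecreasing_seqP => k; rewrite /series /= big_nat_recr//= lerDl.
by rewrite (le_trans (normR_ge0 _) (ub k)).
Unshelve. all: by end_near. Qed.

(** Dominated convergence for series. *)
Lemma tannery E (T : Type) (F : set_system T) (FF : ProperFilter F)
    (u : T -> nat -> E) (l : nat -> E) (b : nat -> R) : abs_complete E ->
  (forall k, (fun x => u x k) @ F --> l k) ->
  (\forall x \near F, forall k, normR (u x k) <= b k) -> cvgn (series b) ->
  (fun x => limn (series (u x))) @ F --> limn (series l).
Proof.
move=> aE ul ub cb.
have lb k : normR (l k) <= b k.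
  by apply: (normR_lim_le _ (ul k)); apply: filterS ub.
apply/cvg_normRP => e e0.
have e3 : 0 < e / 3 by rewrite divr_gt0.
have /cvgrPdist_lt/(_ _ e3)[N _ /(_ N (leqnn _)) hN] := cb.
have {}hN : limn (series b) - series b N < e / 3 by apply: le_lt_trans hN; exact: ler_norm.
have sN : (fun x => series (u x) N) @ F --> series l N.
  elim: N {hN} => [|n IH]; first by rewrite /series /= big_nil; under eq_fun do rewrite big_nil;
    exact: cvg_cst.
  rewrite seriesSr; under eq_fun do rewrite seriesSr.
  by apply: cvgD => //; exact: ul.
have /cvg_normRP/(_ _ e3) := sN.
apply: filterS2 ub => x ux hx.
have h1 := le_lt_trans (series_tail N aE ux cb) hN.
have h2 := le_lt_trans (series_tail N aE lb cb) hN.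
apply: (le_lt_trans (normR_dist3 _ (series (u x) N) _)).
rewrite (_ : e = e / 3 + (e / 3 + e / 3)); last by field.
rewrite ltrD//; apply: (le_lt_trans (normR_dist3 _ (series l N) _)).
by rewrite ltrD// normRBC.
Qed.

(** The iterates form a telescoping series dominated by a geometric one. *)
Lemma contraction_fixed E (S : set E) (f : E -> E) (q : R) : abs_complete E ->
  closed S -> S !=set0 -> (forall x, S x -> S (f x)) -> q < 1 ->
  (forall x y, S x -> S y -> normR (f x - f y) <= q * normR (x - y)) ->
  exists2 x, S x & f x = x.
Proof.
move=> aE cS [x0 Sx0] fS q1 fq.
wlog q0 : q q1 fq / 0 <= q.
  move=> h; apply: (h (Num.max q 0)).
  - by rewrite gt_max q1 ltr01.
  - move=> x y Sx Sy; apply: (le_trans (fq x y Sx Sy)); rewrite ler_wpM2r ?normR_ge0//.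
    by rewrite le_max lexx.
  - by rewrite le_max lexx orbT.
pose y n := iter n f x0.
have Sy n : S (y n) by elim: n => //= n IH; exact: fS.
have dy n : normR (y n.+1 - y n) <= geometric (normR (f x0 - x0)) q n.
  rewrite /geometric /=; elim: n => [|n IH]; first by rewrite expr0 mulr1.
  apply: (le_trans (fq _ _ (Sy _) (Sy _))); rewrite exprS mulrCA.
  by rewrite ler_wpM2l.
have : cvgn (series (fun n => y n.+1 - y n)).
  apply: aE dy _; apply: is_cvg_geometric_series.
  by rewrite ger0_norm.
rewrite (_ : series _ = fun n => y n - x0); last first.
  apply/funext => n; rewrite /series /= -[x0]/(y 0%N).
  by rewrite telescope_sumr.
move=> cy.
have {}cy : cvgn y.
  have -> : y = fun n => (y n - x0) + x0 by apply/funext => n; rewrite subrK.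
  by apply: is_cvgD => //; exact: is_cvg_cst.
exists (limn y); first by apply: (closed_cvg _ cS _ _ cy); exact: nearW.
have SL : S (limn y) by apply: (closed_cvg _ cS _ _ cy); exact: nearW.
suff h : (fun n => y n.+1) @ \oo --> f (limn y).
  have h2 : (fun n => y n.+1) @ \oo --> limn y by rewrite -cvg_shiftS in cy.
  by apply: (cvg_unique _ h h2); exact: norm_hausdorff.
apply/cvg_normRP => e e0.
have /cvg_normRP/(_ _ e0) := cy; apply: filterS => n h.
apply: le_lt_trans h; apply: (le_trans (fq _ _ (Sy _) SL)).
by rewrite ler_piMl ?normR_ge0// ltW.
Qed.

End NormR.

(** * The exponential of a bounded bilinear product *)

Section BanachAlgebraExp.
Context {R : realType}.
Implicit Types E : normedModType R[i].

(** The dual numbers over such a product are again of this kind, with a larger constant;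
    this makes the induction in [Cn_bexp] possible. *)
Record bounded_mul E (mul : E -> E -> E) (K : R) : Prop := BoundedMul {
  bm_bilin : bilinear_mul mul;
  bm_ge0 : 0 <= K;
  bm_bound : forall x y, normR (mul x y) <= K * normR x * normR y }.

Section Mul.
Context {E : normedModType R[i]} (mul : E -> E -> E) (K : R) (mulP : bounded_mul mul K).

Lemma mulbDr x y z : mul x (y + z) = mul x y + mul x z.
Proof. by have := (bm_bilin mulP).1 x 1 y z; rewrite !scale1r. Qed.
Lemma mulbDl x y z : mul (x + y) z = mul x z + mul y z.
Proof. by have := (bm_bilin mulP).2 z 1 x y; rewrite !scale1r. Qed.
Lemma mulb0 x : mul x 0 = 0.
Proof. by apply: (addIr (mul x 0)); rewrite -mulbDr !add0r. Qed.
Lemma mul0b x : mul 0 x = 0.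
Proof. by apply: (addIr (mul 0 x)); rewrite -mulbDl !add0r. Qed.
Lemma mulbZr c x y : mul x (c *: y) = c *: mul x y.
Proof. by have := (bm_bilin mulP).1 x c y 0; rewrite mulb0 !addr0. Qed.
Lemma mulbZl c x y : mul (c *: x) y = c *: mul x y.
Proof. by have := (bm_bilin mulP).2 y c x 0; rewrite /= mul0b !addr0. Qed.
Lemma mulbNr x y : mul x (- y) = - mul x y.
Proof. by rewrite -scaleN1r mulbZr scaleN1r. Qed.
Lemma mulbNl x y : mul (- x) y = - mul x y.
Proof. by rewrite -scaleN1r mulbZl scaleN1r. Qed.
Lemma mulbBr x y z : mul x (y - z) = mul x y - mul x z.
Proof. by rewrite mulbDr mulbNr. Qed.
Lemma mulbBl x y z : mul (x - y) z = mul x z - mul y z.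
Proof. by rewrite mulbDl mulbNl. Qed.

Lemma mul_cvg (T : Type) (F : set_system T) (FF : Filter F) (f g : T -> E) a b :
  f @ F --> a -> g @ F --> b -> (fun x => mul (f x) (g x)) @ F --> mul a b.
Proof.
move=> fa gb; apply/cvg_normRP => e e0.
have K0 := bm_ge0 mulP.
pose M := K * (normR a + normR b + 2) + 1.
have M0 : 0 < M by rewrite ltr_wpDl// mulr_ge0// !addr_ge0// normR_ge0.
pose d := Num.min 1 (e / M).
have d0 : 0 < d by rewrite lt_min ltr01 divr_gt0.
have /cvg_normRP/(_ _ d0) := fa; have /cvg_normRP/(_ _ d0) := gb.
apply: filterS2 => x gx fx.
have -> : mul (f x) (g x) - mul a b = mul (f x - a) (g x) + mul a (g x - b).
  by rewrite mulbBl mulbBr subrKA.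
apply: (le_lt_trans (normRD _ _)).
have gxb : normR (g x) <= normR b + 1.
  rewrite -lerBlDl (le_trans (normR_sub_le _ _))// (le_trans (ltW gx))//.
  by rewrite ge_min lexx.
have h1 : normR (mul (f x - a) (g x)) <= K * d * (normR b + 1).
  apply: (le_trans (bm_bound mulP _ _)).
  apply: ler_pM; rewrite ?mulr_ge0 ?normR_ge0//.
  by rewrite ler_wpM2l// ltW.
have h2 : normR (mul a (g x - b)) <= K * normR a * d.
  apply: (le_trans (bm_bound mulP _ _)).
  by rewrite ler_wpM2l ?mulr_ge0 ?normR_ge0// ltW.
apply: (le_lt_trans (lerD h1 h2)).
apply: (@lt_le_trans _ _ (M * d)); last first.
  by rewrite mulrC -ler_pdivlMr// ge_min lexx orbT.
rewrite /M; nra.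
Qed.

Lemma mul_cont : continuous (fun p : E * E => mul p.1 p.2).
Proof. by move=> p; apply: mul_cvg; [exact: cvg_fst|exact: cvg_snd]. Qed.

Variable one : E.
Definition bpow k x := iter k (mul x) one.
Definition bterm x k := (k`!%:R : R[i])^-1 *: bpow k x.
Definition bexp x := limn (series (bterm x)).

Lemma natC (k : nat) : (k%:R : R[i]) = (k%:R : R)%:C.
Proof. by rewrite rmorph_nat. Qed.

Lemma normR_bterm c x k : normR ((k`!%:R : R[i])^-1 *: (x : E)) <= c / k`!%:R <-> normR x <= c.
Proof.
rewrite natC -fmorphV normRZr ger0_norm ?invr_ge0// mulrC.
by rewrite ler_pM2r ?invr_gt0// ltr0n fact_gt0.
Qed.

Lemma bpow_bound x k : normR (bpow k x) <= (K * normR x) ^+ k * normR one.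
Proof.
elim: k => [|k IH] /=; first by rewrite expr0 mul1r.
apply: (le_trans (bm_bound mulP _ _)); rewrite exprS -[leRHS]mulrA.
by rewrite ler_wpM2l// mulr_ge0 ?normR_ge0//; exact: bm_ge0 mulP.
Qed.

Lemma exp_majorant_cvg (M c : R) : cvgn (series (fun k => M ^+ k * c / k`!%:R)).
Proof.
rewrite (_ : series _ = fun n => c * series (exp_coeff M) n); last first.
  apply/funext => n; rewrite /series /= mulr_sumr; apply: eq_bigr => k _.
  by rewrite /exp_coeff /=; ring.
by apply: is_cvgMr; exact: is_cvg_series_exp_coeff.
Qed.

Lemma bterm_bound x (M : R) : K * normR x <= M ->
  forall k, normR (bterm x k) <= M ^+ k * normR one / k`!%:R.
Proof.
move=> xM k; apply/normR_bterm; apply: (le_trans (bpow_bound _ _)).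
rewrite ler_wpM2r ?normR_ge0// lerXn2r// nnegrE ?mulr_ge0 ?normR_ge0 ?(bm_ge0 mulP)//.
by apply: le_trans xM; rewrite mulr_ge0 ?normR_ge0 ?(bm_ge0 mulP).
Qed.

Hypothesis aE : abs_complete E.

Lemma bexp_cvgn x : series (bterm x) @ \oo --> bexp x.
Proof. by apply: (aE (bterm_bound (lexx _))); exact: exp_majorant_cvg. Qed.

Lemma bpow_cvg (T : Type) (F : set_system T) (FF : Filter F) (f : T -> E) a k :
  f @ F --> a -> (fun x => bpow k (f x)) @ F --> bpow k a.
Proof. by move=> fa; elim: k => [|k IH]; [exact: cvg_cst|exact: mul_cvg]. Qed.

Lemma bexp_cont : continuous bexp.
Proof.
move=> x; apply: (@tannery R E E (nbhs x) _ bterm (bterm x)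
   (fun k => (K * (normR x + 1)) ^+ k * normR one / k`!%:R) aE).
- by move=> k; apply: cvgZr; exact: bpow_cvg.
- apply/nbhs_normRP; exists 1 => // y xy k; apply: bterm_bound.
  rewrite ler_wpM2l ?(bm_ge0 mulP)// -lerBlDl.
  by rewrite (le_trans (normR_sub_le _ _))// ltW.
- exact: exp_majorant_cvg.
Qed.

(** The derivative of x |-> x^k in direction z, which is the second component of (x +
    eps z)^k. *)
Fixpoint dpow k x z : E := if k is k'.+1 then mul x (dpow k' x z) + mul z (bpow k' x) else 0.

Definition dexp x z := limn (series (fun k => (k`!%:R : R[i])^-1 *: dpow k x z)).

Definition qpow k x z (t : R) := (t%:C)^-1 *: (bpow k (x + t%:C *: z) - bpow k x).

Lemma qpowS k x z (t : R) : t != 0 ->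
  qpow k.+1 x z t = mul (x + t%:C *: z) (qpow k x z t) + mul z (bpow k x).
Proof.
move=> t0; have tC : t%:C != 0 :> R[i] by rewrite realC_eq0.
rewrite /qpow mulbZr mulbBr /= -[mul z _]scale1r -(mulVf tC) -scalerA -mulbZl -scalerDr.
by congr (_ *: _); rewrite -addrA; congr (_ + _); rewrite mulbDl opprD subrK.
Qed.

Lemma qpow_cvg k x z : qpow k x z @ 0^' --> dpow k x z.
Proof.
elim: k => [|k IH].
  rewrite /qpow /=; under eq_fun do rewrite subrr scaler0; exact: cvg_cst.
apply: (@cvg_trans _ ((fun t => mul (x + t%:C *: z) (qpow k x z t) + mul z (bpow k x)) @ 0^')).
  apply: near_eq_cvg; near=> t; rewrite qpowS//; near: t.
  by apply/near0P; exists 1.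
by apply: cvgD; [apply: mul_cvg => //; exact: cvg_incr|exact: cvg_cst].
Unshelve. all: by end_near. Qed.

(** A bound for the difference quotients of x^k that is summable against 1/k!, so that
    [tannery] differentiates the exponential series term by term. *)
Lemma qpow_bound k x z (t : R) : t != 0 -> `|t| <= 1 ->
  normR (qpow k x z t) <= (2 * (K * (normR x + normR z))) ^+ k * normR one.
Proof.
move=> t0 t1; pose M := K * (normR x + normR z).
have M0 : 0 <= M by rewrite mulr_ge0 ?addr_ge0 ?normR_ge0// (bm_ge0 mulP).
have K0 := bm_ge0 mulP.
elim: k => [|k IH].
  by rewrite /qpow subrr scaler0 normR0 mulr_ge0 ?normR_ge0.
rewrite qpowS//; apply: (le_trans (normRD _ _)).
have h1 : normR (mul (x + t%:C *: z) (qpow k x z t)) <= M * ((2 * M) ^+ k * normR one).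
  apply: (le_trans (bm_bound mulP _ _)); apply: ler_pM; rewrite ?mulr_ge0 ?normR_ge0//.
  rewrite ler_wpM2l// (le_trans (normRD _ _))// lerD// normRZr.
  by rewrite ler_piMl ?normR_ge0.
have h2 : normR (mul z (bpow k x)) <= M * ((2 * M) ^+ k * normR one).
  apply: (le_trans (bm_bound mulP _ _)); apply: ler_pM; rewrite ?mulr_ge0 ?normR_ge0//.
    by rewrite ler_wpM2l// lerDr normR_ge0.
  apply: (le_trans (bpow_bound _ _)); apply: ler_wpM2r; first exact: normR_ge0.
  apply: lerXn2r; rewrite ?nnegrE.
  - by apply: mulr_ge0 => //; exact: normR_ge0.
  - exact: mulr_ge0.
  - apply: (@le_trans _ _ M); first by rewrite ler_wpM2l// lerDl normR_ge0.
    by rewrite ler_peMl// ler1n.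
apply: (le_trans (lerD h1 h2)).
by rewrite exprS -!mulrA -mulr2n -[leLHS]mulr_natl.
Qed.

Lemma bexp_derive x z :
  (fun t : R => (t%:C)^-1 *: (bexp (x + t%:C *: z) - bexp x)) @ 0^' --> dexp x z.
Proof.
have h : (fun t => limn (series (fun k => (k`!%:R : R[i])^-1 *: qpow k x z t))) @ 0^' --> dexp x z.
  apply: (@tannery R E R _ _ (fun t k => (k`!%:R : R[i])^-1 *: qpow k x z t)
   (fun k => (k`!%:R : R[i])^-1 *: dpow k x z)
   (fun k => (2 * (K * (normR x + normR z))) ^+ k * normR one / k`!%:R) aE).
  - by move=> k; apply: cvgZr; exact: qpow_cvg.
  - apply/near0P; exists 1 => // t t1 t0 k; apply/normR_bterm; apply: qpow_bound => //.
    exact: ltW.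
  - exact: exp_majorant_cvg.
apply: cvg_trans h; apply: near_eq_cvg; apply: filterE => t.
have -> : series (fun k => (k`!%:R : R[i])^-1 *: qpow k x z t) =
  fun n => (t%:C)^-1 *: (series (bterm (x + t%:C *: z)) n - series (bterm x) n).
  apply/funext => n; rewrite /series /= -sumrB scaler_sumr; apply: eq_bigr => k _.
  by rewrite /qpow /bterm -scalerBr !scalerA mulrC.
apply: cvg_lim; first exact: norm_hausdorff.
by apply: cvgZr; apply: cvgB; exact: bexp_cvgn.
Qed.

End Mul.

(** Multiplication of the dual numbers x + eps z with eps^2 = 0. *)
Definition dual_mul E (mul : E -> E -> E) (p q : prodN E E) : prodN E E :=
  (mul p.1 q.1, mul p.1 q.2 + mul p.2 q.1).

Lemma dual_bounded_mul E (mul : E -> E -> E) K :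
  bounded_mul mul K -> bounded_mul (dual_mul mul) (2 * K).
Proof.
move=> mP; split.
- split=> [[a b] c [x y] [x' y']|[a b] c [x y] [x' y']]; rewrite /dual_mul /=.
    congr pair; rewrite /= ?(mulbDr mP) ?(mulbZr mP)//.
    by rewrite scalerDr addrACA.
  congr pair; rewrite /= ?(mulbDl mP) ?(mulbZl mP)//.
  by rewrite scalerDr addrACA.
- by rewrite mulr_ge0// (bm_ge0 mP).
- move=> [a b] [x y]; rewrite !normR_pair /dual_mul /=.
  have K0 := bm_ge0 mP.
  set A := Num.max (normR a) _; set B := Num.max (normR x) _.
  have aA : normR a <= A by rewrite le_max lexx.
  have bA : normR b <= A by rewrite le_max lexx orbT.
  have xB : normR x <= B by rewrite le_max lexx.
  have yB : normR y <= B by rewrite le_max lexx orbT.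
  have h u v : normR u <= A -> normR v <= B -> normR (mul u v) <= K * A * B.
    move=> uA vB; apply: (le_trans (bm_bound mP _ _)).
    by rewrite ler_pM ?mulr_ge0 ?normR_ge0// ler_wpM2l.
  have AB0 : 0 <= K * A * B.
    by rewrite !mulr_ge0// (le_trans (normR_ge0 _) aA, le_trans (normR_ge0 _) xB).
  rewrite ge_max; apply/andP; split.
    by rewrite (le_trans (h _ _ aA xB))// -!mulrA ler_peMl ?mulrA// ler1n.
  apply: (le_trans (normRD _ _)); apply: (le_trans (lerD (h _ _ aA yB) (h _ _ bA xB))).
  by lra.
Qed.

Lemma dual_bpow E (mul : E -> E -> E) K (one : E) x z k : bounded_mul mul K ->
  bpow (dual_mul mul) ((one, 0) : prodN E E) k (x, z) = (bpow mul one k x, dpow mul one k x z).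
Proof. by move=> mP; elim: k => //= k ->. Qed.

(** exp (x + eps z) = exp x + eps dexp (x, z). *)
Lemma dual_bexp E (mul : E -> E -> E) K (one : E) x z : bounded_mul mul K ->
  abs_complete E ->
  bexp (dual_mul mul) ((one, 0) : prodN E E) (x, z) = (bexp mul one x, dexp mul one x z).
Proof.
move=> mP aE; rewrite /bexp series_lim_pair; last first.
  by apply: cvgP; exact: (@bexp_cvgn _ _ _ (dual_bounded_mul mP) (one, 0)
    (abs_complete_pair aE aE) (x, z)).
by congr pair; congr (limn (series _)); apply/funext => k; rewrite /bterm (dual_bpow _ _ _ _ mP).
Qed.

Lemma dexp_cvgn E (mul : E -> E -> E) K (one : E) x z : bounded_mul mul K ->
  abs_complete E ->
  series (fun k => (k`!%:R : R[i])^-1 *: dpow mul one k x z) @ \oo --> dexp mul one x z.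
Proof.
move=> mP aE.
have h := @bexp_cvgn _ _ _ (dual_bounded_mul mP) (one, 0) (abs_complete_pair aE aE) (x, z).
rewrite (dual_bexp _ _ _ mP aE) in h.
rewrite (_ : series _ = snd \o series (bterm (dual_mul mul) ((one, 0) : prodN E E) (x, z))).
  by apply: (cvg_comp _ _ h); exact: cvg_snd.
apply/funext => n /=; rewrite series_snd; congr (series _ n); apply/funext => k.
by rewrite /bterm (dual_bpow _ _ _ _ mP).
Qed.

Lemma dexp_linear E (mul : E -> E -> E) K (one : E) x (c : R[i]) z z' : bounded_mul mul K ->
  abs_complete E -> dexp mul one x (c *: z + z') = c *: dexp mul one x z + dexp mul one x z'.
Proof.
move=> mP aE.
have h1 := @dexp_cvgn _ _ _ one x z mP aE.
have h2 := @dexp_cvgn _ _ _ one x z' mP aE.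
apply: cvg_lim; first exact: norm_hausdorff.
have h3 : (fun n => c *: series (fun k => (k`!%:R : R[i])^-1 *: dpow mul one k x z) n
   + series (fun k => (k`!%:R : R[i])^-1 *: dpow mul one k x z') n) @ \oo
     --> c *: dexp mul one x z + dexp mul one x z'.
  by apply: cvgD => //; exact: cvgZr.
rewrite (_ : series _ = (fun n => c *: series (fun k => (k`!%:R : R[i])^-1 *: dpow mul one k x z) n
   + series (fun k => (k`!%:R : R[i])^-1 *: dpow mul one k x z') n)); first exact: h3.
apply/funext => n; rewrite /series /= scaler_sumr -big_split /=.
apply: eq_bigr => k _; rewrite scalerA [c * _]mulrC -scalerA -scalerDr; congr (_ *: _).
elim: k => [|k IH] /=; first by rewrite scaler0 addr0.
by rewrite IH (mulbDr mP) (mulbDl mP) (mulbZr mP) (mulbZl mP) scalerDr addrACA.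
Qed.

(** By induction on n for all products at once: the derivative of exp is the second
    component of the exponential of dual numbers. *)
Lemma Cn_bexp n E (mul : E -> E -> E) (one : E) K : bounded_mul mul K -> abs_complete E ->
  Cn n [set: E] [set: E] (bexp mul one).
Proof.
elim: n E mul one K => [|n IH] E mul one K mP aE.
  by apply: Cn_0; apply: continuous_cont_on; exact: (@bexp_cont _ _ _ mP one aE).
apply/CnS; split; first by apply: continuous_cont_on; exact: (@bexp_cont _ _ _ mP one aE).
exists (fun p => dexp mul one p.1 p.2).
  by move=> x v _ _; exact: (@bexp_derive _ _ _ mP one aE x v).
have h := IH (prodN E E) _ (one, 0) _ (dual_bounded_mul mP) (abs_complete_pair aE aE).
have -> : (fun p => dexp mul one p.1 p.2) = snd \o bexp (dual_mul mul) ((one, 0) : prodN E E).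
  by apply/funext => -[x z] /=; rewrite (dual_bexp _ _ _ mP aE).
apply: (@CnW R n (prodN E E) E setT setT) => //.
apply: (Cn_comp _ _ _ _ h); first exact: real_domainT.
- exact: (real_domainM (@real_domainT _ E) (@real_domainT _ E)).
- by [].
- by apply: Cn_snd; exact: real_domainT.
Qed.

Lemma Cn_dexp n E (mul : E -> E -> E) (one : E) K : bounded_mul mul K -> abs_complete E ->
  Cn n [set: E * E] [set: E * E] (fun p => dexp mul one p.1 p.2).
Proof.
move=> mP aE.
have h := Cn_bexp n ((one, 0) : prodN E E) (dual_bounded_mul mP) (abs_complete_pair aE aE).
have -> : (fun p => dexp mul one p.1 p.2) = snd \o bexp (dual_mul mul) ((one, 0) : prodN E E).
  by apply/funext => -[x z] /=; rewrite (dual_bexp _ _ _ mP aE).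
apply: (Cn_comp _ _ _ _ h); first exact: real_domainT.
- exact: (real_domainM (@real_domainT _ E) (@real_domainT _ E)).
- by [].
- by apply: Cn_snd; exact: real_domainT.
Qed.

End BanachAlgebraExp.

(** * The exponential of an associative product *)

(** The ball of radius M + e is convex and contains the difference quotients. *)
Lemma mvt_normR (R : realType) (E : normedModType R[i]) (phi d : R -> E) (M : R) :
  (forall s, 0 <= s -> s <= 1 ->
     (fun t : R => (t%:C)^-1 *: (phi (s + t) - phi s)) @ 0^' --> d s) ->
  (forall s, 0 <= s -> s <= 1 -> normR (d s) <= M) -> normR (phi 1 - phi 0) <= M.
Proof.
move=> h hM; apply/ler_addgt0Pr => e e0; apply: ltW.
apply: (@mean_value _ _ phi [set x | normR x < M + e]).
  move=> x y t t0 t1 /= xe ye; apply: (le_lt_trans (normRD _ _)).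
  rewrite !normRZr !ger0_norm ?subr_ge0//.
  rewrite (_ : M + e = t * (M + e) + (1 - t) * (M + e)); last by ring.
  have [->|tn0] := eqVneq t 0; first by rewrite !mul0r !add0r subr0 !mul1r.
  apply: ltr_leD; first by rewrite ltr_pM2l// lt_neqAle eq_sym tn0.
  by rewrite ler_wpM2l ?subr_ge0// ltW.
move=> s s0 s1; have /cvg_normRP/(_ _ e0) := h s s0 s1; apply: filterS => t ht /=.
rewrite -(subrK (d s) (_ *: _)); apply: (le_lt_trans (normRD _ _)).
by rewrite addrC ler_ltD// hM.
Qed.

Section AssociativeExp.
Context {R : realType} {E : normedModType R[i]} (mul : E -> E -> E) (one : E).
Hypothesis mulP : bounded_mul mul (1 : R).
Hypothesis mulA : associative mul.
Hypothesis mul1 : left_id one mul.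
Hypothesis mulx1 : right_id one mul.
Hypothesis one1 : normR one <= 1.
Hypothesis aE : abs_complete E.
Local Notation bexp := (bexp mul one).
Local Notation dexp := (dexp mul one).
Local Notation bpow := (bpow mul one).
Local Notation dpow := (dpow mul one).
Local Notation "x ** y" := (mul x y) (at level 40, left associativity).

Lemma normR_mul x y : normR (x ** y) <= normR x * normR y.
Proof. by have := bm_bound mulP x y; rewrite mul1r. Qed.

Lemma bpow_comm x z k : x ** z = z ** x -> bpow k x ** z = z ** bpow k x.
Proof.
by move=> xz; elim: k => [|k IH] /=; rewrite ?mul1 ?mulx1// -mulA IH mulA xz mulA.
Qed.

Lemma bexp_comm x z : x ** z = z ** x -> bexp x ** z = z ** bexp x.
Proof.
move=> xz; have h := @bexp_cvgn _ _ _ _ mulP one aE x.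
have h1 : (fun n => series (bterm mul one x) n ** z) @ \oo --> bexp x ** z.
  by apply: (mul_cvg mulP) => //; exact: cvg_cst.
have h2 : (fun n => z ** series (bterm mul one x) n) @ \oo --> z ** bexp x.
  by apply: (mul_cvg mulP) => //; exact: cvg_cst.
have e : (fun n => series (bterm mul one x) n ** z) = fun n => z ** series (bterm mul one x) n.
  apply/funext => n; rewrite /series /=.
  elim/big_ind : _ => [|a b ha hb|k _]; first by rewrite (mulb0 mulP) (mul0b mulP).
    by rewrite (mulbDr mulP) (mulbDl mulP) ha hb.
  by rewrite /bterm (mulbZl mulP) (mulbZr mulP) bpow_comm.
by rewrite e in h1; apply: cvg_unique h1 h2; exact: norm_hausdorff.
Qed.

Lemma dpow_comm x z k : x ** z = z ** x ->
  dpow k.+1 x z = (k.+1%:R : R[i]) *: (z ** bpow k x).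
Proof.
move=> xz; elim: k => [|k IH]; first by rewrite /= (mulb0 mulP) add0r scale1r.
rewrite [LHS](_ : _ = x ** dpow k.+1 x z + z ** bpow k.+1 x)// IH (mulbZr mulP).
have -> : x ** (z ** bpow k x) = z ** bpow k.+1 x by rewrite mulA xz -mulA.
by rewrite -[in RHS]natr1 [in RHS]scalerDl scale1r.
Qed.

(** In a direction commuting with x the derivative of exp is the familiar z exp x. *)
Lemma dexp_comm x z : x ** z = z ** x -> dexp x z = z ** bexp x.
Proof.
move=> xz; apply: cvg_lim; first exact: norm_hausdorff.
rewrite -cvg_shiftS.
have h : (fun n => z ** series (bterm mul one x) n) @ \oo --> z ** bexp x.
  by apply: (mul_cvg mulP); [exact: cvg_cst|exact: (@bexp_cvgn _ _ _ _ mulP one aE x)].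
rewrite (_ : [sequence _]_n = fun n => z ** series (bterm mul one x) n); first exact: h.
apply/funext => n; rewrite /series /= big_nat_recl//= scaler0 add0r.
elim: n => [|n IH]; first by rewrite !big_nil (mulb0 mulP).
rewrite !big_nat_recr//= (mulbDr mulP) -IH; congr (_ + _).
rewrite [_ + _](_ : _ = dpow n.+1 x z)// dpow_comm// scalerA /bterm (mulbZr mulP).
congr (_ *: _); rewrite factS natrM invfM mulrAC mulVf ?mul1r// pnatr_eq0.
Qed.

Lemma bexp0 : bexp 0 = one.
Proof.
apply: cvg_lim; first exact: norm_hausdorff.
rewrite -cvg_shiftS (_ : [sequence _]_n = fun=> one); first exact: cvg_cst.
apply/funext => n; rewrite /series /= big_nat_recl//= big1 ?addr0.
  by rewrite /bterm fact0 invr1 scale1r.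
by move=> k _; rewrite /bterm /= (mul0b mulP) scaler0.
Qed.

Lemma cvg_dq_mul (f g : R -> E) (a b df dg : E) :
  f @ 0^' --> a -> (fun t => (t%:C)^-1 *: (f t - a)) @ 0^' --> df ->
  (fun t => (t%:C)^-1 *: (g t - b)) @ 0^' --> dg ->
  (fun t => (t%:C)^-1 *: (f t ** g t - a ** b)) @ 0^' --> df ** b + a ** dg.
Proof.
move=> fa hf hg.
have h1 : (fun t : R => ((t%:C)^-1 *: (f t - a)) ** b) @ 0^' --> df ** b.
  by apply: (mul_cvg mulP) => //; exact: cvg_cst.
have h2 : (fun t : R => f t ** ((t%:C)^-1 *: (g t - b))) @ 0^' --> a ** dg.
  exact: (mul_cvg mulP).
rewrite (_ : (fun t : R => _) = fun t : R => ((t%:C)^-1 *: (f t - a)) ** b + f t **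
  ((t%:C)^-1 *: (g t - b))).
  by rewrite addrC; rewrite addrC; apply: cvgD; [exact: h1|exact: h2].
apply/funext => t; rewrite (mulbZl mulP) (mulbZr mulP) -scalerDr; congr (_ *: _).
by rewrite (mulbBl mulP) (mulbBr mulP) [RHS]addrC subrKA.
Qed.

Lemma deriv0_cst (F : normedModType R[i]) (phi : R -> F) :
  (forall s, (fun t : R => (t%:C)^-1 *: (phi (s + t) - phi s)) @ 0^' --> (0 : F)) ->
  phi 1 = phi 0.
Proof.
move=> h; apply/eqP; rewrite -subr_eq0; apply/eqP; apply: normR_eq0.
apply/eqP; rewrite eq_le normR_ge0 andbT.
by apply: (@mvt_normR R F phi (fun=> 0)) => [s _ _|s _ _]; [exact: h|rewrite normR0].
Qed.

Lemma bexp_line_cvg x z : (fun t : R => bexp (x + t%:C *: z)) @ 0^' --> bexp x.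
Proof.
by apply: (cvg_comp _ _ (@cvg_incr _ E x z)); exact: (@bexp_cont _ _ _ _ mulP one aE).
Qed.

(** The curve s |-> exp (- s x) exp (s x + z) has derivative zero. *)
Lemma bexpD_aux x z : x ** z = z ** x -> bexp (- x) ** bexp (x + z) = bexp z.
Proof.
move=> xz.
pose phi (s : R) := bexp (- (s%:C *: x)) ** bexp (s%:C *: x + z).
have -> : bexp (- x) ** bexp (x + z) = phi 1 by rewrite /phi scale1r.
have -> : bexp z = phi 0 by rewrite /phi scale0r oppr0 bexp0 mul1 add0r.
apply: deriv0_cst => s.
pose u := - (s%:C *: x); pose v := s%:C *: x + z.
have ux : u ** (- x) = (- x) ** u.
  by rewrite /u !(mulbNl mulP) !(mulbNr mulP) (mulbZl mulP) (mulbZr mulP).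
have vx : v ** x = x ** v.
  by rewrite /v (mulbDl mulP) (mulbDr mulP) xz (mulbZl mulP) (mulbZr mulP).
have h := cvg_dq_mul (@bexp_line_cvg u (- x)) (@bexp_derive _ _ _ _ mulP one aE u (- x))
  (@bexp_derive _ _ _ _ mulP one aE v x).
rewrite !dexp_comm// in h.
have e : (- x ** bexp u) ** bexp v + bexp u ** (x ** bexp v) = 0.
  rewrite !(mulbNl mulP) [bexp u ** _]mulA [bexp u ** x]bexp_comm ?addNr//.
  by have := ux; rewrite !(mulbNl mulP) !(mulbNr mulP) => /oppr_inj.
rewrite e in h; apply: cvg_trans h; apply: near_eq_cvg; apply: filterE => t.
rewrite /phi /u /v rmorphD scalerDl opprD scalerN.
by rewrite -[s%:C *: x + z + _]addrA [z + _]addrC addrA.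
Qed.

Lemma bexpNl x : bexp (- x) ** bexp x = one.
Proof.
by have := @bexpD_aux x 0; rewrite addr0 bexp0; apply; rewrite (mulb0 mulP) (mul0b mulP).
Qed.

Lemma bexpNr x : bexp x ** bexp (- x) = one.
Proof. by have := bexpNl (- x); rewrite opprK. Qed.

Lemma bexpD x z : x ** z = z ** x -> bexp (x + z) = bexp x ** bexp z.
Proof. by move=> xz; rewrite -(bexpD_aux xz) mulA bexpNr mul1. Qed.

Lemma bpow_lip x y (r : R) k : normR x <= r -> normR y <= r ->
  normR (bpow k x - bpow k y) <= k%:R * r ^+ k.-1 * normR (x - y).
Proof.
move=> xr yr; have r0 : 0 <= r := le_trans (normR_ge0 x) xr.
have pr j : normR (bpow j y) <= r ^+ j.
  apply: (le_trans (bpow_bound mulP _ _ _)); rewrite mul1r -[X in _ <= X]mulr1; apply: ler_pM => //.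
  - by apply: exprn_ge0; exact: normR_ge0.
  - exact: normR_ge0.
  - by apply: lerXn2r; rewrite ?nnegrE ?normR_ge0.
elim: k => [|k IH]; first by rewrite subrr normR0 !mul0r.
have -> : bpow k.+1 x - bpow k.+1 y = x ** (bpow k x - bpow k y) + (x - y) ** bpow k y.
  by rewrite (mulbBr mulP) (mulbBl mulP) /= subrKA.
apply: (le_trans (normRD _ _)).
have h1 : normR (x ** (bpow k x - bpow k y)) <= k%:R * r ^+ k * normR (x - y).
  apply: (le_trans (normR_mul _ _)); case: k IH => [|k] IH.
    by rewrite subrr normR0 mulr0 !mul0r.
  apply: (le_trans (ler_pM (normR_ge0 _) (normR_ge0 _) xr IH)).
  by rewrite exprS /= !mulrA [r * _]mulrC.
have h2 : normR ((x - y) ** bpow k y) <= r ^+ k * normR (x - y).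
  apply: (le_trans (normR_mul _ _)); rewrite mulrC.
  by rewrite ler_wpM2r ?normR_ge0.
apply: (le_trans (lerD h1 h2)); rewrite -natr1 /=; lra.
Qed.

(** The majorant e^2 of the exponential series beyond its linear term, for arguments of
    norm at most 1. *)
Definition expC : R := limn (series (fun k => 2 ^+ k * 1 / k`!%:R : R)).

(** exp x - exp y differs from x - y by the terms of degree at least 2 of the series,
    each of which is Lipschitz with a constant proportional to r. *)
Lemma bexp_lip x y (r : R) : r <= 1 -> normR x <= r -> normR y <= r ->
  normR (bexp x - bexp y - (x - y)) <= expC * r * normR (x - y).
Proof.
move=> r1 xr yr; have r0 : 0 <= r := le_trans (normR_ge0 x) xr.
pose w k := bterm mul one x k - bterm mul one y k - (if k == 1%N then x - y else 0).
(* The majorant comes from k r^(k-1) <= r 2^k for k >= 2 and r <= 1. *)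
pose b k := r * normR (x - y) * (2 ^+ k * 1 / k`!%:R : R).
have wb k : normR (w k) <= b k.
  rewrite /w /b; case: k => [|[|k]].
  - by rewrite /bterm /= !subrr normR0 !mulr_ge0 ?normR_ge0// invr_ge0.
  - rewrite /bterm /= !mulx1 invr1 !scale1r subrr normR0.
    by rewrite !mulr_ge0 ?normR_ge0.
  - rewrite /= subr0 /bterm -scalerBr.
    rewrite mulr1 mulrA; apply/normR_bterm; apply: (le_trans (bpow_lip k.+2 xr yr)).
    have key : k.+2%:R * r ^+ k.+1 <= r * 2 ^+ k.+2.
      rewrite mulrC; apply: ler_pM => //; first exact: exprn_ge0.
        by rewrite exprS ler_piMr// exprn_ile1.
      by rewrite -natrX ler_nat ltnW// ltn_expl.
    by apply: (le_trans (ler_wpM2r (normR_ge0 _) key)); rewrite mulrAC.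
have cb : cvgn (series b).
  rewrite (_ : series b = fun n => r * normR (x - y) * series (fun k => 2 ^+ k * 1 / k`!%:R : R) n).
    by apply: is_cvgMr; exact: exp_majorant_cvg.
  by apply/funext => n; rewrite /series /= mulr_sumr.
have lb : limn (series b) = expC * r * normR (x - y).
  rewrite -mulrA mulrC; apply: cvg_lim => //.
  rewrite (_ : series b = fun n => r * normR (x - y) * series (fun k => 2 ^+ k * 1 / k`!%:R : R) n).
    by apply: cvgMr; exact: exp_majorant_cvg.
  by apply/funext => n; rewrite /series /= mulr_sumr.
have := series_tail 0 aE wb cb; rewrite lb /series /= !big_geq// !subr0.
congr (normR _ <= _); apply: cvg_lim; first exact: norm_hausdorff.
rewrite -cvg_shiftS -cvg_shiftS.
have h : (fun n => series (bterm mul one x) n.+2 - series (bterm mul one y) n.+2 - (x - y)) @ \oo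
  --> bexp x - bexp y - (x - y).
  apply: cvgB; last exact: cvg_cst.
  by apply: cvgB; rewrite (cvg_shiftS (fun n => series _ n.+1)) cvg_shiftS;
    exact: (@bexp_cvgn _ _ _ _ mulP one aE).
rewrite (_ : [sequence _]_n = fun n => series (bterm mul one x) n.+2 - series (bterm mul one y)
  n.+2 - (x - y)); first exact: h.
apply/funext => n; rewrite /series /= -sumrB.
rewrite /w [LHS]sumrB; congr (_ - _).
by rewrite big_nat_recl// big_nat_recl//= big1 ?addr0 ?add0r.
Qed.

Lemma dexp_near x z (r : R) : r <= 1 -> normR x < r ->
  normR (dexp x z - z) <= expC * r * normR z.
Proof.
move=> r1 xr.
have h : (fun t : R => (t%:C)^-1 *: (bexp (x + t%:C *: z) - bexp x) - z) @ 0^' --> dexp x z - z.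
  by apply: cvgB; [exact: (@bexp_derive _ _ _ _ mulP one aE)|exact: cvg_cst].
have d0 : 0 < (r - normR x) by rewrite subr_gt0.
have p0 : 0 < normR z + 1 by rewrite ltr_wpDl ?normR_ge0.
apply: (normR_lim_le _ h); near=> t.
have t0 : t != 0 by near: t; apply/near0P; exists 1.
have tC : t%:C != 0 :> R[i] by rewrite realC_eq0.
have xt : normR (x + t%:C *: z) <= r.
  have tz : `|t| * normR z <= r - normR x.
    rewrite (@le_trans _ _ (`|t| * (normR z + 1)))//; first by rewrite ler_wpM2l// lerDl.
    rewrite -ler_pdivlMr//; apply: ltW.
    near: t; apply/near0P; exists ((r - normR x) / (normR z + 1)) => //.
    exact: divr_gt0.
  by apply: (le_trans (normRD _ _)); rewrite normRZr addrC -lerBrDr.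
have := bexp_lip r1 xt (ltW xr); rewrite [x + _ - x]addrAC subrr add0r => hl.
have -> : (t%:C)^-1 *: (bexp (x + t%:C *: z) - bexp x) - z =
    (t^-1)%:C *: (bexp (x + t%:C *: z) - bexp x - t%:C *: z).
  by rewrite fmorphV [RHS]scalerBr scalerA mulVf// scale1r.
rewrite normRZr normfV mulrC ler_pdivrMr ?normr_gt0//; apply: (le_trans hl).
by rewrite normRZr mulrA mulrAC.
Unshelve. all: by end_near. Qed.

End AssociativeExp.

(** * Operators on a Hilbert space with real structure *)

Section BopAlgebra.
Context {R : realType} {V : normedModType R[i]}.
Implicit Types f g : bop V.

Lemma bop0 f : f 0 = 0.
Proof.
have h := bop_linear f (-1) 0 0.
by rewrite /= !scaleN1r oppr0 addr0 addNr in h.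
Qed.
Lemma bopD f x y : f (x + y) = f x + f y.
Proof. by have := bop_linear f 1 x y; rewrite !scale1r. Qed.
Lemma bopZ f (c : R[i]) x : f (c *: x) = c *: f x.
Proof. by have := bop_linear f c x 0; rewrite !addr0 bop0 addr0. Qed.

Lemma bop_apply_le f x : normR (f x) <= normR f * normR x.
Proof.
have [->|x0] := eqVneq x 0; first by rewrite bop0 !normR0 mulr0.
have nx : 0 < normR x.
  by rewrite lt_def normR_ge0 andbT; apply: contraNneq x0 => /normR_eq0 ->.
have h : normR (((normR x)^-1)%:C *: x) <= 1.
  by rewrite normRZr ger0_norm ?invr_ge0 ?normR_ge0// mulVf// gt_eqF.
have := opnorm_ub f h; rewrite bopZ normRZr ger0_norm ?invr_ge0 ?normR_ge0//.
by rewrite ler_pdivrMl// mulrC.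
Qed.

Lemma bop_norm_le f (M : R) : (forall x, normR x <= 1 -> normR (f x) <= M) -> normR f <= M.
Proof. exact: opnorm_le. Qed.

Lemma bop_comp_bounded : bounded_mul (@bop_comp R V) 1.
Proof.
split => //.
- split=> [f c g h|h c f g]; apply: val_inj; apply/funext => x.
    by rewrite /= /bop_comp /= bopD bopZ.
  by [].
- move=> f g; rewrite mul1r; apply: bop_norm_le => x x1 /=.
  apply: (le_trans (bop_apply_le f (g x))); rewrite ler_wpM2l ?normR_ge0//.
  by apply: (le_trans (bop_apply_le _ _)); rewrite ler_piMr ?normR_ge0.
Qed.

Lemma bop_compA : associative (@bop_comp R V).
Proof. by move=> f g h; apply: val_inj. Qed.
Lemma bop_comp1 : left_id (bop_id V) (@bop_comp R V).
Proof. by move=> f; apply: val_inj. Qed.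
Lemma bop_compr1 : right_id (bop_id V) (@bop_comp R V).
Proof. by move=> f; apply: val_inj. Qed.
Lemma bop_id_norm : normR (bop_id V) <= 1.
Proof. exact: bop_norm_le. Qed.

Lemma bop_expE f : bop_exp f = bexp (@bop_comp R V) (bop_id V) f.
Proof. by []. Qed.

Lemma bop_apply_cvg (T : Type) (F : set_system T) (FF : Filter F) (f : T -> bop V) g x :
  f @ F --> g -> (fun t => f t x) @ F --> g x.
Proof.
move=> fg; apply/cvg_normRP => e e0.
have d0 : 0 < e / (normR x + 1) by rewrite divr_gt0// ltr_wpDl ?normR_ge0.
have /cvg_normRP/(_ _ d0) := fg; apply: filterS => t h.
have := bop_apply_le (f t - g) x; move=> /le_lt_trans; apply.
apply: (@le_lt_trans _ _ (normR (f t - g) * (normR x + 1))).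
  by rewrite ler_wpM2l ?normR_ge0// lerDl.
by rewrite -ltr_pdivlMr// ltr_wpDl ?normR_ge0.
Qed.

Lemma bop_eval_sum (u : nat -> bop V) n x : (series u n) x = series (fun k => u k x) n.
Proof. by apply: (@big_morph _ _ (fun f : bop V => f x)). Qed.

Hypothesis aV : abs_complete V.

(** The pointwise sum of the series is linear, bounded, and the limit in operator norm
    by the tail estimate. *)
Lemma bop_abs_complete : abs_complete (bop V).
Proof.
move=> u b ub cb.
have ubx x k : normR (u k x) <= b k * normR x.
  by apply: (le_trans (bop_apply_le _ _)); rewrite ler_wpM2r ?normR_ge0.
have cbx (x : V) : cvgn (series (fun k => b k * normR x)).
  rewrite (_ : series _ = fun n => series b n * normR x); first exact: is_cvgMl.
  by apply/funext => n; rewrite /series /= mulr_suml.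
have cux x : cvgn (series (fun k => u k x)) by exact: (aV (ubx x) (cbx x)).
pose U x := limn (series (fun k => u k x)).
have Ulin : linear U.
  move=> c x y; apply: cvg_lim; first exact: norm_hausdorff.
  rewrite (_ : series _ = fun n => c *: series (fun k => u k x) n + series (fun k => u k y) n).
    by apply: cvgD; [apply: cvgZr; exact: cux|exact: cux].
  by apply/funext => n; rewrite -!bop_eval_sum bopD bopZ.
have Ubnd : exists M : R, forall x, normR (U x) <= M * normR x.
  exists (limn (series b)) => x.
  have := series_tail 0 aV (ubx x) (cbx x); rewrite {2 4}/series /= !big_geq// !subr0.
  congr (_ <= _); apply: cvg_lim => //.
  rewrite (_ : series _ = fun n => series b n * normR x); first exact: cvgMl.
  by apply/funext => n; rewrite /series /= mulr_suml.
have Ub : U \in @bounded_linear_pred R V by apply/asboolP; split.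
apply/cvg_ex; exists (Bop Ub); apply/cvg_normRP => e e0.
have /cvgrPdist_lt/(_ _ e0) := cb; apply: filterS => n hn.
apply: le_lt_trans (le_lt_trans (ler_norm _) hn).
apply: bop_norm_le => x x1; rewrite [(_ - _ : bop V) x](_ : _ = series u n x - U x)//.
rewrite bop_eval_sum normRBC; apply: (series_tail n aV _ cb) => k.
apply: (le_trans (bop_apply_le _ _)); apply: le_trans (ub k).
by rewrite ler_piMr ?normR_ge0.
Qed.

End BopAlgebra.

Lemma conj_real (R : realType) (t : R) : Num.conj (t%:C) = t%:C :> R[i].
Proof.
apply: conj_Creal; case: (leP 0 t) => h; [apply: ger0_real|apply: ler0_real];
  by rewrite lecE /= eqxx ?h ?ltW.
Qed.

Section Hilbert.
Context {R : realType} {V : hilbertSpace R}.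

Lemma hdotDl (u v w : V) : hdot V (u + v) w = hdot V u w + hdot V v w.
Proof. exact: linearDl. Qed.
Lemma hdotZl c (u w : V) : hdot V (c *: u) w = c * hdot V u w.
Proof. exact: linearZl_LR. Qed.
Lemma hdotC (u w : V) : hdot V u w = Num.conj (hdot V w u).
Proof. by rewrite hermC expr0 mul1r. Qed.
Lemma hdotDr (u v w : V) : hdot V u (v + w) = hdot V u v + hdot V u w.
Proof. by rewrite hdotC hdotDl rmorphD [hdot V u v]hdotC [hdot V u w]hdotC. Qed.
Lemma hdotZr c (u w : V) : hdot V u (c *: w) = Num.conj c * hdot V u w.
Proof. by rewrite hdotC hdotZl rmorphM [hdot V u w]hdotC. Qed.
Lemma hdotNl (u w : V) : hdot V (- u) w = - hdot V u w.
Proof. by rewrite -scaleN1r hdotZl mulN1r. Qed.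
Lemma hdotNr (u w : V) : hdot V u (- w) = - hdot V u w.
Proof. by rewrite -scaleN1r hdotZr rmorphN rmorph1 mulN1r. Qed.

(** The Cauchy-Schwarz inequality, from the positivity of the norm of |w|^2 u - (u, w)
    w. *)
Lemma hdot_le (u w : V) : `|hdot V u w| <= `|u| * `|w|.
Proof.
have [->|w0] := eqVneq w 0.
  by rewrite normr0 mulr0 -(scale0r (0 : V)) hdotZr conjC0 mul0r normr0.
have n0 : 0 < `|w| ^+ 2 by rewrite exprn_gt0// normr_gt0.
pose a := hdot V u w; pose n := `|w| ^+ 2.
have nr : Num.conj n = n by apply: conj_Creal; rewrite ger0_real// ltW.
have h : 0 <= hdot V (n *: u - a *: w) (n *: u - a *: w).
  by rewrite -hdotE exprn_ge0.
rewrite !(hdotDl, hdotDr, hdotNl, hdotNr, hdotZl, hdotZr) -!hdotE -/n nr in h.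
rewrite -/a [hdot V w u]hdotC -/a in h.
(* The norm of |w|^2 u - (u, w) w, expanded. *)
have {}h : 0 <= n * (n * `|u| ^+ 2 - `|a| ^+ 2).
  by rewrite normCK; apply: le_trans h _; rewrite le_eqVlt; apply/orP; left; apply/eqP; ring.
rewrite pmulr_rge0// subr_ge0 in h.
rewrite -(@ler_pXn2r _ 2)// ?nnegrE ?mulr_ge0// exprMn mulrC.
exact: h.
Qed.

Lemma hdot_cvg (T : Type) (F : set_system T) (FF : Filter F) (f : T -> V) u w :
  f @ F --> u -> (fun t => hdot V (f t) w) @ F --> (hdot V u w : R[i]^o).
Proof.
move=> fu; apply/cvgrPdist_lt => e e0.
have d0 : 0 < e / (`|w| + 1) by rewrite divr_gt0// ltr_wpDl.
have /cvgrPdist_lt/(_ _ d0) := fu; apply: filterS => t h.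
rewrite -hdotNl -hdotDl; apply: (le_lt_trans (hdot_le _ _)).
apply: (@le_lt_trans _ _ (`|u - f t| * (`|w| + 1))).
  by rewrite ler_wpM2l// lerDl.
by rewrite -ltr_pdivlMr// ltr_wpDl.
Qed.

Lemma adjoint_sym (X Y : bop V) : is_adjoint X Y -> is_adjoint Y X.
Proof. by move=> h v w; rewrite hdotC -h [RHS]hdotC. Qed.

Lemma isometry_norm (f : V -> V) : (forall v, hdot V (f v) (f v) = hdot V v v) ->
  forall v, normR (f v) = normR v.
Proof.
move=> h v; suff e : `|f v| = `|v| by rewrite /normR e.
by apply/eqP; rewrite -(@eqrXn2 _ 2)// !hdotE h.
Qed.

End Hilbert.

Section RealStructure.
Context {R : realType} {V : hilbertSpace R} (alpha : V -> V).
Hypothesis alphaP : real_structure alpha.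

Lemma alphaD u v : alpha (u + v) = alpha u + alpha v.
Proof. by have := real_antilinear alphaP 1 u v; rewrite conjC1 !scale1r. Qed.
Lemma alpha0 : alpha 0 = 0.
Proof. by apply: (addIr (alpha 0)); rewrite -alphaD !add0r. Qed.
Lemma alphaZr (t : R) v : alpha (t%:C *: v) = t%:C *: alpha v.
Proof.
have := real_antilinear alphaP t%:C v 0; rewrite alpha0 !addr0 => ->.
by rewrite conj_real.
Qed.
Lemma alphaN v : alpha (- v) = - alpha v.
Proof. by apply: (addIr (alpha v)); rewrite -alphaD !addNr alpha0. Qed.

Lemma alpha_cvg (T : Type) (F : set_system T) (FF : Filter F) (f : T -> V) u :
  f @ F --> u -> (fun t => alpha (f t)) @ F --> alpha u.
Proof.
move=> fu; apply/cvg_normRP => e e0.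
have /cvg_normRP/(_ _ e0) := fu; apply: filterS => t.
rewrite -alphaN -alphaD (@isometry_norm _ _ alpha)// => v.
by apply: (real_antiunitary alphaP).
Qed.

(** Orthogonal group and Lie algebra are both described by this relation, with Y the
    inverse of X or its opposite; it is stable under sums, reversed products and limits,
    hence under power series. *)
Definition alpha_adj (X Y : bop V) :=
  is_adjoint X Y /\ forall v, X (alpha v) = alpha (X v).

Lemma alpha_adjD X Y X' Y' : alpha_adj X Y -> alpha_adj X' Y' -> alpha_adj (X + X') (Y + Y').
Proof.
move=> [a c] [a' c']; split => [v w|v].
  by rewrite [(_ + _ : bop V) v]/(X v + X' v) [(_ + _ : bop V) w]/(Y w + Y' w) hdotDl hdotDr a a'.
by rewrite [LHS](_ : _ = X (alpha v) + X' (alpha v))// c c' -alphaD.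
Qed.

Lemma alpha_adjZ (t : R) X Y : alpha_adj X Y -> alpha_adj (t%:C *: X) (t%:C *: Y).
Proof.
move=> [a c]; split => [v w|v].
  rewrite [(_ *: X : bop V) v]/(t%:C *: X v) [(_ *: Y : bop V) w]/(t%:C *: Y w) hdotZl hdotZr a.
  by rewrite conj_real.
by rewrite [LHS](_ : _ = t%:C *: X (alpha v))// c -alphaZr.
Qed.

Lemma alpha_adj0 : alpha_adj 0 0.
Proof.
split=> [v w|v]; last by rewrite [RHS]alpha0.
change (hdot V (0 : V) w = hdot V v 0); by rewrite -(scale0r (0 : V)) hdotZl hdotZr conjC0 !mul0r.
Qed.

Lemma alpha_adjM X Y X' Y' : alpha_adj X Y -> alpha_adj X' Y' ->
  alpha_adj (bop_comp X X') (bop_comp Y' Y).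
Proof. by move=> [a c] [a' c']; split => [v w|v] /=; [rewrite a a'|rewrite c' c]. Qed.

Lemma alpha_adj1 : alpha_adj (bop_id V) (bop_id V).
Proof. by split. Qed.

Lemma alpha_adj_cvg (T : Type) (F : set_system T) (FF : ProperFilter F) (f h : T -> bop V) X Y :
  f @ F --> X -> h @ F --> Y -> (\forall t \near F, alpha_adj (f t) (h t)) -> alpha_adj X Y.
Proof.
move=> fX hY adj; split=> [v w|v].
  have c1 : (fun t => hdot V (f t v) w) @ F --> (hdot V (X v) w : R[i]^o).
    by apply: hdot_cvg; exact: bop_apply_cvg.
  have c2 : (fun t => hdot V (f t v) w) @ F --> (hdot V v (Y w) : R[i]^o).
    have c3 : (fun t => Num.conj (hdot V (h t w) v)) @ F --> (hdot V v (Y w) : R[i]^o).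
      have c4 : (fun t => hdot V (h t w) v) @ F --> (hdot V (Y w) v : R[i]^o).
        by apply: hdot_cvg; exact: bop_apply_cvg.
      apply/cvgrPdist_lt => e e0; have /cvgrPdist_lt/(_ _ e0) := c4.
      apply: filterS => t; rewrite [hdot V v _]hdotC -rmorphB.
      by rewrite norm_conjC.
    apply: cvg_trans c3; apply: near_eq_cvg; apply: filterS adj => t [a _].
    by rewrite a -hdotC.
  by apply: cvg_unique c1 c2; exact: norm_hausdorff.
have c1 : (fun t => f t (alpha v)) @ F --> X (alpha v) by exact: bop_apply_cvg.
have c2 : (fun t => f t (alpha v)) @ F --> alpha (X v).
  have c3 : (fun t => alpha (f t v)) @ F --> alpha (X v).
    by apply: alpha_cvg; exact: bop_apply_cvg.
  by apply: cvg_trans c3; apply: near_eq_cvg; apply: filterS adj => t [_ ->].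
by apply: cvg_unique c1 c2; exact: norm_hausdorff.
Qed.

End RealStructure.

(** * Smoothness of inverses of linear families *)

Lemma cvg_to_within (T : Type) (E : topologicalType) (F : set_system T) (FF : Filter F)
    (f : T -> E) (x : E) (U : set E) :
  f @ F --> x -> (\forall t \near F, U (f t)) -> f @ F --> within U (nbhs x).
Proof.
move=> fx fU A hA; have h : \forall t \near F, U (f t) -> A (f t) by exact: (fx _ hA).
by apply: filterS2 h fU => t /[apply].
Qed.

Lemma cont_on_cvg (T : Type) (E G : topologicalType) (F : set_system T) (FF : Filter F)
    (g : E -> G) (f : T -> E) (x : E) (U : set E) : cont_on U g -> U x ->
  f @ F --> x -> (\forall t \near F, U (f t)) -> (fun t => g (f t)) @ F --> g x.
Proof.
move=> cg Ux fx fU; apply: (cvg_comp _ _ (cvg_to_within FF fx fU)).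
exact: cg.
Qed.

Section InverseFamily.
Context {R : realType} {E : tvsType R[i]} {F : normedModType R[i]}.
Variables (L U : set E) (M : set F) (Phi Psi : E * F -> F) (c : R).
Hypothesis dL : real_domain L U.
Hypothesis dM : real_domain M M.
Hypothesis Phi_smooth : smooth_map (L `*` M) (U `*` M) Phi.
Hypothesis Phi_lin : forall x, U x -> real_linear_on M (fun z => Phi (x, z)).
Hypothesis PhiM : forall x z, U x -> M z -> M (Phi (x, z)).
Hypothesis PsiM : forall x y, U x -> M y -> M (Psi (x, y)).
Hypothesis PhiK : forall x z, U x -> M z -> Psi (x, Phi (x, z)) = z.
Hypothesis PsiK : forall x y, U x -> M y -> Phi (x, Psi (x, y)) = y.
Hypothesis Psi_bound : forall x y, U x -> M y -> normR (Psi (x, y)) <= c * normR y.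

Lemma domB y z : M y -> M z -> M (y - z).
Proof.
move=> My Mz; apply: (rdD dM) => //; rewrite -scaleN1r -(rmorph1 (real_complex R)) -rmorphN.
exact: (rdZ dM).
Qed.

Lemma Psi_lin x : U x -> real_linear_on M (fun y => Psi (x, y)).
Proof.
move=> Ux y v t My Mv.
rewrite -[RHS](PhiK Ux); last by apply: (rdD dM); [exact: PsiM|apply: (rdZ dM); exact: PsiM].
by rewrite Phi_lin ?PsiK//; exact: PsiM.
Qed.

Lemma PsiB x y z : U x -> M y -> M z -> Psi (x, y - z) = Psi (x, y) - Psi (x, z).
Proof.
move=> Ux My Mz; have := Psi_lin Ux (-1) My Mz.
by rewrite rmorphN rmorph1 !scaleN1r.
Qed.

Lemma PsiZ x y (t : R) : U x -> M y -> Psi (x, t%:C *: y) = t%:C *: Psi (x, y).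
Proof.
move=> Ux My; have P0 : Psi (x, 0) = 0.
  by have := PsiB Ux My My; rewrite !subrr.
by have := Psi_lin Ux t (rd0 dM) My; rewrite P0 !add0r.
Qed.

(** Psi (x, y) - w is Psi (x, y - Phi (x, w)), which is small for (x, y) near the point
    where w = Psi (x, y). *)
Lemma Psi_cont : cont_on (U `*` M) Psi.
Proof.
move=> [x y] [/= Ux My]; pose w := Psi (x, y).
have Mw : M w by exact: PsiM.
have nU : \forall p \near within (U `*` M) (nbhs (x, y)), (U `*` M) p.
  by apply: withinT; exact: filter_filter.
have h : (fun p : E * F => p.2 - Phi (p.1, w)) @ within (U `*` M) (nbhs (x, y)) --> (0 : F).
  have e0 : 0 = y - Phi (x, w) by rewrite /w PsiK// subrr.
  rewrite [X in _ --> X]e0; apply: tvs_cvgB.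
    by apply: cvg_within_filter; exact: cvg_snd.
  have cP := @cont_on_comp _ _ _ (U `*` M) (U `*` M) Phi (fun p : E * F => (p.1, w)) _ _ _ (x, y)
    (conj Ux My).
  apply: cP; last by move=> [a b] [].
    apply: cont_on_pair; first by apply: continuous_cont_on => p; exact: cvg_fst.
    by move=> p _; exact: cvg_cst.
  exact: Cn_cont (Phi_smooth 0).
apply/cvg_normRP => e e0.
have c0 : 0 < `|c| + 1 by rewrite ltr_wpDl.
have /cvg_normRP/(_ _ (divr_gt0 e0 c0)) := h.
apply: filterS2 nU => -[x' y'] [/= Ux' My'].
rewrite subr0 => hp; rewrite -/w -{1}(PhiK Ux' Mw) -PsiB//; last exact: PhiM.
apply: (le_lt_trans (Psi_bound Ux' (domB My' (PhiM Ux' Mw)))).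
rewrite ltr_pdivlMr// in hp; apply: le_lt_trans hp; rewrite mulrC.
by rewrite ler_wpM2l ?normR_ge0// (le_trans (ler_norm c))// lerDl.
Qed.

(** Implicit differentiation of Phi (x, Psi (x, y)) = y. *)
Lemma Psi_deriv dPhi : deriv_on (L `*` M) (U `*` M) Phi dPhi ->
  deriv_on (L `*` M) (U `*` M) Psi
    (fun p => Psi (p.1.1, p.2.2 - dPhi ((p.1.1, Psi p.1), (p.2.1, 0)))).
Proof.
move=> d [x y] [z y'] [/= Ux My] [/= Lz My']; pose w := Psi (x, y).
have Mw : M w by exact: PsiM.
have h := d (x, w) (z, 0) (conj Ux Mw) (conj Lz (rd0 dM)).
pose q (t : R) := (t%:C)^-1 *: (Phi (x + t%:C *: z, w) - Phi (x, w)).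
have hq : q @ 0^' --> dPhi ((x, w), (z, 0)).
  apply: cvg_trans h; apply: near_eq_cvg; apply: filterE => t; rewrite /q.
  rewrite (_ : (x, w) + t%:C *: (z, 0) = (x + t%:C *: z, w))//.
  by apply: injective_projections => //=; rewrite scaler0 addr0.
have nU : \forall t \near (0 : R)^', U (x + t%:C *: z) by exact: near_incr dL Ux Lz.
have nM : \forall t \near (0 : R)^', M (q t).
  apply: filterS nU => t Ut; rewrite /q -fmorphV; apply: (rdZ dM).
  by apply: domB; exact: PhiM.
have dM' : M (dPhi ((x, w), (z, 0))).
  by apply: closed_cvg hq => //; exact: rd_closed dM.
have h2 : (fun t : R => (x + t%:C *: z, y' - q t)) @ 0^' --> (x, y' - dPhi ((x, w), (z, 0))).
  apply: cvg_pair; first exact: cvg_incr.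
  by apply: tvs_cvgB => //; exact: cvg_cst.
have h3 : (fun t : R => Psi (x + t%:C *: z, y' - q t)) @ 0^' -->
  Psi (x, y' - dPhi ((x, w), (z, 0))).
  apply: (cont_on_cvg _ Psi_cont _ h2); first by split => //; exact: domB.
  by apply: filterS2 nU nM => t Ut Mt; split => //=; exact: domB.
apply: cvg_trans h3; apply: near_eq_cvg; near=> t => /=.
have Ut : U (x + t%:C *: z) by near: t.
have Mt : M (q t) by near: t.
have t0 : t != 0 by near: t; apply/near0P; exists 1.
have tC : t%:C != 0 :> R[i] by rewrite realC_eq0.
have Mq : M (y' - q t) by exact: domB.
rewrite -fmorphV -[Psi (x, y)]/w -{1}(PhiK Ut Mw) -PsiB; last 3 first.
- by [].
- by apply: (rdD dM) => //; exact: (rdZ dM).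
- exact: PhiM.
rewrite -PsiZ//; last by apply: domB; [apply: (rdD dM) => //; exact: (rdZ dM)|exact: PhiM].
congr (Psi (_, _)).
rewrite -{1}(PsiK Ux My) -/w addrAC scalerDr scalerA fmorphV mulVf// scale1r addrC.
rewrite [RHS]addrC /=; congr (_ + _); by rewrite /q -scalerN opprB addrC.
Unshelve. all: by end_near. Qed.

(** The derivative of Psi is expressed through Psi and the derivative of Phi. *)
Lemma Cn_inverse n : Cn n (L `*` M) (U `*` M) Psi.
Proof.
have dLM := real_domainM dL dM.
elim: n => [|n IH]; first by apply: Cn_0; exact: Psi_cont.
have [dPhi d sd] := smooth_deriv (@norm_hausdorff _ _) dLM Phi_smooth.
apply/CnS; split; first exact: Psi_cont.
exists (fun p => Psi (p.1.1, p.2.2 - dPhi ((p.1.1, Psi p.1), (p.2.1, 0)))).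
  exact: Psi_deriv.
have dLMf := real_domain_full dLM.
have dLf := real_domain_full dL.
have D := real_domainM dLM dLMf.
have C11 : Cn n ((L `*` M) `*` (L `*` M)) ((U `*` M) `*` (L `*` M))
  (fun p : (E * F) * (E * F) => p.1.1).
  apply: (Cn_comp (M := L `*` M) (W := U `*` M) (f := fst) (g := fst) D dLM).
  - by move=> [a b] [].
  - exact: Cn_fst.
  - exact: Cn_fst.
have C1 : Cn n ((L `*` M) `*` (L `*` M)) ((U `*` M) `*` (L `*` M))
  (fun p : (E * F) * (E * F) => Psi p.1).
  apply: (Cn_comp (M := L `*` M) (W := U `*` M) (f := Psi) (g := fst) D dLM) => //.
  - by move=> [a b] [].
  - exact: Cn_fst.
have C21 : Cn n ((L `*` M) `*` (L `*` M)) ((U `*` M) `*` (L `*` M))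
  (fun p : (E * F) * (E * F) => p.2.1).
  apply: (Cn_comp (M := L `*` M) (W := L `*` M) (f := fst) (g := snd) D dLMf).
  - by move=> [a b] [].
  - exact: Cn_fst.
  - exact: Cn_snd.
have C22 : Cn n ((L `*` M) `*` (L `*` M)) ((U `*` M) `*` (L `*` M))
  (fun p : (E * F) * (E * F) => p.2.2).
  apply: (Cn_comp (M := L `*` M) (W := L `*` M) (f := snd) (g := snd) D dLMf).
  - by move=> [a b] [].
  - exact: Cn_snd.
  - exact: Cn_snd.
have dPhiM p q : (U `*` M) p -> (L `*` M) q -> M (dPhi (p, q)).
  move=> hp hq; have [] := deriv_on_closed dLM dM d _ hp hq => // -[x z] [/= Ux Mz].
  exact: PhiM.
apply: (Cn_comp (M := L `*` M) (W := U `*` M) (f := Psi) (g := fun p => (p.1.1, _)) D dLM) => //.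
  move=> [[x y] [z y']] [[/= Ux My] [/= Lz My']]; split => //=.
  by apply: domB => //; apply: dPhiM; split => //=; [exact: PsiM|exact: rd0 dM].
apply: Cn_pair => //; apply: Cn_add => //.
apply: (Cn_comp (M := M) (W := M) (f := -%R) (g := fun p => dPhi _) D dM).
- move=> [[x y] [z y']] [[/= Ux My] [/= Lz My']].
  by apply: dPhiM; split => //=; [exact: PsiM|exact: rd0 dM].
- apply: Cn_linear => //.
    by move=> a b t _ _; rewrite opprD scalerN.
  by apply: continuous_cont_on; exact: opp_continuous.
apply: (Cn_comp (f := dPhi) (g := fun p => (_, _)) D D _ (sd n)) => /=.
  move=> [[x y] [z y']] [[/= Ux My] [/= Lz My']].
  by split => /=; split => //=; [exact: PsiM|exact: rd0 dM].
apply: Cn_pair; apply: Cn_pair => //; exact: Cn_cst.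
Qed.

End InverseFamily.

(** * The orthogonal group near the identity *)

Section LogBounds.
Context {R : realType}.
Implicit Types C d e D w x u : R.

Lemma log_bounds C d e : 0 <= C -> 0 <= e -> d * (4 * (1 + 2 * C)) = 1 -> e <= d ->
  e <= 1 / 4 /\ e * C <= 1 / 8.
Proof. by move=> *; split; nra. Qed.

Lemma log_bounds_contraction C e D : 0 <= D -> e <= 1 / 4 -> e * C <= 1 / 8 ->
  D * e + e * D + (C * (2 * e) * D + C * (2 * e) * D) <= D.
Proof.
move=> D0 /(ler_wpM2r D0) h1 /(ler_wpM2r D0) h2; lra.
Qed.

Lemma log_bounds_half e x : x <= e + e -> 2^-1 * x <= e.
Proof. by move=> h; lra. Qed.

Lemma log_bounds_ball e w : w <= 2 * e -> 2^-1 * w + e <= 2 * e.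
Proof. by move=> h; lra. Qed.

Lemma log_bounds_unit e w : e <= 1 / 4 -> w <= 2 * e -> w <= 1.
Proof. by move=> h1 h2; lra. Qed.

Lemma log_bounds_lt2 C e w x : 0 <= C -> e <= 1 / 4 -> e * C <= 1 / 8 ->
  w <= 2 * e -> x <= (1 + C) * w -> e + x < 2.
Proof. by move=> C0 h1 h2 h3 h4; nra. Qed.

Lemma log_bounds_two : 2^-1 + 2^-1 = 1 :> R.
Proof. by lra. Qed.

Lemma log_bounds_zero u : 0 <= u -> u < 2 -> 2 * u <= u * u -> u = 0.
Proof.
move=> u0 u2 h; apply/eqP; rewrite eq_le u0 andbT leNgt; apply/negP => up.
by move: h; rewrite ler_pM2r// leNgt u2.
Qed.

End LogBounds.

Section OrthogonalGroupTheory.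
Context {R : realType} {V : hilbertSpace R} (alpha : V -> V).
Hypothesis alphaP : real_structure alpha.
Local Notation lieO := (orthogonal_lie_algebra alpha).
Local Notation grpO := (orthogonal_group alpha).
Local Notation "x ** y" := (bop_comp x y) (at level 40, left associativity).
Local Notation one := (bop_id V).
Local Notation adjO := (alpha_adj alpha).
Implicit Types X Y Z W : bop V.

Let mP := @bop_comp_bounded R V.
Let mA := @bop_compA R V.
Let m1 := @bop_comp1 R V.
Let mr1 := @bop_compr1 R V.
Let n1 := @bop_id_norm R V.
Let aB : abs_complete (bop V) := bop_abs_complete (@complete_abs R V).

(** The Lie algebra condition is the adjoint relation between X and - X. *)
Lemma lie_adj X : lieO X <-> adjO X (- X).
Proof. by []. Qed.

Lemma adjN X Y : adjO X Y -> adjO (- X) (- Y).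
Proof.
by move=> h; have := alpha_adjZ alphaP (-1) h; rewrite rmorphN rmorph1 !scaleN1r.
Qed.

Lemma lieD X Y : lieO X -> lieO Y -> lieO (X + Y).
Proof. by move=> hX hY; apply/lie_adj; rewrite opprD; exact: alpha_adjD. Qed.
Lemma lieZ (t : R) X : lieO X -> lieO (t%:C *: X).
Proof. by move=> hX; apply/lie_adj; rewrite -scalerN; exact: alpha_adjZ. Qed.
Lemma lie0 : lieO 0.
Proof. by apply/lie_adj; rewrite oppr0; exact: alpha_adj0. Qed.
Lemma lieN X : lieO X -> lieO (- X).
Proof. by move=> hX; have := lieZ (-1) hX; rewrite rmorphN rmorph1 scaleN1r. Qed.
Lemma lieB X Y : lieO X -> lieO Y -> lieO (X - Y).
Proof. by move=> hX hY; apply: lieD => //; exact: lieN. Qed.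

Lemma lie_cvg (T : Type) (F : set_system T) (FF : ProperFilter F) (f : T -> bop V) X :
  f @ F --> X -> (\forall t \near F, lieO (f t)) -> lieO X.
Proof.
move=> fX h; apply/lie_adj; apply: (alpha_adj_cvg alphaP _ fX _ h).
exact: (tvs_cvgN _ fX).
Qed.

Lemma lie_closed : closed lieO.
Proof.
move=> X hX; have P := within_nbhs_proper hX.
apply: (@lie_cvg _ (within lieO (nbhs X)) _ id).
  by apply: cvg_within_filter; exact: cvg_id.
by apply: withinT; exact: filter_filter.
Qed.

Lemma lie_domain (r : R) : real_domain lieO (lie_ball alpha r).
Proof.
split; [exact: lie0|exact: lieD|by move=> *; exact: lieZ|exact: lie_closed|by move=> X []|].
move=> X [_ Xr]; exists [set Y | normR (Y - X) < r - normR X].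
  by apply/nbhs_normRP; exists (r - normR X) => //; rewrite subr_gt0.
move=> Y /= h hY; split => //.
by rewrite -(subrK X Y) (le_lt_trans (normRD _ _))// -ltrBrDr.
Qed.

Lemma lie_domainT : real_domain lieO lieO.
Proof. exact: real_domain_full (lie_domain 1). Qed.

(** The orthogonal group consists of the X that are in adjoint relation, both ways, with
    an inverse. *)
Lemma group_adj g : grpO g <-> exists h, [/\ adjO g h, adjO h g, g ** h = one & h ** g = one].
Proof.
split=> [Og|[h [[a c] [a' c'] gh hg]]]; last by split => //; exists h.
have [[h [agh gh hg]] ga] := Og.
have ghv v : g (h v) = v by rewrite -[LHS]/((g ** h) v) gh.
have hgv v : h (g v) = v by rewrite -[LHS]/((h ** g) v) hg.
exists h; split => //; split; first exact: adjoint_sym.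
by move=> v; rewrite -[v in LHS]ghv -ga hgv.
Qed.

Lemma group1 : grpO one.
Proof. by apply/group_adj; exists one; split => //; exact: alpha_adj1. Qed.

Lemma groupM g h : grpO g -> grpO h -> grpO (g ** h).
Proof.
move=> /group_adj[g' [a b c d]] /group_adj[h' [a' b' c' d']]; apply/group_adj.
exists (h' ** g'); split; [exact: alpha_adjM|exact: alpha_adjM| |].
- by rewrite -mA (mA h) c' m1.
- by rewrite -mA (mA g') d m1.
Qed.

Lemma group_normE g v : grpO g -> normR (g v) = normR v.
Proof.
move=> [[h [a _ hg]] _]; apply: isometry_norm => u.
by rewrite a -[h (g u)]/((h ** g) u) hg.
Qed.

Lemma group_norm g : grpO g -> normR g <= 1.
Proof. by move=> Og; apply: bop_norm_le => v; rewrite group_normE. Qed.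

Lemma norm_groupMl g X : grpO g -> normR (g ** X) <= normR X.
Proof.
by move=> Og; apply: bop_norm_le => v v1 /=; rewrite group_normE//; exact: opnorm_ub.
Qed.

Lemma normM X Y : normR (X ** Y) <= normR X * normR Y.
Proof. exact: (normR_mul mP). Qed.

Lemma norm_groupMr g X : grpO g -> normR (X ** g) <= normR X.
Proof.
move=> Og; apply: (le_trans (normM _ _)); rewrite ler_piMr ?normR_ge0//.
exact: group_norm.
Qed.

(** The relation [alpha_adj] passes to powers and to limits. *)
Lemma exp_adj X Y : adjO X Y -> adjO (bop_exp X) (bop_exp Y).
Proof.
move=> h; rewrite !bop_expE.
have hp k : adjO (bpow (@bop_comp R V) one k X) (bpow (@bop_comp R V) one k Y).
  elim: k => [|k IH] /=; first exact: alpha_adj1.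
  rewrite -(bpow_comm mA m1 mr1 k (erefl (Y ** Y))).
  exact: alpha_adjM.
have hs n : adjO (series (bterm (@bop_comp R V) one X) n) (series (bterm (@bop_comp R V) one Y) n).
  rewrite /series /=; elim/big_ind2 : _ => [|A B C D|k _].
  - exact: alpha_adj0.
  - exact: alpha_adjD.
  - by rewrite /bterm natC -fmorphV; exact: alpha_adjZ.
apply: (alpha_adj_cvg alphaP _ (@bexp_cvgn _ _ _ _ mP one aB X) (@bexp_cvgn _ _ _ _ mP one aB Y)).
exact: nearW.
Qed.

Lemma expNl X : bop_exp (- X) ** bop_exp X = one.
Proof. exact: (bexpNl mP mA m1 mr1 aB). Qed.
Lemma expNr X : bop_exp X ** bop_exp (- X) = one.
Proof. exact: (bexpNr mP mA m1 mr1 aB). Qed.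
Lemma exp0 : bop_exp (0 : bop V) = one.
Proof. exact: (bexp0 one mP). Qed.
Lemma expD X Y : X ** Y = Y ** X -> bop_exp (X + Y) = bop_exp X ** bop_exp Y.
Proof. exact: (bexpD mP mA m1 mr1 aB). Qed.

Lemma exp_lineD (s t : R) X :
  bop_exp ((s + t)%:C *: X) = bop_exp (s%:C *: X) ** bop_exp (t%:C *: X).
Proof.
by rewrite rmorphD scalerDl expD// !(mulbZl mP) !(mulbZr mP) !scalerA mulrC.
Qed.

Lemma group_exp X : lieO X -> grpO (bop_exp X).
Proof.
move=> hX; apply/group_adj; exists (bop_exp (- X)); split.
- exact: exp_adj.
- by apply: exp_adj; rewrite -{2}(opprK X); apply/lie_adj; exact: lieN.
- exact: expNr.
- exact: expNl.
Qed.

Lemma exp_conj g h X : h ** g = one -> g ** h = one ->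
  bop_exp (h ** X ** g) = h ** bop_exp X ** g.
Proof.
move=> hg gh; rewrite !bop_expE.
have hp k : bpow (@bop_comp R V) one k (h ** X ** g) = h ** bpow (@bop_comp R V) one k X ** g.
  elim: k => [|k IH]; first by rewrite /= mr1 hg.
  rewrite [LHS]/= -/(bpow _ _ _ _) IH [in RHS]/=.
  by rewrite !mA -[h ** X ** g ** h]mA gh mr1.
have c := @bexp_cvgn _ _ _ _ mP one aB X.
have c1 : (fun n => h ** series (bterm (@bop_comp R V) one X) n ** g) @ \oo -->
  h ** bexp (@bop_comp R V) one X ** g.
  by apply: (mul_cvg mP); [apply: (mul_cvg mP) => //; exact: cvg_cst|exact: cvg_cst].
apply: cvg_lim; first exact: norm_hausdorff.
rewrite (_ : series _ = fun n => h ** series (bterm (@bop_comp R V) one X) n ** g)//.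
apply/funext => n; rewrite /series /=; elim/big_ind2 : _ => [|A B C D -> ->|k _].
- by rewrite (mulb0 mP) (mul0b mP).
- by rewrite (mulbDr mP) (mulbDl mP).
- by rewrite /bterm hp (mulbZr mP) (mulbZl mP).
Qed.

Lemma lie_conj g h X : adjO g h -> adjO h g -> lieO X -> lieO (h ** X ** g).
Proof.
move=> a a' hX; apply/lie_adj; have -> : - (h ** X ** g) = h ** ((- X) ** g).
  by rewrite (mulbNl mP) (mulbNr mP) mA.
exact: alpha_adjM (alpha_adjM a' hX) a.
Qed.

Let C := @expC R.

Lemma expC_ge0 : 0 <= C.
Proof.
have := nondecreasing_cvgn_le _ (@exp_majorant_cvg R 2 1) 0.
rewrite /series /= big_geq//; apply.
apply/nondecreasing_seqP => k; rewrite big_nat_recr//= lerDl.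
by rewrite !mulr_ge0 ?exprn_ge0// invr_ge0.
Qed.

Lemma exp_lip X Y (r : R) : r <= 1 -> normR X <= r -> normR Y <= r ->
  normR (bop_exp X - bop_exp Y - (X - Y)) <= C * r * normR (X - Y).
Proof. exact: (bexp_lip mP mr1 n1 aB). Qed.

(** Second order remainder of the exponential at 0. *)
Lemma exp_taylor1 X : normR X <= 1 -> normR (bop_exp X - one - X) <= C * normR X * normR X.
Proof.
move=> X1; have := @exp_lip X 0 (normR X) X1 (lexx _).
by rewrite normR0 exp0 !subr0 => /(_ (normR_ge0 _)).
Qed.

Lemma exp_near1 X : normR X <= 1 -> normR (bop_exp X - one) <= (1 + C) * normR X.
Proof.
move=> X1; rewrite -(subrK X (_ - one)); apply: (le_trans (normRD _ _)).
rewrite addrC mulrDl mul1r lerD2l (le_trans (exp_taylor1 X1))//.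
by rewrite ler_piMr ?mulr_ge0 ?expC_ge0 ?normR_ge0.
Qed.

(** The difference of two values of the contraction in [group_log], arranged so that
    every term contains a small factor. *)
Lemma log_algebra h h' D q q' :
  D + (2^-1 : R)%:C *: ((q' - D) ** h - h' ** (q + D)) =
  (2^-1 : R)%:C *: (D ** (one - h) + (one - h') ** D + (q' ** h - h' ** q)).
Proof.
have e3 : D = (2^-1 : R)%:C *: (D + D).
  by rewrite scalerDr -scalerDl -rmorphD log_bounds_two rmorph1 scale1r.
rewrite {1}e3 -scalerDr; congr (_ *: _).
rewrite (mulbBl mP) (mulbDr mP) (mulbBr mP D) (mulbBl mP one) m1 mr1.
rewrite [D - _ + _]addrACA -[RHS]addrA; congr (_ + _).
by rewrite [- (_ + _)]opprD addrACA [RHS]addrC.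
Qed.

(** A solution W of exp (- W) h = h^-1 exp W is a fixed point of T W = W + (exp (- W) h
    - h^-1 exp W) / 2, which maps the Lie algebra to itself for h orthogonal and is a
    contraction of a small ball, of radius twice the distance of h from 1. Then u = exp
    (- W) h is an involution at distance less than 2 from 1, which forces u = 1. Unlike
    the logarithm series, T preserves the Lie algebra by inspection. *)
Lemma group_log : exists2 d : R, 0 < d & forall h, grpO h -> normR (h - one) < d ->
  exists2 W, lieO W & bop_exp W = h /\ normR W <= 2 * normR (h - one).
Proof.
have C0 := expC_ge0.
(* With e <= d, both e and e C are small enough to make T a contraction with factor
   1/2. *)
pose d : R := (4 * (1 + 2 * C))^-1.
have dC : d * (4 * (1 + 2 * C)) = 1 by rewrite mulVf// gt_eqF// mulr_gt0// ltr_wpDr// mulr_ge0.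
have d0 : 0 < d by rewrite invr_gt0 mulr_gt0// ltr_wpDr// mulr_ge0.
exists d => // h Oh hd.
have [h' [a a' hh' h'h]] := (group_adj h).1 Oh.
have Oh' : grpO h' by apply/group_adj; exists h.
set e := normR (h - one) in hd *.
have e0 : 0 <= e by exact: normR_ge0.
have [e4 eC] := log_bounds C0 e0 dC (ltW hd).
have h'1 : normR (h' - one) <= e.
  have -> : h' - one = h' ** (one - h) by rewrite (mulbBr mP) h'h mr1.
  by rewrite (le_trans (norm_groupMl _ Oh'))// normRBC.
(* Newton's iteration for exp W = h, symmetrized so that its increments are skew-
   adjoint. *)
pose T W := W + (2^-1 : R)%:C *: (bop_exp (- W) ** h - h' ** bop_exp W).
pose S := [set W | lieO W /\ normR W <= 2 * e].
have Tlie W : lieO W -> lieO (T W).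
  move=> hW; apply: lieD => //; apply: lieZ; apply/lie_adj; rewrite opprB.
  have hW' : adjO (- W) W by have := lieN hW; rewrite lie_adj opprK.
  rewrite (_ : h' ** _ - _ = - (bop_exp (- W) ** h) + h' ** bop_exp W); last by rewrite addrC.
  rewrite [X in adjO _ X]addrC; apply: alpha_adjD => //.
    by apply: alpha_adjM => //; exact: exp_adj.
  by apply: adjN; apply: alpha_adjM => //; exact: exp_adj.
have Tlip W W' : S W -> S W' -> normR (T W - T W') <= 2^-1 * normR (W - W').
  move=> [hW We] [hW' We'].
  have r1 : 2 * e <= 1 by exact: log_bounds_unit e4 (lexx _).
  pose D := W - W'; pose q := bop_exp W - bop_exp W' - D.
  pose q' := bop_exp (- W) - bop_exp (- W') + D.
  have hq : normR q <= C * (2 * e) * normR D by exact: exp_lip.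
  have hq' : normR q' <= C * (2 * e) * normR D.
    have := @exp_lip (- W) (- W') (2 * e) r1.
    rewrite !normRN => /(_ We We'); rewrite /q' /D.
    by rewrite -opprD opprK normRN.
  have -> : T W - T W' = (2^-1 : R)%:C *: (D ** (one - h) + (one - h') ** D + (q' ** h - h' ** q)).
    have eAB : (bop_exp (- W) ** h - h' ** bop_exp W) - (bop_exp (- W') ** h - h' ** bop_exp W')
        = (q' - D) ** h - h' ** (q + D).
      rewrite /q' /q addrK subrK (mulbBl mP) (mulbBr mP) !opprB.
      by rewrite addrACA [- _ + - _]addrC addrACA.
    have -> : T W - T W' = D + (2^-1 : R)%:C *: ((q' - D) ** h - h' ** (q + D)).
      by rewrite -eAB scalerBr /T opprD addrACA.
    exact: log_algebra.
  rewrite normRZr ger0_norm ?invr_ge0// ler_pM2l ?invr_gt0//.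
  have k1 : normR (D ** (one - h)) <= normR D * e.
    by apply: (le_trans (normM _ _)); rewrite (normRBC one h).
  have k2 : normR ((one - h') ** D) <= e * normR D.
    by apply: (le_trans (normM _ _)); rewrite (normRBC one h') ler_wpM2r ?normR_ge0.
  have k3 : normR (q' ** h) <= C * (2 * e) * normR D.
    exact: le_trans (norm_groupMr _ Oh) hq'.
  have k4 : normR (h' ** q) <= C * (2 * e) * normR D.
    exact: le_trans (norm_groupMl _ Oh') hq.
  apply: (le_trans (normRD _ _)); apply: (le_trans (lerD (normRD _ _) (normRB _ _))).
  apply: (le_trans (lerD (lerD k1 k2) (lerD k3 k4))).
  exact: log_bounds_contraction (normR_ge0 D) e4 eC.
have T0 : normR (T 0) <= e.
  rewrite /T oppr0 exp0 add0r m1 mr1 normRZr ger0_norm ?invr_ge0//.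
  apply: log_bounds_half.
  rewrite -(subrKA one h (- h')); apply: (le_trans (normRD _ _)).
  by apply: lerD; [exact: lexx|rewrite normRBC; exact: h'1].
have S0 : S 0 by split; [exact: lie0|rewrite normR0 mulr_ge0].
have cS : closed S.
  rewrite (_ : S = lieO `&` [set W | normR W <= 2 * e])//.
  apply: closedI; first exact: lie_closed.
  move=> W hW; have P := within_nbhs_proper hW.
  apply: (@normR_lim_le _ _ _ (within [set W | normR W <= 2 * e] (nbhs W)) _ id).
    by apply: cvg_within_filter; exact: cvg_id.
  by apply: withinT; exact: filter_filter.
have TS W : S W -> S (T W).
  move=> SW; split; first exact: Tlie SW.1.
  rewrite -(subrK (T 0) (T W)); apply: (le_trans (normRD _ _)).
  apply: (le_trans (lerD (Tlip _ _ SW S0) T0)); rewrite subr0.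
  exact: log_bounds_ball SW.2.
have [|W [hW We] fW] := contraction_fixed aB cS (ex_intro _ _ S0) TS _ Tlip.
  by rewrite invf_lt1// ltr1n.
exists W => //; split => //.
pose u := bop_exp (- W) ** h.
have eu : u = h' ** bop_exp W.
  move: fW; rewrite /T => /eqP; rewrite -subr_eq0 addrAC subrr add0r scaler_eq0.
  case/orP => [/eqP|]; last by rewrite subr_eq0 => /eqP.
  by move=> /complexI/eqP; rewrite invr_eq0 pnatr_eq0.
(* The fixed point equation says u = h^-1 exp W = u^-1. *)
have uu : u ** u = one by rewrite {1}eu /u -mA (mA (bop_exp W)) expNr m1 h'h.
have W1 : normR W <= 1 by exact: log_bounds_unit We.
have u1 : normR (u - one) < 2.
  have -> : u - one = bop_exp (- W) ** (h - bop_exp W) by rewrite (mulbBr mP) expNl.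
  apply: (le_lt_trans (norm_groupMl _ (group_exp (lieN hW)))).
  rewrite -(subrKA one h); apply: (le_lt_trans (normRD _ _)).
  rewrite -/e normRBC.
  exact: log_bounds_lt2 C0 e4 eC We (exp_near1 W1).
(* For an involution (u - 1)^2 = - 2 (u - 1), hence |u - 1| is 0 or at least 2. *)
have us : (u - one) ** (u - one) = (-2 : R)%:C *: (u - one).
  have -> : (-2 : R)%:C = - 2%:R :> R[i] by rewrite rmorphN rmorph_nat.
  rewrite (mulbBl mP) !(mulbBr mP) uu m1 !mr1 scaleNr scaler_nat mulr2n.
  by rewrite [RHS]opprD -[one - u]opprB.
have : 2 * normR (u - one) <= normR (u - one) * normR (u - one).
  rewrite -[X in X * normR _ <= _](_ : `|-2| = 2 :> R); last by rewrite normrN ger0_norm.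
  by rewrite -normRZr -us; exact: normM.
move=> /(log_bounds_zero (normR_ge0 (u - one)) u1)/normR_eq0/eqP; rewrite subr_eq0 => /eqP ue.
by rewrite -[LHS]mr1 -ue /u mA expNr m1.
Qed.

End OrthogonalGroupTheory.

(** * The logarithmic derivative of the exponential *)

Section PhiBounds.
Context {R : realType}.

Lemma phi_bounds (C : R) : 0 <= C -> exists2 r : R, 0 < r & r <= 1 /\ C * r + (1 + C) * r <= 1 / 2.
Proof.
move=> C0; pose D := 2 * (1 + 2 * C).
have D0 : 0 < D by rewrite mulr_gt0// ltr_wpDr// mulr_ge0.
exists D^-1; first by rewrite invr_gt0.
have h : D^-1 * D = 1 by rewrite mulVf// gt_eqF.
have r0 : 0 < D^-1 by rewrite invr_gt0.
rewrite /D in h r0 *; split; nra.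
Qed.

Lemma half_absorb (a b c : R) : a <= b + c -> b <= 2^-1 * a -> a <= 2 * c.
Proof. by move=> *; lra. Qed.

Lemma log_remainder (a w C n : R) : 0 <= a -> 0 <= w -> 0 <= C -> w <= 2 * n ->
  a * (C * w * w) <= w * (2 * C * (a * n)).
Proof.
move=> a0 w0 C0 h; have k : 0 <= a * C * w by rewrite !mulr_ge0.
have := ler_wpM2l k h; lra.
Qed.

End PhiBounds.

Section LogarithmicDerivative.
Context {R : realType} {V : hilbertSpace R} (alpha : V -> V).
Hypothesis alphaP : real_structure alpha.
Local Notation lieO := (orthogonal_lie_algebra alpha).
Local Notation grpO := (orthogonal_group alpha).
Local Notation "x ** y" := (bop_comp x y) (at level 40, left associativity).
Local Notation one := (bop_id V).
Local Notation adjO := (alpha_adj alpha).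
Implicit Types X Y Z W : bop V.

Let mP := @bop_comp_bounded R V.
Let mA := @bop_compA R V.
Let m1 := @bop_comp1 R V.
Let mr1 := @bop_compr1 R V.
Let n1 := @bop_id_norm R V.
Let aB : abs_complete (bop V) := bop_abs_complete (@complete_abs R V).

Lemma bop_exp_cont : continuous (@bop_exp R V).
Proof. exact: (@bexp_cont _ _ _ _ mP one aB). Qed.

Lemma comp_cvg (T : Type) (F : set_system T) (FF : Filter F) (f g : T -> bop V) a b :
  f @ F --> a -> g @ F --> b -> (fun x => f x ** g x) @ F --> a ** b.
Proof. by move=> fa gb; apply: (mul_cvg mP). Qed.

(** The left logarithmic derivative of exp at X in direction Z. *)
Definition ldexp (p : bop V * bop V) : bop V :=
  bop_exp (- p.1) ** dexp (@bop_comp R V) one p.1 p.2.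

Lemma Cn_bop_exp n (L U : set (bop V)) : Cn n L U (@bop_exp R V).
Proof. by apply: (@CnW _ _ _ _ setT setT) => //; exact: Cn_bexp mP aB. Qed.

Lemma ldexp_smooth L U : smooth_map L U ldexp.
Proof.
move=> n; apply: (@CnW _ _ _ _ setT setT) => //.
have dT := @real_domainT R (bop V).
have dTT : real_domain [set: bop V * bop V] [set: bop V * bop V] by exact: real_domainT.
have h1 : Cn n [set: bop V * bop V] [set: bop V * bop V] (fun p => bop_exp (- p.1)).
  apply: (Cn_comp (f := @bop_exp R V) (g := fun p => - p.1) dTT dT) => //.
    exact: Cn_bop_exp.
  apply: Cn_linear => //.
    by move=> [x x'] [v v'] t _ _ /=; rewrite opprD scalerN.
  by apply: continuous_cont_on => x; apply: tvs_cvgN; exact: cvg_fst.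
have h2 := Cn_dexp n one mP aB.
apply: (Cn_comp (f := fun p : bop V * bop V => p.1 ** p.2) (g := fun p => (_, _)) dTT dTT) => //;
  last exact: Cn_pair h1 h2.
apply: (@CnW _ _ _ _ (setT `*` setT) (setT `*` setT)) => //.
apply: Cn_bilinear => //.
  split=> [y _ x v t _ _|x _ y v t _ _] /=.
    by rewrite (mulbDl mP) (mulbZl mP).
  by rewrite (mulbDr mP) (mulbZr mP).
by apply: continuous_cont_on; exact: mul_cont mP.
Qed.

Lemma ldexp_lin X : real_linear_on lieO (fun Z => ldexp (X, Z)).
Proof.
move=> Z Z' t _ _; rewrite /ldexp /= addrC (dexp_linear _ _ _ _ _ mP aB).
by rewrite (mulbDr mP) (mulbZr mP) addrC.
Qed.

(** A curve through 1 that moves exp X to exp (X + tZ); its velocity is ldexp (X, Z). *)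
Definition exp_curve X Z (t : R) := bop_exp (- X) ** bop_exp (X + t%:C *: Z).

Lemma exp_curveE X Z t : bop_exp (X + t%:C *: Z) = bop_exp X ** exp_curve X Z t.
Proof. by rewrite /exp_curve mA expNr m1. Qed.

Lemma exp_curve_group X Z t : lieO X -> lieO Z -> grpO (exp_curve X Z t).
Proof.
move=> hX hZ; apply: groupM => //; apply: group_exp => //; first exact: lieN.
by apply: lieD => //; exact: lieZ.
Qed.

Lemma exp_curve_cvg X Z : exp_curve X Z @ 0^' --> one.
Proof.
rewrite -(expNl X); apply: comp_cvg; first exact: cvg_cst.
by apply: (cvg_comp _ _ (@cvg_incr _ _ X Z)); exact: bop_exp_cont.
Qed.

Lemma exp_curve_deriv X Z :
  (fun t : R => (t%:C)^-1 *: (exp_curve X Z t - one)) @ 0^' --> ldexp (X, Z).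
Proof.
have h : (fun t : R => bop_exp (- X) ** ((t%:C)^-1 *: (bop_exp (X + t%:C *: Z) - bop_exp X)))
  @ 0^' --> ldexp (X, Z).
  by apply: comp_cvg; [exact: cvg_cst|exact: (@bexp_derive _ _ _ _ mP one aB)].
apply: cvg_trans h; apply: near_eq_cvg; apply: filterE => t.
by rewrite (mulbZr mP) (mulbBr mP) expNl.
Qed.

(** The curve and its inverse are adjoint, so their velocities ldexp (X, Z) and - ldexp
    (X, Z) are adjoint in the limit. *)
Lemma ldexp_lie X Z : lieO X -> lieO Z -> lieO (ldexp (X, Z)).
Proof.
move=> hX hZ.
pose d (t : R) := bop_exp (- (X + t%:C *: Z)) ** bop_exp X.
have cd t : exp_curve X Z t ** d t = one.
  by rewrite /exp_curve /d -mA (mA (bop_exp (X + _))) expNr m1 expNl.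
have dc t : d t ** exp_curve X Z t = one.
  by rewrite /exp_curve /d -mA (mA (bop_exp X)) expNr m1 expNl.
have hW t : lieO (X + t%:C *: Z) by apply: lieD => //; exact: lieZ.
have aN W : lieO W -> adjO (- W) W by move=> hW'; have := lieN alphaP hW'; rewrite lie_adj opprK.
have adj t : adjO (exp_curve X Z t) (d t).
  by apply: alpha_adjM; apply: exp_adj => //; [exact: aN|exact: hW].
have dcv : d @ 0^' --> one.
  rewrite -(expNl X); apply: comp_cvg; last exact: cvg_cst.
  have h : (fun t : R => - (X + t%:C *: Z)) @ 0^' --> - X by apply: tvs_cvgN; exact: cvg_incr.
  by apply: (cvg_comp _ _ h); exact: bop_exp_cont.
have h1 : (fun t : R => (t%:C)^-1 *: (exp_curve X Z t - one)) @ 0^' --> ldexp (X, Z).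
  exact: exp_curve_deriv.
have h2 : (fun t : R => (t%:C)^-1 *: (d t - one)) @ 0^' --> - ldexp (X, Z).
  have h3 : (fun t : R => - (d t ** ((t%:C)^-1 *: (exp_curve X Z t - one)))) @ 0^' -->
    - ldexp (X, Z).
    by apply: tvs_cvgN; rewrite -[X in _ --> X]m1; apply: comp_cvg.
  apply: cvg_trans h3; apply: near_eq_cvg; apply: filterE => t.
  by rewrite (mulbZr mP) (mulbBr mP) dc mr1 -scalerN opprB.
apply/lie_adj; apply: (alpha_adj_cvg alphaP _ h1 h2).
apply: filterE => t; rewrite -fmorphV; apply: alpha_adjZ => //.
apply: alpha_adjD => //; apply: adjN => //; exact: alpha_adj1.
Qed.

(** [group_log] is applied pointwise; near the limit of the filter it yields a choice of
    logarithms. *)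
Lemma group_curve_log (T : Type) (F : set_system T) (FF : Filter F) (c : T -> bop V) :
  c @ F --> one -> (\forall t \near F, grpO (c t)) ->
  exists W : T -> bop V, \forall t \near F,
    [/\ lieO (W t), bop_exp (W t) = c t & normR (W t) <= 2 * normR (c t - one)].
Proof.
move=> c1 Oc; have [d d0 H] := group_log alphaP.
pose W t := get [set W | [/\ lieO W, bop_exp W = c t & normR W <= 2 * normR (c t - one)]].
exists W; have /cvg_normRP/(_ _ d0) := c1; apply: filterS2 Oc => t Ot ht.
have [X hX [e n]] := H _ Ot ht.
exact: (@getPex _ [set W | [/\ lieO W, bop_exp W = c t & normR W <= 2 * normR (c t - one)]]
  (ex_intro _ X (And3 hX e n))).
Qed.

Lemma log_curve_cvg (T : Type) (F : set_system T) (FF : Filter F) (c W : T -> bop V) :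
  c @ F --> one -> (\forall t \near F, normR (W t) <= 2 * normR (c t - one)) ->
  W @ F --> (0 : bop V).
Proof.
move=> c1 h; apply/cvg_normRP => e e0.
have e2 : 0 < e / 2 by exact: divr_gt0.
have /cvg_normRP/(_ _ e2) := c1; apply: filterS2 h => t h1 h2; rewrite subr0.
by apply: (le_lt_trans h1); rewrite -ltr_pdivlMl// mulrC.
Qed.

(** exp W = 1 + W + O(|W|^2) and |W| <= 2 |c - 1|, so W and c - 1 have the same
    derivative. *)
Lemma log_curve_deriv (c W : R -> bop V) Z :
  c @ 0^' --> one -> (fun t : R => (t%:C)^-1 *: (c t - one)) @ 0^' --> Z ->
  (\forall t \near (0 : R)^', [/\ lieO (W t), bop_exp (W t) = c t & normR (W t) <= 2 * normR
    (c t - one)]) ->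
  (fun t : R => (t%:C)^-1 *: W t) @ 0^' --> Z.
Proof.
move=> c1 cZ hW.
pose q (t : R) := (t%:C)^-1 *: (c t - one).
have Wc : W @ 0^' --> (0 : bop V).
  by apply: (log_curve_cvg _ c1); apply: filterS hW => t [].
pose r (t : R) := (t%:C)^-1 *: (c t - one - W t).
suff hr : r @ 0^' --> (0 : bop V).
  have h : (fun t => q t - r t) @ 0^' --> Z - 0 by exact: tvs_cvgB.
  rewrite subr0 in h; apply: cvg_trans h; apply: near_eq_cvg; apply: filterE => t.
  by rewrite /q /r -scalerBr opprB addrC subrK.
have nq : (fun t => normR (W t) * (2 * @expC R * normR (q t))) @ 0^' --> (0 : R).
  rewrite -[X in _ --> X](mul0r (2 * @expC R * normR Z)); apply: cvgM.
    have h : (fun t => normR (W t)) @ 0^' --> normR (0 : bop V) by exact: normR_cvg.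
    by rewrite normR0 in h.
  by apply: cvgMr; exact: normR_cvg.
apply/cvg_normRP => e e0.
have /cvgrPdist_lt/(_ _ e0) := nq.
have /cvg_normRP/(_ _ ltr01) := Wc.
apply: filterS3 hW => t [hW eW nW] W1 h; rewrite subr0; rewrite subr0 in W1.
rewrite sub0r normrN in h; apply: le_lt_trans h; apply: le_trans (ler_norm _).
rewrite /r -eW -fmorphV normRZr; apply: (le_trans (ler_wpM2l (normr_ge0 _) (exp_taylor1 (ltW W1)))).
have -> : normR (q t) = `|t^-1| * normR (c t - one) by rewrite /q -fmorphV normRZr.
exact: log_remainder (normr_ge0 _) (normR_ge0 _) (@expC_ge0 R) nW.
Qed.

(** ldexp (0, Z) = Z, and ldexp is Lipschitz in X with a constant proportional to |Z|. *)
Lemma ldexp_near : exists2 r : R, 0 < r & forall X Z, lieO X -> normR X < r ->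
  normR (ldexp (X, Z) - Z) <= 2^-1 * normR Z.
Proof.
have [r r0 [r1 rC]] := phi_bounds (@expC_ge0 R).
exists r => // X Z hX Xr.
have -> : ldexp (X, Z) - Z = bop_exp (- X) ** (dexp (@bop_comp R V) one X Z - Z)
  + (bop_exp (- X) - one) ** Z.
  by rewrite (mulbBr mP) (mulbBl mP) m1 subrKA.
apply: (le_trans (normRD _ _)).
have k1 : normR (bop_exp (- X) ** (dexp (@bop_comp R V) one X Z - Z)) <= @expC R * r * normR Z.
  apply: (le_trans (norm_groupMl _ (group_exp alphaP (lieN alphaP hX)))).
  exact: (dexp_near mP mr1 n1 aB).
have k2 : normR ((bop_exp (- X) - one) ** Z) <= (1 + @expC R) * r * normR Z.
  apply: (le_trans (normM _ _)); apply: ler_wpM2r; first exact: normR_ge0.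
  apply: (@le_trans _ _ ((1 + @expC R) * normR X)).
    rewrite -(normRN X); apply: exp_near1; rewrite normRN; exact: ltW (lt_le_trans Xr r1).
  apply: ler_wpM2l; last exact: ltW.
  by apply: addr_ge0 => //; exact: expC_ge0.
apply: (le_trans (lerD k1 k2)); rewrite -mulrDl; apply: ler_wpM2r; first exact: normR_ge0.
by rewrite -div1r.
Qed.

(** Z |-> Y + Z - ldexp (X, Z) is a contraction of the Lie algebra by [ldexp_near]; its
    fixed point is the preimage of Y, and [Cn_inverse] gives smoothness. *)
Lemma ldexp_inverse : exists2 r : R, 0 < r & exists Psi : bop V * bop V -> bop V,
  (forall X Y, lie_ball alpha r X -> lieO Y -> lieO (Psi (X, Y)) /\ ldexp (X, Psi (X, Y)) = Y) /\
  smooth_map (lieO `*` lieO) (lie_ball alpha r `*` lieO) Psi.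
Proof.
have [r r0 H] := ldexp_near; exists r => //.
pose Psi p := get [set Z | lieO Z /\ ldexp (p.1, Z) = p.2].
have PhiB X Z Z' : lieO Z -> lieO Z' -> ldexp (X, Z - Z') = ldexp (X, Z) - ldexp (X, Z').
  move=> hZ hZ'; have := @ldexp_lin X Z Z' (-1) hZ hZ'.
  by rewrite rmorphN rmorph1 !scaleN1r.
have bnd X Z : lieO X -> normR X < r -> normR Z <= 2 * normR (ldexp (X, Z)).
  move=> hX Xr; apply: half_absorb (H X Z hX Xr).
  by rewrite addrC -{1}(subKr (ldexp (X, Z)) Z); exact: normRB.
have inj X Z Z' : lieO X -> normR X < r -> lieO Z -> lieO Z' ->
  ldexp (X, Z) = ldexp (X, Z') -> Z = Z'.
  move=> hX Xr hZ hZ' e; apply/eqP; rewrite -subr_eq0; apply/eqP; apply: normR_eq0.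
  apply/eqP; rewrite eq_le normR_ge0 andbT; apply: (le_trans (bnd X _ hX Xr)).
  by rewrite PhiB// e subrr normR0 mulr0 lexx.
have PsiP X Y : lie_ball alpha r X -> lieO Y -> lieO (Psi (X, Y)) /\ ldexp (X, Psi (X, Y)) = Y.
  move=> [hX Xr] hY; apply: (@getPex _ [set Z | lieO Z /\ ldexp (X, Z) = Y]).
  pose f Z := Y + (Z - ldexp (X, Z)).
  have [||||Z hZ fZ] := @contraction_fixed _ _ lieO f 2^-1 aB (lie_closed alphaP).
  - by exists 0; exact: lie0.
  - by move=> Z hZ; apply: lieD => //; apply: lieB => //; exact: ldexp_lie.
  - by rewrite invf_lt1// ltr1n.
  - move=> Z Z' hZ hZ'; rewrite /f opprD addrACA subrr add0r.
    have -> : Z - ldexp (X, Z) - (Z' - ldexp (X, Z')) = - (ldexp (X, Z - Z') - (Z - Z')).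
      by rewrite PhiB// [RHS]opprB [X in _ + X = _]opprD addrACA -opprD.
    by rewrite normRN; exact: H.
  exists Z; split => //; move: fZ => /eqP; rewrite /f addrA -subr_eq0 addrAC.
  by rewrite addrK subr_eq0 => /eqP ->.
exists Psi; split => // n.
apply: (@Cn_inverse R _ _ lieO (lie_ball alpha r) lieO ldexp Psi 2 (lie_domain alphaP r)
  (lie_domainT alphaP)).
- exact: ldexp_smooth.
- by move=> X _; exact: ldexp_lin.
- by move=> X Z [hX _] hZ; exact: ldexp_lie.
- by move=> X Y hX hY; have [] := PsiP X Y hX hY.
- move=> X Z hX hZ; have hP := ldexp_lie hX.1 hZ.
  have [a b] := PsiP X _ hX hP; exact: inj hX.1 hX.2 a hZ b.
- by move=> X Y hX hY; have [] := PsiP X Y hX hY.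
- by move=> X Y hX hY; have [a {2}<-] := PsiP X Y hX hY; exact: bnd hX.1 hX.2.
Qed.

End LogarithmicDerivative.

(** * Unital star morphisms are contractive *)

Lemma half_sum (R : realFieldType) (x : R) : 2^-1 * (x + x) = x.
Proof. by lra. Qed.

Section CstarTheory.
Context {R : realType}.

Section NonUnital.
Context {A : cstarAlgebra R}.
Implicit Types a b : A.

Lemma cs_bounded_mul : bounded_mul (@cs_mul R A) 1.
Proof.
split => //; first exact: cs_mul_bilinear.
move=> a b; rewrite mul1r; have := cs_normM a b.
by rewrite !normRE -rmorphM lecR.
Qed.

Lemma cs_starD a b : cs_star (a + b) = cs_star a + cs_star b.
Proof. by have := @cs_starL R A 1 a b; rewrite conjC1 !scale1r. Qed.
Lemma cs_star0 : cs_star (0 : A) = 0.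
Proof. by apply: (addIr (cs_star (0 : A))); rewrite -cs_starD !add0r. Qed.
Lemma cs_starZ c a : cs_star (c *: a) = Num.conj c *: cs_star a.
Proof. by have := @cs_starL R A c a 0; rewrite cs_star0 !addr0. Qed.
Lemma cs_starN a : cs_star (- a) = - cs_star a.
Proof. by rewrite -scaleN1r cs_starZ rmorphN rmorph1 scaleN1r. Qed.
Lemma cs_starB a b : cs_star (a - b) = cs_star a - cs_star b.
Proof. by rewrite cs_starD cs_starN. Qed.

Lemma normR_star_mul a : normR (cs_mul (cs_star a) a) = normR a ^+ 2.
Proof. by rewrite /normR cs_normE normRE -rmorphXn. Qed.

Lemma normR_star a : normR (cs_star a) = normR a.
Proof.
have h b : normR b <= normR (cs_star b).
  have [e|e] := eqVneq (normR b) 0; first by rewrite e normR_ge0.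
  have p : 0 < normR b by rewrite lt_def e normR_ge0.
  by rewrite -(ler_pM2r p) -expr2 -normR_star_mul (normR_mul cs_bounded_mul).
by apply/eqP; rewrite eq_le h andbT -{2}(cs_starK a) h.
Qed.

Lemma cs_star_cvg (T : Type) (F : set_system T) (FF : Filter F) (f : T -> A) a :
  f @ F --> a -> (fun t => cs_star (f t)) @ F --> cs_star a.
Proof.
move=> fa; apply/cvg_normRP => e e0.
have /cvg_normRP/(_ _ e0) := fa; apply: filterS => t.
by rewrite -cs_starB normR_star.
Qed.
End NonUnital.

Section Unital.
Context {A : unitalCstarAlgebra R}.
Local Notation one := (ucs_one A).
Local Notation "x ** y" := (cs_mul x y) (at level 40, left associativity).
Let mP := @cs_bounded_mul A.

Lemma ucs_star1 : cs_star one = one.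
Proof. by rewrite -[LHS](@ucs_mul1 R A) -{1}(cs_starK one) -cs_starM ucs_mul1 cs_starK. Qed.

Lemma ucs_norm1 : normR one <= 1.
Proof.
have := normR_star_mul one; rewrite ucs_star1 ucs_mul1 expr2 => h.
have [e|e] := eqVneq (normR one) 0; first by rewrite e ler01.
by have -> : normR one = 1 by apply: (mulfI e); rewrite mulr1 -h.
Qed.

Lemma half_scale (x : A) : (2^-1 : R)%:C *: (x + x) = x.
Proof.
rewrite scalerDr -scalerDl -rmorphD (_ : 2^-1 + 2^-1 = 1 :> R) ?rmorph1 ?scale1r//.
by rewrite -div1r -splitr.
Qed.

(** 1 - s is a square root of 1 - b^2 if s = (b^2 + s^2) / 2. This map contracts the
    ball of radius |b|^2 in the self-adjoint elements commuting with b. *)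
Lemma cs_sqrt (b : A) : cs_star b = b -> normR b < 1 ->
  exists c : A, [/\ cs_star c = c, c ** b = b ** c & c ** c = one - b ** b].
Proof.
move=> sb b1; pose be := normR b ^+ 2.
have be0 : 0 <= be by rewrite exprn_ge0// normR_ge0.
have be1 : be < 1 by rewrite expr_lt1 ?normR_ge0.
pose S := [set s : A | [/\ cs_star s = s, s ** b = b ** s & normR s <= be]].
pose T (s : A) := (2^-1 : R)%:C *: (b ** b + s ** s).
have nT : normR (b ** b) <= be.
  by rewrite /be expr2; exact: (normR_mul mP).
have S0 : S 0.
  by split; [exact: cs_star0|rewrite (mulb0 mP) (mul0b mP)|rewrite normR0].
have TS s : S s -> S (T s).
  move=> [ss sc sn]; split.
  - by rewrite cs_starZ conj_real cs_starD !cs_starM sb ss.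
  - rewrite /T (mulbZl mP) (mulbZr mP) (mulbDl mP) (mulbDr mP); congr (_ *: (_ + _)).
      by rewrite cs_mulA.
    by rewrite -cs_mulA sc cs_mulA sc cs_mulA.
  - rewrite /T normRZr ger0_norm ?invr_ge0//.
    have h1 : normR (s ** s) <= be * be.
      by apply: (le_trans (normR_mul mP _ _)); rewrite ler_pM ?normR_ge0.
    have h2 : be * be <= be by rewrite ler_piMl// ltW.
    apply: (@le_trans _ _ (2^-1 * (be + be))).
      rewrite ler_wpM2l ?invr_ge0// (le_trans (normRD _ _))// lerD// (le_trans h1)//.
    by rewrite half_sum.
have cS : closed S.
  move=> s hs; have P := within_nbhs_proper hs.
  have ci : id @ within S (nbhs s) --> s by apply: cvg_within_filter; exact: cvg_id.
  have nS : \forall t \near within S (nbhs s), S t by apply: withinT; exact: filter_filter.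
  split.
  - apply: (@cvg_unique _ (@norm_hausdorff _ _) _ _ _ _ _ ci).
    apply: cvg_trans (cs_star_cvg _ ci); apply: near_eq_cvg.
    by apply: filterS nS => t [].
  - have c1 : (fun t => t ** b) @ within S (nbhs s) --> s ** b.
      by apply: (mul_cvg mP) => //; exact: cvg_cst.
    have c2 : (fun t => b ** t) @ within S (nbhs s) --> b ** s.
      by apply: (mul_cvg mP) => //; exact: cvg_cst.
    apply: (@cvg_unique _ (@norm_hausdorff _ _) _ _ _ _ c1).
    by apply: cvg_trans c2; apply: near_eq_cvg; apply: filterS nS => t [].
  - by apply: (normR_lim_le _ ci); apply: filterS nS => t [].
have Tlip s t : S s -> S t -> normR (T s - T t) <= be * normR (s - t).
  move=> [_ _ sn] [_ _ tn].
  have -> : T s - T t = (2^-1 : R)%:C *: (s ** (s - t) + (s - t) ** t).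
    rewrite /T -scalerBr opprD addrACA subrr add0r (mulbBr mP) (mulbBl mP).
    by rewrite subrKA.
  rewrite normRZr ger0_norm ?invr_ge0//.
  have h1 : normR (s ** (s - t)) <= be * normR (s - t).
    by apply: (le_trans (normR_mul mP _ _)); rewrite ler_wpM2r ?normR_ge0.
  have h2 : normR ((s - t) ** t) <= be * normR (s - t).
    by apply: (le_trans (normR_mul mP _ _)); rewrite mulrC ler_wpM2r ?normR_ge0.
  apply: (@le_trans _ _ (2^-1 * (be * normR (s - t) + be * normR (s - t)))).
    by rewrite ler_wpM2l ?invr_ge0// (le_trans (normRD _ _))// lerD.
  by rewrite half_sum.
have [s [ss sc sn] fs] := contraction_fixed (@complete_abs R A) cS (ex_intro _ _ S0) TS be1 Tlip.
exists (one - s); split.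
- by rewrite cs_starB ucs_star1 ss.
- by rewrite (mulbBl mP) (mulbBr mP) ucs_mul1 ucs_mulr1 sc.
- rewrite (mulbBl mP) !(mulbBr mP) !ucs_mul1 !ucs_mulr1.
  have e : s + s = b ** b + s ** s by rewrite -{1 2}fs /T -scalerDr half_scale.
  have -> : b ** b = s + s - s ** s by rewrite e addrK.
  by rewrite !opprB -addrA; congr (_ + _); rewrite addrCA -opprD.
Qed.
End Unital.
End CstarTheory.

Section StarMorphism.
Context {R : realType} {A B : unitalCstarAlgebra R} (F : A -> B).
Hypothesis FP : unital_star_morphism F.
Local Notation "x ** y" := (cs_mul x y) (at level 40, left associativity).
Let mB := @cs_bounded_mul R B.

Lemma usm0 : F 0 = 0.
Proof.
have h := usm_linear FP (-1) 0 0.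
by rewrite /= !scaleN1r oppr0 addr0 addNr in h.
Qed.
Lemma usmD x y : F (x + y) = F x + F y.
Proof. by have := usm_linear FP 1 x y; rewrite !scale1r. Qed.
Lemma usmZ (c : R[i]) x : F (c *: x) = c *: F x.
Proof. by have := usm_linear FP c x 0; rewrite !addr0 usm0 addr0. Qed.
Lemma usmB x y : F (x - y) = F x - F y.
Proof. by rewrite usmD -scaleN1r usmZ scaleN1r. Qed.

(** u = x + iy satisfies u* u = 1, so |u| <= 1 by the C*-identity, and x is the real
    part of u. *)
Lemma unitary_part (x y : B) : cs_star x = x -> cs_star y = y -> y ** x = x ** y ->
  x ** x + y ** y = ucs_one B -> normR x <= 1.
Proof.
move=> sx sy xy h; pose i : R[i] := Complex 0 1.
have ci : Num.conj i = - i by apply/eqP; rewrite eq_complex /= oppr0 !eqxx.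
have ii : i * i = -1.
  by apply/eqP; rewrite eq_complex /= !mul0r !mulr0 mul1r sub0r addr0 oppr0 !eqxx.
pose u := x + i *: y.
have su : cs_star u = x - i *: y by rewrite cs_starD cs_starZ sx sy ci scaleNr.
have uu : cs_star u ** u = ucs_one B.
  rewrite su /u (mulbDr mB) !(mulbBl mB) !(mulbZl mB) !(mulbZr mB) scalerA ii scaleN1r opprK xy.
  by rewrite addrA subrK h.
have u1 : normR u <= 1.
  have := normR_star_mul u; rewrite uu => e.
  have : normR u ^+ 2 <= 1 by rewrite -e; exact: ucs_norm1.
  by rewrite expr_le1 ?normR_ge0.
have -> : x = (2^-1 : R)%:C *: (u + cs_star u).
  by rewrite su /u addrACA subrr addr0 half_scale.
rewrite normRZr ger0_norm ?invr_ge0//.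
have : normR (u + cs_star u) <= 1 + 1.
  by apply: (le_trans (normRD _ _)); rewrite normR_star lerD.
by move=> hh; rewrite -[X in _ <= X](half_sum 1) ler_wpM2l ?invr_ge0.
Qed.

(** With c the square root of 1 - b^2, the elements F b and F c satisfy the hypotheses
    of [unitary_part]. *)
Lemma usm_selfadj (b : A) : cs_star b = b -> normR b < 1 -> normR (F b) <= 1.
Proof.
move=> sb b1; have [c [sc cb cc]] := cs_sqrt sb b1.
apply: (@unitary_part _ (F c)).
- by rewrite -usm_star// sb.
- by rewrite -usm_star// sc.
- by rewrite -!usm_mul// cb.
- by rewrite -!usm_mul// cc usmB usm_one// addrC subrK.
Qed.

(** The C*-identity reduces the claim to the self-adjoint element a* a, which is
    rescaled to norm less than 1. *)
Lemma usm_contractive (a : A) : normR (F a) <= normR a.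
Proof.
have sa b : cs_star b = b -> normR (F b) <= normR b.
  move=> sb; apply/ler_addgt0Pr => e e0.
  have p : 0 < normR b + e by rewrite ltr_wpDl ?normR_ge0.
  have ip : 0 < (normR b + e)^-1 by rewrite invr_gt0.
  (* The constant e makes the norm of c strictly less than 1. *)
  pose c := ((normR b + e)^-1)%:C *: b.
  have sc : cs_star c = c by rewrite cs_starZ conj_real sb.
  have c1 : normR c < 1.
    by rewrite normRZr gtr0_norm// mulrC ltr_pdivrMr// mul1r ltrDl.
  have := usm_selfadj sc c1.
  by rewrite usmZ normRZr gtr0_norm// mulrC ler_pdivrMr// mul1r.
have := sa (cs_star a ** a); rewrite cs_starM cs_starK => /(_ erefl).
rewrite usm_mul// usm_star// !normR_star_mul.
by rewrite ler_pXn2r// nnegrE normR_ge0.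
Qed.

End StarMorphism.

Section BogoliubovTheory.
Context {R : realType} {V : hilbertSpace R} (alpha : V -> V).
Context {C : unitalCstarAlgebra R} (iota : V -> C).
Hypothesis iotaP : clifford_algebra alpha iota.
Local Notation grpO := (orthogonal_group alpha).
Local Notation theta := (bogoliubov iota).

Lemma usm_comp (f k : C -> C) : unital_star_morphism f -> unital_star_morphism k ->
  unital_star_morphism (f \o k).
Proof.
move=> [fl fm f1 fs] [kl km k1 ks]; split=> /=.
- by move=> c x y /=; rewrite kl fl.
- by move=> a b; rewrite km fm.
- by rewrite k1 f1.
- by move=> a; rewrite ks fs.
Qed.

Lemma theta_usm g : grpO g -> unital_star_morphism (theta g).
Proof. by move=> Og; have [] := bogoliubovP iotaP Og. Qed.

Lemma theta_iota g v : grpO g -> theta g (iota v) = iota (g v).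
Proof. by move=> Og; have [] := bogoliubovP iotaP Og. Qed.

(** Uniqueness in the universal property of the Clifford algebra. *)
Lemma clifford_ext (f k : C -> C) : unital_star_morphism f -> unital_star_morphism k ->
  (exists2 g, grpO g & forall v, f (iota v) = iota (g v)) ->
  (forall v, f (iota v) = k (iota v)) -> f = k.
Proof.
move=> fP kP [g Og fg] fk; have [icl univ] := iotaP.
have [F [_ uF]] := univ _ _ (clifford_map_orthogonal icl Og).
by rewrite -(uF f)// -(uF k)//; split => // v; rewrite -fk.
Qed.

Lemma theta1 a : theta (bop_id V) a = a.
Proof.
have O1 : grpO (bop_id V) by exact: group1.
have -> // : theta (bop_id V) = id.
apply: clifford_ext => //; first exact: theta_usm.
  by exists (bop_id V) => // v; rewrite theta_iota.
by move=> v; rewrite theta_iota.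
Qed.

Lemma thetaM g h a : grpO g -> grpO h -> grpO (bop_comp g h) ->
  theta (bop_comp g h) a = theta g (theta h a).
Proof.
move=> Og Oh Ogh; rewrite -[RHS]/((theta g \o theta h) a).
have -> // : theta (bop_comp g h) = theta g \o theta h.
apply: clifford_ext; [exact: theta_usm|by apply: usm_comp; exact: theta_usm| |].
  by exists (bop_comp g h) => // v; rewrite theta_iota.
by move=> v; rewrite /= !theta_iota.
Qed.

(** th g and its inverse are both contractive. *)
Lemma theta_norm g a : grpO g -> normR (theta g a) = normR a.
Proof.
move=> Og; have [h [Oh gh hg]] := orthogonal_inverse Og.
apply/eqP; rewrite eq_le (usm_contractive (theta_usm Og)) /=.
have O1 : grpO (bop_comp h g).
  by rewrite hg; exact: group1.
rewrite -{1}(theta1 a) -hg thetaM//.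
exact: usm_contractive (theta_usm Oh) _.
Qed.

End BogoliubovTheory.

(** * Orbits of one-parameter groups *)

Lemma subD_subB (W : zmodType) (a b x y : W) : a - (x + y) - (b - x) = a - b - y.
Proof.
by rewrite opprB addrA opprD -[a + _ + x]addrA [- x - y + x]addrAC addNr add0r addrAC.
Qed.

Section LieAction.
Context {R : realType} {V : hilbertSpace R} (alpha : V -> V).
Hypothesis alphaP : real_structure alpha.
Context {C : unitalCstarAlgebra R} (iota : V -> C).
Hypothesis iotaP : clifford_algebra alpha iota.
Local Notation lieO := (orthogonal_lie_algebra alpha).
Local Notation grpO := (orthogonal_group alpha).
Local Notation "x ** y" := (bop_comp x y) (at level 40, left associativity).
Local Notation th := (bogoliubov iota).
Local Notation act := (lie_action iota).
Local Notation acts := (lie_actions iota).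
Implicit Types (X Y Z W : bop V) (a b c : C).

Let mP := @bop_comp_bounded R V.
Let mA := @bop_compA R V.
Let m1 := @bop_comp1 R V.
Let mr1 := @bop_compr1 R V.

Lemma thD g a b : grpO g -> th g (a + b) = th g a + th g b.
Proof. by move=> Og; exact: usmD (theta_usm iotaP Og) _ _. Qed.
Lemma thZ g k a : grpO g -> th g (k *: a) = k *: th g a.
Proof. by move=> Og; exact: usmZ (theta_usm iotaP Og) _ _. Qed.
Lemma thB g a b : grpO g -> th g (a - b) = th g a - th g b.
Proof. by move=> Og; exact: usmB (theta_usm iotaP Og) _ _. Qed.
Lemma th_norm g a : grpO g -> normR (th g a) = normR a.
Proof. by move=> Og; exact: (theta_norm iotaP). Qed.
Lemma thM g h a : grpO g -> grpO h -> th (g ** h) a = th g (th h a).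
Proof. by move=> Og Oh; apply: (thetaM iotaP) => //; exact: groupM. Qed.
Lemma th1 a : th (bop_id V) a = a.
Proof. exact: (theta1 iotaP). Qed.

Lemma th_cvg (T : Type) (F : set_system T) (FF : Filter F) g (f : T -> C) a : grpO g ->
  f @ F --> a -> (fun t => th g (f t)) @ F --> th g a.
Proof.
move=> Og fa; apply/cvg_normRP => e e0; have /cvg_normRP/(_ _ e0) := fa.
by apply: filterS => t; rewrite -thB// th_norm.
Qed.

Lemma group_line Y (t : R) : lieO Y -> grpO (bop_exp (t%:C *: Y)).
Proof. by move=> hY; apply: group_exp => //; exact: lieZ. Qed.
Hint Resolve group_line : core.

Definition diff_quot Y a (t : R) : C := (t%:C)^-1 *: (th (bop_exp (t%:C *: Y)) a - a).

Local Notation dq := diff_quot.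

(** [lie_action] is a total function; it is only meaningful where the difference
    quotients converge. *)
Lemma act_lim Y a b : dq Y a @ 0^' --> b -> act Y a = b.
Proof. by move=> h; apply: cvg_lim => //; exact: norm_hausdorff. Qed.

Lemma dq_lin Y (k : R[i]) a b a' b' : lieO Y -> dq Y a @ 0^' --> a' -> dq Y b @ 0^' --> b' ->
  dq Y (k *: a + b) @ 0^' --> k *: a' + b'.
Proof.
move=> hY ha hb.
have h : (fun t => k *: dq Y a t + dq Y b t) @ 0^' --> k *: a' + b'.
  by apply: cvgD => //; exact: cvgZr.
apply: cvg_trans h; apply: near_eq_cvg; apply: filterE => t.
rewrite /diff_quot thD ?thZ; try exact: group_line.
by rewrite [in RHS]opprD [in RHS]addrACA -[in RHS]scalerBr [in RHS]scalerDr !scalerA [k * _]mulrC.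
Qed.

Lemma dq_scale Y (s : R) a b : dq Y a @ 0^' --> b -> dq (s%:C *: Y) a @ 0^' --> s%:C *: b.
Proof.
have [->|s0] := eqVneq s 0.
  move=> _; rewrite rmorph0 !scale0r; apply: cvg_near_cst; apply: filterE => t.
  by rewrite /diff_quot scaler0 exp0 th1 subrr scaler0.
move=> h.
have h2 : (fun t => s%:C *: dq Y a (t * s)) @ 0^' --> s%:C *: b.
  by apply: cvgZr; exact: (cvg_comp _ _ (dnbhs_scale s0) h).
apply: cvg_trans h2; apply: near_eq_cvg; apply: filterE => t.
have sC : s%:C != 0 :> R[i] by rewrite realC_eq0.
rewrite /diff_quot !scalerA rmorphM invfM mulrCA mulfV// mulr1.
by rewrite -scalerA.
Qed.

(** th (exp ((s + t) Y)) = th (exp (sY)) th (exp (tY)): the derivative at s is the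
    derivative at 0, transported. *)
Lemma orbit_deriv Y a b (s : R) : lieO Y -> dq Y a @ 0^' --> b ->
  (fun t : R => (t%:C)^-1 *: (th (bop_exp ((s + t)%:C *: Y)) a - th (bop_exp (s%:C *: Y)) a)) @ 0^'
    --> th (bop_exp (s%:C *: Y)) b.
Proof.
move=> hY h.
have h2 : (fun t => th (bop_exp (s%:C *: Y)) (dq Y a t)) @ 0^' --> th (bop_exp (s%:C *: Y)) b.
  by apply: th_cvg => //; exact: group_line.
apply: cvg_trans h2; apply: near_eq_cvg; apply: filterE => t.
rewrite exp_lineD thM; [|exact: group_line|exact: group_line].
by rewrite /diff_quot thZ ?thB//; exact: group_line.
Qed.

Lemma orbit_lip Y a b : lieO Y -> dq Y a @ 0^' --> b -> normR (th (bop_exp Y) a - a) <= normR b.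
Proof.
move=> hY h.
have := @mvt_normR R C (fun s => th (bop_exp (s%:C *: Y)) a)
   (fun s => th (bop_exp (s%:C *: Y)) b) (normR b).
rewrite /= rmorph1 scale1r rmorph0 scale0r exp0 th1; apply.
  by move=> s _ _; exact: orbit_deriv.
by move=> s _ _; rewrite th_norm//; exact: group_line.
Qed.

Lemma orbit_lip_line Y a b (t : R) : lieO Y -> dq Y a @ 0^' --> b ->
  normR (th (bop_exp (t%:C *: Y)) a - a) <= `|t| * normR b.
Proof.
move=> hY h; rewrite -normRZr; apply: orbit_lip; first exact: lieZ.
exact: dq_scale.
Qed.

(** The mean value estimate for s |-> th (exp (sY)) a - s Ya, whose derivative th (exp
    (sY)) Ya - Ya is bounded by |s| |YYa| according to [orbit_lip_line]. *)
Lemma orbit_taylor Y a b c : lieO Y -> dq Y a @ 0^' --> b -> dq Y b @ 0^' --> c ->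
  normR (th (bop_exp Y) a - a - b) <= normR c.
Proof.
move=> hY ha hb.
have := @mvt_normR R C (fun s => th (bop_exp (s%:C *: Y)) a - s%:C *: b)
   (fun s => th (bop_exp (s%:C *: Y)) b - b) (normR c).
rewrite /= rmorph1 !scale1r rmorph0 !scale0r exp0 th1 subr0 addrAC; apply.
  move=> s _ _.
  have h : (fun t : R => (t%:C)^-1 *: (th (bop_exp ((s + t)%:C *: Y)) a - th (bop_exp (s%:C *: Y))
    a) - b) @ 0^'
    --> th (bop_exp (s%:C *: Y)) b - b.
    by apply: cvgB; [exact: orbit_deriv|exact: cvg_cst].
  apply: cvg_trans h; apply: near_eq_cvg; near=> t.
  have t0 : t != 0 by near: t; apply/near0P; exists 1.
  have tC : t%:C != 0 :> R[i] by rewrite realC_eq0.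
  rewrite [(s + t)%:C *: b](_ : _ = s%:C *: b + t%:C *: b); last by rewrite rmorphD scalerDl.
  by rewrite subD_subB [in RHS]scalerBr scalerA mulVf// scale1r.
move=> s s0 s1; apply: (le_trans (orbit_lip_line s hY hb)).
by rewrite ger0_norm// ler_piMl ?normR_ge0.
Unshelve. all: by end_near. Qed.

Lemma orbit_cont Y a b : lieO Y -> dq Y a @ 0^' --> b ->
  (fun t : R => th (bop_exp (t%:C *: Y)) a) @ 0^' --> a.
Proof.
move=> hY h; apply/cvg_normRP => e e0; apply/near0P.
have p0 : 0 < normR b + 1 by rewrite ltr_wpDl ?normR_ge0.
exists (e / (normR b + 1)); first exact: divr_gt0.
move=> t te _; apply: (le_lt_trans (orbit_lip_line t hY h)).
apply: (@le_lt_trans _ _ (`|t| * (normR b + 1))); first by rewrite ler_wpM2l// lerDl.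
by rewrite -ltr_pdivlMr.
Qed.

(** The mean value estimate bounds the difference quotients of x t minus y0 by the
    oscillation of the orbit of y0, uniformly in t, and passes to the limit.
    Differentiability of y t makes its orbit continuous, hence also the orbit of the
    limit y0. *)
Lemma act_closed (T : Type) (F : set_system T) (FF : ProperFilter F) Z (x y : T -> C) (x0 y0 : C) :
  lieO Z -> (\forall t \near F, dq Z (x t) @ 0^' --> y t) ->
  (\forall t \near F, exists w : C, dq Z (y t) @ 0^' --> w) ->
  x @ F --> x0 -> y @ F --> y0 -> dq Z x0 @ 0^' --> y0.
Proof.
move=> hZ dx dy xx0 yy0.
have cy0 : forall e, 0 < e -> exists2 d, 0 < d &
    forall s : R, `|s| < d -> normR (th (bop_exp (s%:C *: Z)) y0 - y0) < e.
  move=> e e0; have e3 : 0 < e / 3 by exact: divr_gt0.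
  have /cvg_normRP/(_ _ e3) hy := yy0.
  have [t [[w hw] yt]] := filter_ex (filterI dy hy).
  have /cvg_normRP/(_ _ e3)/near0P[d d0 H] := orbit_cont hZ hw.
  exists d => // s sd; have [->|s0] := eqVneq s 0.
    by rewrite scale0r exp0 th1 subrr normR0.
  apply: (le_lt_trans (normR_dist3 _ (th (bop_exp (s%:C *: Z)) (y t)) _)).
  rewrite (_ : e = e / 3 + (e / 3 + e / 3)); last by field.
  apply: ltrD; first by rewrite -thB;
    [rewrite th_norm; [rewrite normRBC|exact: group_line]|exact: group_line].
  by apply: (le_lt_trans (normR_dist3 _ (y t) _)); apply: ltrD => //; exact: H.
apply/cvg_normRP => e e0; have e2 : 0 < e / 2 by exact: divr_gt0.
have e4 : 0 < e / 4 by exact: divr_gt0.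
have [d d0 Hd] := cy0 _ e4.
apply/near0P; exists d => // s sd s0.
have h : (fun t => dq Z (x t) s - y0) @ F --> dq Z x0 s - y0.
  apply: cvgB; last exact: cvg_cst.
  by apply: cvgZr; apply: cvgB => //; apply: th_cvg => //; exact: group_line.
apply: (@le_lt_trans _ _ (e / 2)); last by rewrite ltr_pdivrMr// ltr_pMr// ltr1n.
apply: (normR_lim_le _ h).
have /cvg_normRP/(_ _ e4) hy := yy0.
apply: filterS2 dx hy => t dxt yt.
have sC : s%:C != 0 :> R[i] by rewrite realC_eq0.
have := @mvt_normR R C (fun r => (s%:C)^-1 *: th (bop_exp (r%:C *: (s%:C *: Z))) (x t) - r%:C *: y0)
   (fun r => th (bop_exp (r%:C *: (s%:C *: Z))) (y t) - y0) (e / 2).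
rewrite /= rmorph1 !scale1r rmorph0 !scale0r exp0 th1 subr0 addrAC -scalerBr; apply.
  move=> r _ _.
  have k := @orbit_deriv _ _ _ r (lieZ alphaP s hZ) (@dq_scale _ s _ _ dxt).
  have k2 : (fun u : R => (s%:C)^-1 *:
    ((u%:C)^-1 *: (th (bop_exp ((r + u)%:C *: (s%:C *: Z))) (x t)
    - th (bop_exp (r%:C *: (s%:C *: Z))) (x t))) - y0) @ 0^' -->
    (s%:C)^-1 *: th (bop_exp (r%:C *: (s%:C *: Z))) (s%:C *: y t) - y0.
    by apply: cvgB; [apply: cvgZr; exact: k|exact: cvg_cst].
  have e5 : (s%:C)^-1 *: th (bop_exp (r%:C *: (s%:C *: Z))) (s%:C *: y t)
    = th (bop_exp (r%:C *: (s%:C *: Z))) (y t).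
    by rewrite thZ; [rewrite [LHS]scalerA mulVf// scale1r|apply: group_line; exact: lieZ].
  rewrite e5 in k2.
  apply: cvg_trans k2; apply: near_eq_cvg; near=> u.
  have u0 : u != 0 by near: u; apply/near0P; exists 1.
  have uC : u%:C != 0 :> R[i] by rewrite realC_eq0.
  rewrite [(r + u)%:C *: y0](_ : _ = r%:C *: y0 + u%:C *: y0); last by rewrite rmorphD scalerDl.
  rewrite subD_subB [RHS]scalerBr.
  rewrite [u%:C^-1 *: (u%:C *: y0)](_ : _ = y0); last by rewrite scalerA mulVf// scale1r.
  by congr (_ - _); rewrite -[in RHS]scalerBr [LHS]scalerA [RHS]scalerA mulrC.
move=> r r0 r1; apply: (le_trans (normR_dist3 _ (th (bop_exp (r%:C *: (s%:C *: Z))) y0) _)).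
rewrite (_ : e / 2 = e / 4 + e / 4); last by field.
apply: lerD.
  by rewrite -thB; [rewrite th_norm; [exact: ltW|]|]; apply: group_line; exact: lieZ.
rewrite scalerA -rmorphM; apply: ltW; apply: Hd; rewrite normrM (ger0_norm r0).
by apply: le_lt_trans sd; rewrite ler_piMl.
Unshelve. all: by end_near. Qed.

(** exp (tY) g = g exp (t g^-1 Y g). *)
Lemma dq_equiv g h Y a b : grpO g -> h ** g = bop_id V -> g ** h = bop_id V -> lieO Y ->
  lieO (h ** Y ** g) ->
  dq (h ** Y ** g) a @ 0^' --> b -> dq Y (th g a) @ 0^' --> th g b.
Proof.
move=> Og hg gh hY hY' H.
have h2 : (fun t => th g (dq (h ** Y ** g) a t)) @ 0^' --> th g b by exact: th_cvg.
apply: cvg_trans h2; apply: near_eq_cvg; apply: filterE => t.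
rewrite /diff_quot thZ// thB// -!thM//; try exact: group_line.
rewrite (_ : t%:C *: (h ** Y ** g) = h ** (t%:C *: Y) ** g); last first.
  by rewrite (mulbZr mP) (mulbZl mP).
by rewrite exp_conj// !mA gh m1.
Qed.

End LieAction.

(** * Lie-smooth vectors and their seminorms *)

Section SmoothVectors.
Context {R : realType} {V : hilbertSpace R} (alpha : V -> V).
Hypothesis alphaP : real_structure alpha.
Context {C : unitalCstarAlgebra R} (iota : V -> C).
Hypothesis iotaP : clifford_algebra alpha iota.
Local Notation lieO := (orthogonal_lie_algebra alpha).
Local Notation grpO := (orthogonal_group alpha).
Local Notation "x ** y" := (bop_comp x y) (at level 40, left associativity).
Local Notation th := (bogoliubov iota).
Local Notation act := (lie_action iota).
Local Notation acts := (lie_actions iota).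
Local Notation dq := (diff_quot iota).
Implicit Types (X Y Z W : bop V) (a b c : C) (Ys : seq (bop V)).

Let mP := @bop_comp_bounded R V.
Let mA := @bop_compA R V.
Let m1 := @bop_comp1 R V.
Let mr1 := @bop_compr1 R V.
Let mC := @cs_bounded_mul R C.

Definition lie_seq Ys := forall Y, Y \in Ys -> lieO Y.
Definition lie_unit_seq Ys := forall Y, Y \in Ys -> lieO Y /\ normR Y <= 1.
Local Notation lies := lie_seq.
Local Notation units := lie_unit_seq.

Lemma units_lies Ys : units Ys -> lies Ys.
Proof. by move=> h Y /h[]. Qed.
Lemma lies_cons Y Ys : lies (Y :: Ys) <-> lieO Y /\ lies Ys.
Proof.
split=> [h|[hY h] Z]; last by rewrite in_cons => /orP[/eqP ->|/h].
by split=> [|Z hZ]; apply: h; rewrite in_cons ?eqxx// hZ orbT.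
Qed.
Lemma lies_rcons Y Ys : lies (rcons Ys Y) <-> lieO Y /\ lies Ys.
Proof.
split=> [h|[hY h] Z]; last by rewrite mem_rcons in_cons => /orP[/eqP ->|/h].
by split=> [|Z hZ]; apply: h; rewrite mem_rcons in_cons ?eqxx// hZ orbT.
Qed.
Lemma units_rcons Y Ys : units (rcons Ys Y) <-> (lieO Y /\ normR Y <= 1) /\ units Ys.
Proof.
split=> [h|[hY h] Z]; last by rewrite mem_rcons in_cons => /orP[/eqP ->|/h].
by split=> [|Z hZ]; apply: h; rewrite mem_rcons in_cons ?eqxx// hZ orbT.
Qed.

Lemma acts_rcons Ys Y a : acts (rcons Ys Y) a = acts Ys (act Y a).
Proof. by rewrite /lie_actions foldr_rcons. Qed.

(** Existence of the directional derivatives does not imply additivity in the direction.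
    Additivity of the outermost one, for all orders, gives multilinearity. *)
Record lie_smooth a : Prop := LieSmooth {
  sm_dq : forall Ys Y, lies Ys -> lieO Y -> dq Y (acts Ys a) @ 0^' --> acts (Y :: Ys) a;
  sm_add : forall Ys Y Y', lies Ys -> lieO Y -> lieO Y' ->
    act (Y + Y') (acts Ys a) = act Y (acts Ys a) + act Y' (acts Ys a);
  sm_bnd : forall n, exists M, forall Ys, size Ys = n -> units Ys -> normR (acts Ys a) <= M }.

Local Notation Sm := lie_smooth.

Lemma lies_nil : lies [::]. Proof. by []. Qed.

Lemma sm_dq1 a Y : Sm a -> lieO Y -> dq Y a @ 0^' --> act Y a.
Proof. by move=> sa hY; exact: (sm_dq sa lies_nil hY). Qed.

Lemma sm_addY a Y Y' : Sm a -> lieO Y -> lieO Y' -> act (Y + Y') a = act Y a + act Y' a.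
Proof. by move=> sa hY hY'; exact: (sm_add sa lies_nil hY hY'). Qed.

Lemma sm_scaleY a Y (t : R) : Sm a -> lieO Y -> act (t%:C *: Y) a = t%:C *: act Y a.
Proof. by move=> sa hY; apply: act_lim; apply: (dq_scale iotaP); exact: sm_dq1. Qed.

Lemma acts_lin Ys (k : R[i]) a b : Sm a -> Sm b -> lies Ys ->
  acts Ys (k *: a + b) = k *: acts Ys a + acts Ys b.
Proof.
move=> sa sb; elim: Ys => // Y Ys IH /lies_cons[hY hYs] /=.
by rewrite IH//; apply: act_lim; apply: (dq_lin alphaP iotaP) => //; exact: sm_dq.
Qed.

Lemma Sm_lin (k : R[i]) a b : Sm a -> Sm b -> Sm (k *: a + b).
Proof.
move=> sa sb; split.
- move=> Ys Y hYs hY; rewrite !acts_lin//; last by apply/lies_cons.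
  by apply: (dq_lin alphaP iotaP) => //; exact: sm_dq.
- move=> Ys Y Y' hYs hY hY'; rewrite acts_lin//.
  have h W : lieO W -> act W (k *: acts Ys a + acts Ys b) = k *: act W (acts Ys a)
    + act W (acts Ys b).
    by move=> hW; apply: act_lim; apply: (dq_lin alphaP iotaP) => //; exact: sm_dq.
  rewrite (h (Y + Y') (lieD alphaP hY hY')) (h Y hY) (h Y' hY').
  by rewrite (sm_add sa)// (sm_add sb)// scalerDr addrACA.
- move=> n; have [M hM] := sm_bnd sa n; have [N hN] := sm_bnd sb n.
  exists (complex.Re `|k| * M + N) => Ys sY uY; rewrite acts_lin//; last exact: units_lies.
  apply: (le_trans (normRD _ _)); rewrite normRZ; apply: lerD; last exact: hN.
  by apply: ler_wpM2l; [exact: Re_norm_ge0|exact: hM].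
Qed.

Lemma Sm0 : Sm 0.
Proof.
have z Y : lieO Y -> dq Y 0 @ 0^' --> (0 : C).
  move=> hY; apply: cvg_near_cst; apply: filterE => t.
  have O := group_line alphaP t hY.
  by rewrite /diff_quot -{1}(subrr (0 : C)) (thB iotaP)// subrr subrr scaler0.
have z0 Ys : lies Ys -> acts Ys 0 = 0.
  elim: Ys => // Y Ys IH /lies_cons[hY hYs] /=.
  by rewrite IH//; apply: act_lim; exact: z.
split.
- by move=> Ys Y hYs hY; rewrite !z0//; [exact: z|exact/lies_cons].
- move=> Ys Y Y' hYs hY hY'; rewrite z0//.
  have h W : lieO W -> act W 0 = 0 by move=> hW; apply: act_lim; exact: z.
  by rewrite (h (Y + Y') (lieD alphaP hY hY')) (h Y hY) (h Y' hY') addr0.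
- by move=> n; exists 0 => Ys _ uY; rewrite z0 ?normR0//; exact: units_lies.
Qed.

Lemma SmD a b : Sm a -> Sm b -> Sm (a + b).
Proof. by move=> sa sb; rewrite -(scale1r a); exact: Sm_lin. Qed.
Lemma SmZ (k : R[i]) a : Sm a -> Sm (k *: a).
Proof. by move=> sa; rewrite -(addr0 (_ *: _)); apply: Sm_lin => //; exact: Sm0. Qed.
Lemma SmN a : Sm a -> Sm (- a).
Proof. by move=> sa; rewrite -scaleN1r; exact: SmZ. Qed.
Lemma SmB a b : Sm a -> Sm b -> Sm (a - b).
Proof. by move=> sa sb; apply: SmD => //; exact: SmN. Qed.

Lemma act_D Y a b : Sm a -> Sm b -> lieO Y -> act Y (a + b) = act Y a + act Y b.
Proof.
move=> sa sb hY; have /(_ [:: Y] 1 a b sa sb) := acts_lin.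
by rewrite /= !scale1r; apply; apply/lies_cons.
Qed.
Lemma act_Z Y (k : R[i]) a : Sm a -> lieO Y -> act Y (k *: a) = k *: act Y a.
Proof.
move=> sa hY; have /(_ [:: Y] k a 0 sa Sm0) := acts_lin.
have z : act Y 0 = 0.
  have /(_ [:: Y] (-1) 0 0 Sm0 Sm0) := acts_lin.
  by rewrite /= !scaleN1r !addNr => -> //; apply/lies_cons.
by rewrite /= !addr0 z addr0; apply; apply/lies_cons.
Qed.
Lemma act_B Y a b : Sm a -> Sm b -> lieO Y -> act Y (a - b) = act Y a - act Y b.
Proof.
by move=> sa sb hY; rewrite act_D//; [rewrite -scaleN1r act_Z// scaleN1r|exact: SmN].
Qed.

Lemma sm_subY a Y Y' : Sm a -> lieO Y -> lieO Y' -> act (Y - Y') a = act Y a - act Y' a.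
Proof.
move=> sa hY hY'; rewrite sm_addY//; last exact: lieN.
by rewrite -scaleN1r -(rmorph1 (real_complex R)) -rmorphN sm_scaleY// rmorphN rmorph1 scaleN1r.
Qed.

(** Scaling of the innermost direction passes through the outer derivatives, which are
    linear where they exist. *)
Lemma acts_last_scale Ys Y (t : R) a : Sm a -> lies Ys -> lieO Y ->
  acts Ys (t%:C *: act Y a) = t%:C *: acts Ys (act Y a).
Proof.
move=> sa; elim: Ys => // Z Ys IH /lies_cons[hZ hYs] hY /=.
rewrite IH//; apply: act_lim.
rewrite -[_ *: acts Ys _]addr0 -[X in _ --> X]addr0.
have z : dq Z 0 @ 0^' --> (0 : C).
  have h := sm_dq1 Sm0 hZ; rewrite (_ : act Z 0 = 0) in h => //.
  by have := act_Z 0 Sm0 hZ; rewrite !scale0r.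
apply: (dq_lin alphaP iotaP) => //.
have hr : lies (rcons Ys Y) by apply/lies_rcons.
by have := sm_dq sa hr hZ; rewrite -rcons_cons !acts_rcons.
Qed.

(** The derivatives of Ya are those of a with one more innermost direction; only the
    bounds, stated for the unit ball, need rescaling. *)
Lemma Sm_act Y a : Sm a -> lieO Y -> Sm (act Y a).
Proof.
move=> sa hY; split.
- move=> Ys Z hYs hZ; have hr : lies (rcons Ys Y) by apply/lies_rcons.
  by have := sm_dq sa hr hZ; rewrite -rcons_cons !acts_rcons.
- move=> Ys Z Z' hYs hZ hZ'; have hr : lies (rcons Ys Y) by apply/lies_rcons.
  by have := sm_add sa hr hZ hZ'; rewrite !acts_rcons.
- move=> n; have [M hM] := sm_bnd sa n.+1.
  have M0 : 0 <= M.
    apply: le_trans (normR_ge0 _) (hM (nseq n.+1 0) (size_nseq _ _) _).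
    by move=> W; rewrite mem_nseq => /andP[_ /eqP ->]; split; [exact: lie0|rewrite normR0].
  exists (normR Y * M) => Ys sY uY.
  have [Y0|Y0] := eqVneq (normR Y) 0.
    rewrite Y0 mul0r -[act Y a]scale1r (normR_eq0 Y0).
    have := @sm_scaleY a 0 0 sa (lie0 alphaP); rewrite rmorph0 !scale0r => ->.
    rewrite scaler0.
    have := @acts_lin Ys (-1) 0 0 Sm0 Sm0 (units_lies uY).
    by rewrite !scaleN1r oppr0 addr0 addNr => ->; rewrite normR0.
  pose Y1 := ((normR Y)^-1)%:C *: Y.
  have hY1 : lieO Y1 by exact: lieZ.
  have eY : Y = (normR Y)%:C *: Y1.
    by rewrite /Y1 scalerA -rmorphM mulfV// rmorph1 scale1r.
  rewrite {1}eY sm_scaleY// acts_last_scale//; last exact: units_lies.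
  rewrite normRZr ger0_norm ?normR_ge0//; apply: ler_wpM2l; first exact: normR_ge0.
  rewrite -acts_rcons; apply: hM; first by rewrite size_rcons sY.
  apply/units_rcons; split => //; split => //.
  by rewrite normRZr normfV ger0_norm ?normR_ge0// mulVf.
Qed.

Definition lie_norm_set n a := [set normR (acts Ys a) | Ys in
  [set Ys | (size Ys <= n)%N /\ units Ys]].
Definition lie_norm n a : R := sup (lie_norm_set n a).
Local Notation P := lie_norm.

Lemma lie_norm_has_sup n a : Sm a -> has_sup (lie_norm_set n a).
Proof.
move=> sa; split; first by exists (normR a); exists [::].
suff [M hM] : exists M, forall Ys, (size Ys <= n)%N -> units Ys -> normR (acts Ys a) <= M.
  by exists M => _ [Ys [sY uY] <-]; exact: hM.
elim: n => [|n [M hM]].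
  by exists (normR a) => -[].
have [N hN] := sm_bnd sa n.+1; exists (Num.max M N) => Ys.
rewrite leq_eqVlt => /orP[/eqP sY uY|sY uY]; rewrite le_max.
  by rewrite hN// orbT.
by rewrite hM.
Qed.

Lemma P_ub n a Ys : Sm a -> (size Ys <= n)%N -> units Ys -> normR (acts Ys a) <= P n a.
Proof. by move=> sa sY uY; apply: sup_upper_bound; [exact: lie_norm_has_sup|exists Ys]. Qed.

Lemma P_le n a (M : R) : Sm a ->
  (forall Ys, (size Ys <= n)%N -> units Ys -> normR (acts Ys a) <= M) -> P n a <= M.
Proof.
move=> sa hM; apply: ge_sup; first by have [] := lie_norm_has_sup n sa.
by move=> _ [Ys [sY uY] <-]; exact: hM.
Qed.

Lemma P_norm n a : Sm a -> normR a <= P n a.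
Proof. by move=> sa; exact: (P_ub (Ys := [::])). Qed.

Lemma P_ge0 n a : Sm a -> 0 <= P n a.
Proof. by move=> sa; exact: le_trans (normR_ge0 _) (P_norm n sa). Qed.

Lemma P0E a : Sm a -> P 0 a = normR a.
Proof.
move=> sa; apply/eqP; rewrite eq_le P_norm// andbT.
by apply: P_le => // -[].
Qed.

Lemma P_mono n m a : Sm a -> (n <= m)%N -> P n a <= P m a.
Proof. by move=> sa nm; apply: P_le => // Ys sY uY; apply: P_ub => //; exact: leq_trans nm. Qed.

Lemma PD n a b : Sm a -> Sm b -> P n (a + b) <= P n a + P n b.
Proof.
move=> sa sb; apply: P_le => [|Ys sY uY]; first exact: SmD.
rewrite -[a]scale1r acts_lin//; last exact: units_lies.
by rewrite !scale1r (le_trans (normRD _ _))// lerD// P_ub.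
Qed.

Lemma PZ n (k : R[i]) a : Sm a -> P n (k *: a) = complex.Re `|k| * P n a.
Proof.
have le (l : R[i]) b : Sm b -> P n (l *: b) <= complex.Re `|l| * P n b.
  move=> sb; apply: P_le => [|Ys sY uY]; first exact: SmZ.
  have := acts_lin l sb Sm0 (units_lies uY).
  have z : acts Ys 0 = 0.
    have := @acts_lin Ys (-1) 0 0 Sm0 Sm0 (units_lies uY).
    by rewrite !scaleN1r oppr0 addr0 addNr.
  rewrite z !addr0 => ->; rewrite normRZ.
  by apply: ler_wpM2l; [exact: Re_norm_ge0|exact: P_ub].
move=> sa; apply/eqP; rewrite eq_le le// andTb.
have [->|k0] := eqVneq k 0.
  by rewrite normr0 mul0r P_ge0//; exact: SmZ.
have n0 : 0 < complex.Re `|k|.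
  have : 0 < `|k| by rewrite normr_gt0.
  by rewrite ltcE => /andP[].
have nV : complex.Re `|k^-1| = (complex.Re `|k|)^-1.
  apply: (mulIf (lt0r_neq0 n0)); rewrite mulVf ?lt0r_neq0//.
  apply: (@complexI R); transitivity (`|k^-1| * `|k|).
    by rewrite [RHS](congr2 *%R (normcRe k^-1) (normcRe k)) -rmorphM.
  by rewrite -normrM mulVf// normr1.
rewrite -ler_pdivlMl// -nV.
by have := le k^-1 _ (SmZ k sa); rewrite scalerA mulVf// scale1r.
Qed.

Lemma P_actu n Y a : Sm a -> lieO Y -> normR Y <= 1 -> P n (act Y a) <= P n.+1 a.
Proof.
move=> sa hY Y1; apply: P_le => [|Ys sY uY]; first exact: Sm_act.
rewrite -acts_rcons; apply: P_ub => //; first by rewrite size_rcons.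
by apply/units_rcons.
Qed.

Lemma P_act n Y a : Sm a -> lieO Y -> P n (act Y a) <= normR Y * P n.+1 a.
Proof.
move=> sa hY; have [Y0|Y0] := eqVneq (normR Y) 0.
  rewrite Y0 mul0r (normR_eq0 Y0).
  have := @sm_scaleY a 0 0 sa (lie0 alphaP); rewrite rmorph0 !scale0r => ->.
  by rewrite -(scale0r (0 : C)) PZ ?normr0 ?mul0r//; exact: Sm0.
pose Y1 := ((normR Y)^-1)%:C *: Y.
have hY1 : lieO Y1 by exact: lieZ.
have eY : Y = (normR Y)%:C *: Y1.
  by rewrite /Y1 scalerA -rmorphM mulfV// rmorph1 scale1r.
rewrite {1}eY sm_scaleY// PZ; last exact: Sm_act.
rewrite Re_normr_real ger0_norm ?normR_ge0//; apply: ler_wpM2l; first exact: normR_ge0.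
by apply: P_actu => //; rewrite normRZr normfV ger0_norm ?normR_ge0// mulVf.
Qed.

(** Estimates in the seminorms by induction: the seminorm of order n + 1 is controlled
    by the norm and by the seminorms of order n of the derivatives. *)
Lemma P_S_le n a (M : R) : Sm a -> normR a <= M ->
  (forall Y, lieO Y -> normR Y <= 1 -> P n (act Y a) <= M) -> P n.+1 a <= M.
Proof.
move=> sa aM hM; apply: P_le => // Ys; elim/last_ind: Ys => // Ys Y _.
rewrite size_rcons ltnS => sY /units_rcons[[hY Y1] uY].
rewrite acts_rcons; apply: le_trans (hM Y hY Y1).
by apply: P_ub => //; exact: Sm_act.
Qed.

End SmoothVectors.

(** * Products, involution, equivariance, completeness *)

Section SmoothCalculus.
Context {R : realType} {V : hilbertSpace R} (alpha : V -> V).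
Hypothesis alphaP : real_structure alpha.
Context {C : unitalCstarAlgebra R} (iota : V -> C).
Hypothesis iotaP : clifford_algebra alpha iota.
Local Notation lieO := (orthogonal_lie_algebra alpha).
Local Notation grpO := (orthogonal_group alpha).
Local Notation "x ** y" := (bop_comp x y) (at level 40, left associativity).
Local Notation th := (bogoliubov iota).
Local Notation act := (lie_action iota).
Local Notation acts := (lie_actions iota).
Local Notation dq := (diff_quot iota).
Local Notation Sm := (lie_smooth alpha iota).
Local Notation P := (lie_norm alpha iota).
Local Notation lies := (lie_seq alpha).
Local Notation units := (lie_unit_seq alpha).
Implicit Types (X Y Z W : bop V) (a b c : C) (Ys : seq (bop V)).

Let mP := @bop_comp_bounded R V.
Let mA := @bop_compA R V.
Let m1 := @bop_comp1 R V.
Let mr1 := @bop_compr1 R V.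
Let mC := @cs_bounded_mul R C.

(** Differentiability to order n with additivity but without bounds: an inductive form
    of the first two clauses of [lie_smooth], convenient for products, whose iterated
    derivatives are sums of products. *)
Fixpoint lie_diff n c : Prop := if n is m.+1 then
  (forall Y, lieO Y -> dq Y c @ 0^' --> act Y c /\ lie_diff m (act Y c)) /\
  (forall Y Y', lieO Y -> lieO Y' -> act (Y + Y') c = act Y c + act Y' c) else True.

Lemma lie_diff_acts n c Ys : lies Ys -> lie_diff (n + size Ys) c -> lie_diff n (acts Ys c).
Proof.
elim: Ys n => [|Y Ys IH] n; first by rewrite addn0.
move=> /lies_cons[hY hYs]; rewrite addnS -addSn => /(IH _ hYs) /= -[h _].
exact: (h Y hY).2.
Qed.

Lemma Sm_of_lie_diff c : (forall n, lie_diff n c) ->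
  (forall n, exists M, forall Ys, size Ys = n -> units Ys -> normR (acts Ys c) <= M) -> Sm c.
Proof.
move=> h hM; split => //.
  by move=> Ys Y hYs hY; have [k _] := @lie_diff_acts 1 c Ys hYs (h _); exact: (k Y hY).1.
by move=> Ys Y Y' hYs hY hY'; have [_ k] := @lie_diff_acts 1 c Ys hYs (h _); exact: k.
Qed.

Lemma dq_add Y a b a' b' : lieO Y -> dq Y a @ 0^' --> a' -> dq Y b @ 0^' --> b' ->
  dq Y (a + b) @ 0^' --> a' + b'.
Proof.
move=> hY ha hb; have := @dq_lin _ _ _ alphaP _ _ iotaP Y 1 a b a' b' hY ha hb.
by rewrite !scale1r.
Qed.

Lemma lie_diff_add n a b : lie_diff n a -> lie_diff n b -> lie_diff n (a + b).
Proof.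
elim: n a b => //= n IH a b [ha ha'] [hb hb'].
have e Y : lieO Y -> dq Y (a + b) @ 0^' --> act Y a + act Y b.
  by move=> hY; apply: dq_add => //; [exact: (ha Y hY).1|exact: (hb Y hY).1].
have e' Y : lieO Y -> act Y (a + b) = act Y a + act Y b by move=> hY; apply: act_lim; exact: e.
split=> [Y hY|Y Y' hY hY'].
  rewrite e'//; split; first exact: e.
  by apply: IH; [exact: (ha Y hY).2|exact: (hb Y hY).2].
rewrite (e' (Y + Y') (lieD alphaP hY hY')) (e' Y hY) (e' Y' hY') ha'// hb'//.
by rewrite addrACA.
Qed.

Lemma acts_add Ys a b : lies Ys -> lie_diff (size Ys) a -> lie_diff (size Ys) b ->
  acts Ys (a + b) = acts Ys a + acts Ys b.
Proof.
elim/last_ind: Ys a b => // Ys Y IH a b; rewrite size_rcons => /lies_rcons[hY hYs] [ha _] [hb _].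
rewrite !acts_rcons -IH//; [|exact: (ha Y hY).2|exact: (hb Y hY).2].
congr (acts Ys _); apply: act_lim; apply: dq_add => //; [exact: (ha Y hY).1|exact: (hb Y hY).1].
Qed.

(** The usual proof of the Leibniz rule; th (exp (tY)) b tends to b because the orbit of
    b is differentiable. *)
Lemma dq_mul Y a b a' b' : lieO Y -> dq Y a @ 0^' --> a' -> dq Y b @ 0^' --> b' ->
  dq Y (cs_mul a b) @ 0^' --> cs_mul a' b + cs_mul a b'.
Proof.
move=> hY ha hb.
have h : (fun t => cs_mul (dq Y a t) (th (bop_exp (t%:C *: Y)) b) + cs_mul a (dq Y b t)) @ 0^'
    --> cs_mul a' b + cs_mul a b'.
  apply: cvgD; apply: (mul_cvg mC) => //; last exact: cvg_cst.
  exact: (orbit_cont alphaP iotaP hY hb).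
apply: cvg_trans h; apply: near_eq_cvg; apply: filterE => t.
have O := group_line alphaP t hY.
rewrite /diff_quot (usm_mul (theta_usm iotaP O)) (mulbZl mC) (mulbZr mC) -scalerDr.
by congr (_ *: _); rewrite (mulbBl mC) (mulbBr mC) subrKA.
Qed.

Lemma act_mul Y a b : Sm a -> Sm b -> lieO Y ->
  act Y (cs_mul a b) = cs_mul (act Y a) b + cs_mul a (act Y b).
Proof.
by move=> sa sb hY; apply: act_lim; apply: dq_mul => //; [exact: (sm_dq1 sa)|exact: (sm_dq1 sb)].
Qed.

Lemma lie_diff_mul n a b : Sm a -> Sm b -> lie_diff n (cs_mul a b).
Proof.
elim: n a b => //= n IH a b sa sb; split=> [Y hY|Y Y' hY hY'].
  rewrite act_mul//; split; first by apply: dq_mul => //; [exact: (sm_dq1 sa)|exact: (sm_dq1 sb)].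
  by apply: lie_diff_add; apply: IH => //; exact: (Sm_act alphaP iotaP).
rewrite (act_mul sa sb (lieD alphaP hY hY')) (act_mul sa sb hY) (act_mul sa sb hY').
by rewrite (sm_addY sa hY hY') (sm_addY sb hY hY') (mulbDl mC) (mulbDr mC) addrACA.
Qed.

(** Each derivative doubles the number of terms in the Leibniz rule. *)
Lemma acts_mul_le n a b Ys : Sm a -> Sm b -> (size Ys <= n)%N -> units Ys ->
  normR (acts Ys (cs_mul a b)) <= 2 ^+ n * P n a * P n b.
Proof.
elim: n a b Ys => [|n IH] a b Ys sa sb.
  case: Ys => // _ _; rewrite expr0 mul1r !P0E//; exact: (normR_mul mC).
elim/last_ind: Ys => [|Ys Y _].
  move=> _ _; apply: (le_trans (normR_mul mC _ _)); rewrite -mulrA.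
  apply: (@le_trans _ _ (P n.+1 a * P n.+1 b)).
    by apply: ler_pM; rewrite ?normR_ge0//; exact: P_norm.
  rewrite ler_peMl//; first by rewrite mulr_ge0//; exact: P_ge0.
  by rewrite exprn_ege1// ler1n.
rewrite size_rcons ltnS => sY /units_rcons[[hY Y1] uY].
rewrite acts_rcons act_mul//.
have sYa := Sm_act alphaP iotaP sa hY; have sYb := Sm_act alphaP iotaP sb hY.
rewrite acts_add; [|exact: units_lies|exact: lie_diff_mul|exact: lie_diff_mul].
apply: (le_trans (normRD _ _)).
have k1 : normR (acts Ys (cs_mul (act Y a) b)) <= 2 ^+ n * P n.+1 a * P n.+1 b.
  apply: (le_trans (IH _ _ _ sYa sb sY uY)).
  apply: ler_pM.
  - by rewrite mulr_ge0 ?exprn_ge0//; exact: P_ge0.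
  - exact: P_ge0.
  - by rewrite ler_wpM2l ?exprn_ge0//; exact: (P_actu alphaP iotaP).
  - exact: P_mono.
have k2 : normR (acts Ys (cs_mul a (act Y b))) <= 2 ^+ n * P n.+1 a * P n.+1 b.
  apply: (le_trans (IH _ _ _ sa sYb sY uY)).
  apply: ler_pM.
  - by rewrite mulr_ge0 ?exprn_ge0//; exact: P_ge0.
  - exact: P_ge0.
  - by rewrite ler_wpM2l ?exprn_ge0//; exact: P_mono.
  - exact: (P_actu alphaP iotaP).
apply: (le_trans (lerD k1 k2)); rewrite exprS; lra.
Qed.

Lemma Sm_mul a b : Sm a -> Sm b -> Sm (cs_mul a b).
Proof.
move=> sa sb; apply: Sm_of_lie_diff => n; first exact: lie_diff_mul.
exists (2 ^+ n * P n a * P n b) => Ys sY uY; apply: acts_mul_le => //.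
by rewrite sY.
Qed.

Lemma P_mul n a b : Sm a -> Sm b -> P n (cs_mul a b) <= 2 ^+ n * P n a * P n b.
Proof.
by move=> sa sb; apply: P_le => [|Ys sY uY]; [exact: Sm_mul|exact: acts_mul_le].
Qed.

Lemma dq_star Y a a' : lieO Y -> dq Y a @ 0^' --> a' -> dq Y (cs_star a) @ 0^' --> cs_star a'.
Proof.
move=> hY ha.
have h : (fun t => cs_star (dq Y a t)) @ 0^' --> cs_star a' by exact: cs_star_cvg.
apply: cvg_trans h; apply: near_eq_cvg; apply: filterE => t.
have O := group_line alphaP t hY.
by rewrite /diff_quot (usm_star (theta_usm iotaP O)) -fmorphV cs_starZ conj_real cs_starB.
Qed.

Lemma acts_star Ys a : Sm a -> lies Ys -> acts Ys (cs_star a) = cs_star (acts Ys a).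
Proof.
move=> sa; elim: Ys => // Y Ys IH /lies_cons[hY hYs] /=; rewrite IH//.
by apply: act_lim; apply: dq_star => //; exact: (sm_dq sa).
Qed.

Lemma Sm_star a : Sm a -> Sm (cs_star a).
Proof.
move=> sa; split.
- move=> Ys Y hYs hY; rewrite !acts_star//; last by apply/lies_cons.
  by apply: dq_star => //; exact: (sm_dq sa).
- move=> Ys Y Y' hYs hY hY'; rewrite acts_star//.
  have e W : lieO W -> act W (cs_star (acts Ys a)) = cs_star (act W (acts Ys a)).
    by move=> hW; apply: act_lim; apply: dq_star => //; exact: (sm_dq sa).
  by rewrite (e _ (lieD alphaP hY hY')) (e _ hY) (e _ hY') -cs_starD (sm_add sa).
- move=> n; have [M hM] := sm_bnd sa n; exists M => Ys sY uY.
  by rewrite acts_star//; [rewrite normR_star; exact: hM|exact: units_lies].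
Qed.

Lemma P_star n a : Sm a -> P n (cs_star a) <= P n a.
Proof.
move=> sa; apply: P_le => [|Ys sY uY]; first exact: Sm_star.
by rewrite acts_star//; [rewrite normR_star; exact: P_ub|exact: units_lies].
Qed.

Section Equivariance.
Variables (g h : bop V).
Hypothesis Og : grpO g.
Hypothesis ag : alpha_adj alpha g h.
Hypothesis ah : alpha_adj alpha h g.
Hypothesis gh : g ** h = bop_id V.
Hypothesis hg : h ** g = bop_id V.
Let conj Y := h ** Y ** g.

Lemma conj_lie Y : lieO Y -> lieO (conj Y).
Proof. by move=> hY; apply: lie_conj. Qed.

Lemma inv_group : grpO h.
Proof. by apply/group_adj; exists g. Qed.

Lemma conj_norm Y : normR (conj Y) <= normR Y.
Proof.
apply: (le_trans (norm_groupMr _ Og)); apply: norm_groupMl; exact: inv_group.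
Qed.

Lemma conj_lies Ys : lies Ys -> lies (map conj Ys).
Proof. by move=> hY W /mapP[Y /hY h' ->]; exact: conj_lie. Qed.

Lemma conj_units Ys : units Ys -> units (map conj Ys).
Proof.
move=> hY W /mapP[Y /hY[h1 h2] ->]; split; first exact: conj_lie.
exact: le_trans (conj_norm _) h2.
Qed.

(** Y th g = th g (g^-1 Y g), applied to each derivative. *)
Lemma acts_th Ys a : Sm a -> lies Ys -> acts Ys (th g a) = th g (acts (map conj Ys) a).
Proof.
move=> sa; elim: Ys => // Y Ys IH /lies_cons[hY hYs] /=; rewrite IH//.
apply: act_lim; apply: (dq_equiv alphaP iotaP Og hg gh hY (conj_lie hY)).
by apply: (sm_dq sa); [exact: conj_lies|exact: conj_lie].
Qed.

Lemma Sm_th a : Sm a -> Sm (th g a).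
Proof.
move=> sa; split.
- move=> Ys Y hYs hY; rewrite !acts_th//; last by apply/lies_cons.
  apply: (dq_equiv alphaP iotaP Og hg gh hY (conj_lie hY)).
  by apply: (sm_dq sa); [exact: conj_lies|exact: conj_lie].
- move=> Ys Y Y' hYs hY hY'.
  have e W : lieO W -> act W (acts Ys (th g a)) = th g (act (conj W) (acts (map conj Ys) a)).
    move=> hW; rewrite -[LHS]/(acts (W :: Ys) (th g a)) acts_th//.
    by apply/lies_cons.
  rewrite (e _ (lieD alphaP hY hY')) (e _ hY) (e _ hY') -(thD iotaP)//; congr (th g _).
  rewrite -(sm_add sa); [|exact: conj_lies|exact: conj_lie|exact: conj_lie].
  by rewrite /conj (mulbDr mP) (mulbDl mP).
- move=> n; have [M hM] := sm_bnd sa n; exists M => Ys sY uY.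
  rewrite acts_th//; last exact: units_lies.
  by rewrite (th_norm iotaP)//; apply: hM; [rewrite size_map|exact: conj_units].
Qed.

Lemma P_th n a : Sm a -> P n (th g a) <= P n a.
Proof.
move=> sa; apply: P_le => [|Ys sY uY]; first exact: Sm_th.
rewrite acts_th//; last exact: units_lies.
by rewrite (th_norm iotaP)//; apply: P_ub => //; [rewrite size_map|exact: conj_units].
Qed.

Lemma act_th Y a : Sm a -> lieO Y -> act Y (th g a) = th g (act (h ** Y ** g) a).
Proof. by move=> sa hY; rewrite -[LHS]/(acts [:: Y] (th g a)) acts_th//; apply/lies_cons. Qed.
End Equivariance.

Lemma Smg g a : grpO g -> Sm a -> Sm (th g a).
Proof. by move=> Og; have [h [? ? ? ?]] := (group_adj alpha g).1 Og; apply: (@Sm_th g h). Qed.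
Lemma Pg g n a : grpO g -> Sm a -> P n (th g a) <= P n a.
Proof. by move=> Og; have [h [? ? ? ?]] := (group_adj alpha g).1 Og; apply: (@P_th g h). Qed.

Lemma acts_bound Ys a : Sm a -> lies Ys ->
  normR (acts Ys a) <= (\prod_(Y <- Ys) normR Y) * P (size Ys) a.
Proof.
elim/last_ind: Ys a => [|Ys Y IH] a sa; first by rewrite big_nil mul1r P0E.
move=> /lies_rcons[hY hYs]; rewrite acts_rcons size_rcons -cats1 big_cat big_seq1.
apply: (le_trans (IH _ (Sm_act alphaP iotaP sa hY) hYs)); rewrite -mulrA.
apply: ler_wpM2l; last exact: (P_act alphaP iotaP).
by apply: prodr_ge0 => W _; exact: normR_ge0.
Qed.

(** The iterated derivatives of x t are Cauchy, and their limits are the iterated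
    derivatives of the limit of x t by [act_closed]; additivity and bounds pass to the
    limit. *)
Lemma Sm_limit (T : Type) (F : set_system T) (FF : ProperFilter F) (x : T -> C) :
  (forall t, Sm (x t)) ->
  (forall n (e : R), 0 < e -> exists2 A, F A & forall s t, A s -> A t -> P n (x s - x t) < e) ->
  exists2 x0, Sm x0 & forall n (e : R), 0 < e -> \forall t \near F, P n (x t - x0) < e.
Proof.
move=> sx cx.
have cvgL Ys : lies Ys -> exists L : C, (fun t => acts Ys (x t)) @ F --> L.
  move=> hYs; apply/cvg_ex; apply: cauchy_cvg.
  apply/cauchy_ballP => -[e e']; rewrite ltcE /= => /andP[/eqP -> e0].
  pose K := \prod_(Y <- Ys) normR Y.
  have K0 : 0 <= K by apply: prodr_ge0 => W _; exact: normR_ge0.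
  have K1 : 0 < K + 1 by rewrite ltr_wpDl.
  have [A FA hA] := cx (size Ys) _ (divr_gt0 e0 K1).
  pose B := [set acts Ys (x t) | t in A].
  have FB : F (fun t => B (acts Ys (x t))) by apply: filterS FA => t At; exists t.
  exists (B, B) => // -[_ _] [/= [s As <-] [t At <-]].
  rewrite -ball_normE /= normRE ltcR.
  have -> : acts Ys (x s) - acts Ys (x t) = acts Ys (x s - x t).
    by rewrite -scaleN1r addrC -(acts_lin alphaP iotaP)// scaleN1r addrC.
  apply: (le_lt_trans (acts_bound (SmB alphaP iotaP (sx s) (sx t)) hYs)).
  apply: (@le_lt_trans _ _ ((K + 1) * P (size Ys) (x s - x t))).
    apply: ler_wpM2r; last by rewrite lerDl.
    by apply: P_ge0; exact: (SmB alphaP iotaP).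
  by rewrite mulrC -ltr_pdivlMr//; exact: hA.
pose L Ys := lim ((fun t => acts Ys (x t)) @ F).
have LP Ys : lies Ys -> (fun t => acts Ys (x t)) @ F --> L Ys.
  by move=> hYs; have [l hl] := cvgL Ys hYs; exact: (cvgP _ hl).
have L_dq Ys Y : lies Ys -> lieO Y -> dq Y (L Ys) @ 0^' --> L (Y :: Ys).
  move=> hYs hY.
  have hc : lies (Y :: Ys) by apply/lies_cons.
  apply: (act_closed alphaP iotaP FF hY _ _ (LP _ hYs) (LP _ hc)).
    by apply: filterE => t; exact: (sm_dq (sx t)).
  apply: filterE => t; exists (acts [:: Y, Y & Ys] (x t)).
  exact: (sm_dq (sx t)).
pose x0 := L [::].
have aL Ys : lies Ys -> acts Ys x0 = L Ys.
  elim: Ys => // Y Ys IH /lies_cons[hY hYs] /=; rewrite IH//.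
  by apply: act_lim; exact: L_dq.
have sx0 : Sm x0.
  split.
  - by move=> Ys Y hYs hY; rewrite !aL//; [exact: L_dq|apply/lies_cons].
  - move=> Ys Y Y' hYs hY hY'; rewrite aL//.
    have e W : lieO W -> act W (L Ys) = L (W :: Ys) by move=> hW; apply: act_lim; exact: L_dq.
    rewrite (e _ (lieD alphaP hY hY')) (e _ hY) (e _ hY').
    have c0 W : lieO W -> (fun t => acts (W :: Ys) (x t)) @ F --> L (W :: Ys).
      by move=> hW; apply: LP; apply/lies_cons.
    have c1 := c0 _ (lieD alphaP hY hY').
    have c2 : (fun t => acts (Y :: Ys) (x t) + acts (Y' :: Ys) (x t)) @ F -->
      L (Y :: Ys) + L (Y' :: Ys).
      by apply: cvgD; exact: c0.
    apply: (cvg_unique (@norm_hausdorff _ _) c1).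
    apply: cvg_trans c2; apply: near_eq_cvg; apply: filterE => t /=.
    by rewrite (sm_add (sx t)).
  - move=> n; have [A FA hA] := cx n 1 ltr01; have [t At] := filter_ex FA.
    exists (1 + P n (x t)) => Ys sY uY; have hYs := units_lies uY; rewrite aL//.
    apply: (normR_lim_le _ (LP _ hYs)); apply: filterS FA => s As.
    rewrite -(subrK (x t) (x s)) -[x s - x t]scale1r (acts_lin alphaP iotaP)//;
      last exact: (SmB alphaP iotaP).
    rewrite scale1r (le_trans (normRD _ _))// lerD//.
      apply: le_trans (ltW (hA _ _ As At)); apply: P_ub => //; first exact: (SmB alphaP iotaP).
      by rewrite sY.
    by apply: P_ub => //; rewrite sY.
exists x0 => // n e e0.
have e2 : 0 < e / 2 by exact: divr_gt0.
have [A FA hA] := cx n _ e2.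
apply: filterS (FA) => t At.
apply: (@le_lt_trans _ _ (e / 2)); last by rewrite ltr_pdivrMr// ltr_pMr// ltr1n.
apply: P_le => [|Ys sY uY]; first exact: (SmB alphaP iotaP).
have hYs := units_lies uY.
have eB u v : Sm u -> Sm v -> acts Ys (u - v) = acts Ys u - acts Ys v.
  by move=> su sv; rewrite addrC -scaleN1r (acts_lin alphaP iotaP)// scaleN1r addrC.
rewrite eB// aL//.
have k : (fun s => acts Ys (x t) - acts Ys (x s)) @ F --> acts Ys (x t) - L Ys.
  by apply: cvgB; [exact: cvg_cst|exact: LP].
apply: (normR_lim_le _ k); apply: filterS FA => s As.
rewrite -eB//; apply: le_trans (ltW (hA _ _ At As)).
by apply: P_ub => //; exact: (SmB alphaP iotaP).
Qed.

End SmoothCalculus.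

(** * Orbit maps in the seminorms *)

Section RealBounds.
Context {R : realType}.
Implicit Types C y z h B D K p q : R.

Lemma conj_bound1 C y z h : 0 <= z -> h <= (1 + C) * y -> z * h + h * z <= 2 * (1 + C) * y * z.
Proof. by move=> z0 /(ler_wpM2r z0) k; lra. Qed.

Lemma conj_bound2 C y z h' B D : 0 <= C -> 0 <= y -> 0 <= z -> 0 <= h' -> 0 <= B ->
  h' <= (1 + C) * y -> B <= 2 * (1 + C) * y * z -> D <= C * y * y ->
  h' * B + (z * D + D * z) <= (2 * (1 + C) ^+ 2 + 2 * C) * y ^+ 2 * z.
Proof.
move=> C0 y0 z0 h0 B0 k1 k2 /(ler_wpM2r z0) k3.
have k4 := ler_pM h0 B0 k1 k2.
rewrite !expr2; nra.
Qed.
Lemma mul_dbl y z : z * y + y * z = 2 * z * y.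
Proof. ring. Qed.
End RealBounds.

(** The rearrangement used for the derivative of the second order remainder: p - q is
    the commutator term. *)
Lemma telescope (M : zmodType) (ec ez eb z p q : M) :
  ec - z - p = (ec - ez - eb) + (eb - (p - q)) + (ez - z - q).
Proof.
rewrite opprB [_ - eb + _]addrA subrK [RHS]addrAC -[ez - z - q]addrA subrKA.
by rewrite addrA -[X in _ = X - p]addrA subrK.
Qed.

Section Estimates.
Context {R : realType} {V : hilbertSpace R} (alpha : V -> V).
Hypothesis alphaP : real_structure alpha.
Context {C : unitalCstarAlgebra R} (iota : V -> C).
Hypothesis iotaP : clifford_algebra alpha iota.
Local Notation lieO := (orthogonal_lie_algebra alpha).
Local Notation grpO := (orthogonal_group alpha).
Local Notation "x ** y" := (bop_comp x y) (at level 40, left associativity).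
Local Notation one := (bop_id V).
Local Notation th := (bogoliubov iota).
Local Notation act := (lie_action iota).
Local Notation acts := (lie_actions iota).
Local Notation dq := (diff_quot iota).
Local Notation Sm := (lie_smooth alpha iota).
Local Notation P := (lie_norm alpha iota).
Implicit Types (X Y Z W : bop V) (a b c : C) (Ys : seq (bop V)).

Let mP := @bop_comp_bounded R V.
Let mA := @bop_compA R V.
Let m1 := @bop_comp1 R V.
Let mr1 := @bop_compr1 R V.
Let K0 := @expC R.

Definition commutator Z Y : bop V := Z ** Y - Y ** Z.

Lemma commutator_lie Z Y : lieO Z -> lieO Y -> lieO (commutator Z Y).
Proof.
move=> hZ hY; apply/lie_adj; rewrite /commutator opprB.
have e (A B : bop V) : A ** B = (- A) ** (- B) by rewrite (mulbNl mP) (mulbNr mP) opprK.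
have a Z' Y' : lieO Z' -> lieO Y' -> alpha_adj alpha (Z' ** Y') (Y' ** Z').
  by move=> hZ' hY'; rewrite (e Y' Z'); exact: alpha_adjM.
by apply: alpha_adjD => //; [exact: a|apply: adjN => //; exact: a].
Qed.

Lemma commutator_norm Z Y : normR (commutator Z Y) <= 2 * normR Z * normR Y.
Proof.
apply: (le_trans (normRB _ _)); apply: (le_trans (lerD (normM _ _) (normM _ _))).
by rewrite mul_dbl.
Qed.

(** The adjoint action of exp (- Y) on Z. *)
Definition conj_exp Y Z := bop_exp (- Y) ** Z ** bop_exp Y.

Lemma conj_exp_lie Y Z : lieO Y -> lieO Z -> lieO (conj_exp Y Z).
Proof.
move=> hY hZ; have aY := exp_adj alphaP hY; apply: lie_conj => //.
by apply: exp_adj => //; have := lieN alphaP hY; rewrite lie_adj opprK.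
Qed.

Lemma conj_exp_sub Y Z : conj_exp Y Z - Z =
  bop_exp (- Y) ** (Z ** (bop_exp Y - one) - (bop_exp Y - one) ** Z).
Proof.
rewrite (mulbBr mP Z) (mulbBl mP _ _ Z) m1 mr1 opprB.
rewrite [Z - _]addrC addrACA addNr addr0.
by rewrite (mulbDr mP) (mulbNr mP) !mA expNl m1.
Qed.

Lemma conj_exp_near1 Y Z : lieO Y -> normR Y <= 1 ->
  normR (conj_exp Y Z - Z) <= 2 * (1 + K0) * normR Y * normR Z.
Proof.
move=> hY Y1; rewrite conj_exp_sub.
apply: (le_trans (norm_groupMl _ (group_exp alphaP (lieN alphaP hY)))).
apply: (le_trans (normRB _ _)); apply: (le_trans (lerD (normM _ _) (normM _ _))).
by apply: conj_bound1; [exact: normR_ge0|exact: exp_near1].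
Qed.

(** The first order term in Y of the adjoint action is the commutator. *)
Lemma conj_exp_near2 Y Z : lieO Y -> normR Y <= 1 ->
  normR (conj_exp Y Z - Z - commutator Z Y) <= (2 * (1 + K0) ^+ 2 + 2 * K0) * normR Y ^+
    2 * normR Z.
Proof.
move=> hY Y1; rewrite conj_exp_sub.
set B := Z ** _ - _; pose D := bop_exp Y - one - Y.
have -> : bop_exp (- Y) ** B - commutator Z Y = (bop_exp (- Y) - one) ** B + (Z ** D - D ** Z).
  have -> : Z ** D - D ** Z = B - commutator Z Y.
    rewrite /D /B /commutator; set E := bop_exp Y - one.
    rewrite (mulbBr mP) (mulbBl mP) !opprB -!addrA; congr (_ + _).
    by rewrite addrCA [RHS]addrCA; congr (_ + _); exact: addrC.
  by rewrite (mulbBl mP) m1 subrKA.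
have YN : normR (- Y) <= 1 by rewrite normRN.
have hB : normR B <= 2 * (1 + K0) * normR Y * normR Z.
  apply: (le_trans (normRB _ _)); apply: (le_trans (lerD (normM _ _) (normM _ _))).
  by apply: conj_bound1; [exact: normR_ge0|exact: exp_near1].
apply: (le_trans (normRD _ _)).
apply: (le_trans (lerD (normM _ _) (normRB _ _))).
apply: (le_trans (lerD (lexx _) (lerD (normM _ _) (normM _ _)))).
have hD : normR D <= K0 * normR Y * normR Y by exact: exp_taylor1.
have hE : normR (bop_exp (- Y) - one) <= (1 + K0) * normR Y.
  by have := exp_near1 YN; rewrite normRN.
have C0 : 0 <= K0 := @expC_ge0 R.
exact: (@conj_bound2 R K0 (normR Y) (normR Z) (normR (bop_exp (- Y) - one)) (normR B) (normR D) C0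
  (normR_ge0 _) (normR_ge0 _) (normR_ge0 _) (normR_ge0 _) hE hB hD).
Qed.

(** Moving a derivative through th (exp Y) conjugates its direction. *)
Lemma th_expE Y Z a : Sm a -> lieO Y -> lieO Z ->
  act Z (th (bop_exp Y) a) = th (bop_exp Y) (act (conj_exp Y Z) a).
Proof.
move=> sa hY hZ; apply: (act_th alphaP iotaP) => //.
- exact: group_exp.
- exact: exp_adj.
- by apply: exp_adj => //; have := lieN alphaP hY; rewrite lie_adj opprK.
- exact: expNr.
- exact: expNl.
Qed.

Lemma act_norm a Y : Sm a -> lieO Y -> normR (act Y a) <= normR Y * P 1 a.
Proof.
move=> sa hY; apply: le_trans (P_act alphaP iotaP 0 sa hY).
by apply: P_norm; exact: (Sm_act alphaP iotaP).
Qed.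

(** Apply the closed operator Z to the difference quotients of a in direction Y. By
    [th_expE], Z (th (exp (tY)) a - a) / t is the difference quotient of Za in direction
    Y plus th (exp (tY)) applied to the derivative of a in direction (exp (- tY) Z exp
    (tY) - Z) / t, which tends to the commutator. *)
Lemma act_commutator a Y Z : Sm a -> lieO Y -> lieO Z ->
  act (commutator Z Y) a = act Z (act Y a) - act Y (act Z a).
Proof.
move=> sa hY hZ.
have sYa := Sm_act alphaP iotaP sa hY; have sZa := Sm_act alphaP iotaP sa hZ.
have hB := commutator_lie hZ hY; have sBa := Sm_act alphaP iotaP sa hB.
pose E (t : R) := bop_exp (t%:C *: Y).
have OE t : grpO (E t) by exact: group_line.
pose x (t : R) := dq Y a t.
pose y (t : R) := act Z (dq Y a t).
have sth t b : Sm b -> Sm (th (E t) b) by move=> sb; exact: (Smg alphaP iotaP).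
have sx t : Sm (x t) by apply: SmZ => //; apply: SmB => //; exact: sth.
have yE t : y t = th (E t) ((t%:C)^-1 *: act (conj_exp (t%:C *: Y) Z - Z) a) + dq Y (act Z a) t.
  have hc : lieO (conj_exp (t%:C *: Y) Z) by apply: conj_exp_lie => //; exact: lieZ.
  rewrite /y /diff_quot -/(E t) (act_Z alphaP iotaP)//; last by apply: SmB => //; exact: sth.
  rewrite (act_B alphaP iotaP)//; last exact: sth.
  rewrite /E th_expE//; last exact: lieZ.
  rewrite (thZ iotaP)//; last exact: group_line.
  rewrite -scalerDr; congr (_ *: _).
  rewrite (sm_subY alphaP iotaP)// (thB iotaP)//; last exact: group_line.
  by rewrite subrKA.
have q0 : (fun t : R => (t%:C)^-1 *: (conj_exp (t%:C *: Y) Z - Z)) @ 0^' --> commutator Z Y.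
  pose M := (2 * (1 + K0) ^+ 2 + 2 * K0) * normR Y ^+ 2 * normR Z.
  apply/cvg_normRP => e e0; apply/near0P.
  have M0 : 0 <= M.
    apply: mulr_ge0; last exact: normR_ge0.
    apply: mulr_ge0; last by apply: exprn_ge0; exact: normR_ge0.
    have := @expC_ge0 R => k; rewrite addr_ge0 ?mulr_ge0 ?exprn_ge0 ?addr_ge0//.
  have d1 : 0 < (normR Y + 1)^-1 by rewrite invr_gt0 ltr_wpDl ?normR_ge0.
  have d2 : 0 < e / (M + 1) by rewrite divr_gt0// ltr_wpDl.
  exists (Num.min (normR Y + 1)^-1 (e / (M + 1))); first by rewrite lt_min d1 d2.
  move=> t; rewrite lt_min => /andP[td1 td2] t0.
  have tC : t%:C != 0 :> R[i] by rewrite realC_eq0.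
  have -> : (t%:C)^-1 *: (conj_exp (t%:C *: Y) Z - Z) - commutator Z Y =
      (t^-1)%:C *: (conj_exp (t%:C *: Y) Z - Z - commutator Z (t%:C *: Y)).
    rewrite [in RHS]scalerBr fmorphV; congr (_ - _).
    by rewrite /commutator (mulbZr mP) (mulbZl mP) -scalerBr scalerA mulVf// scale1r.
  have n1 : normR (t%:C *: Y) <= 1.
    rewrite normRZr; apply: (@le_trans _ _ (`|t| * (normR Y + 1))).
      by rewrite ler_wpM2l// lerDl.
    by rewrite -ler_pdivlMr ?ltr_wpDl ?normR_ge0// div1r ltW.
  rewrite normRZr normfV ltr_pdivrMl ?normr_gt0//.
  apply: (le_lt_trans (conj_exp_near2 Z (lieZ alphaP t hY) n1)).
  rewrite normRZr exprMn.
  have -> : (2 * (1 + K0) ^+ 2 + 2 * K0) * (`|t| ^+ 2 * normR Y ^+ 2) * normR Z = `|t| * (M * `|t|).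
    by rewrite /M; ring.
  rewrite ltr_pM2l ?normr_gt0//.
  apply: (@le_lt_trans _ _ ((M + 1) * `|t|)); first by rewrite ler_wpM2r// lerDl.
  by rewrite mulrC -ltr_pdivlMr// ltr_wpDl.
have yc : y @ 0^' --> act (commutator Z Y) a + act Y (act Z a).
  rewrite (_ : y = fun t => th (E t) ((t%:C)^-1 *: act (conj_exp (t%:C *: Y) Z - Z) a)
    + dq Y (act Z a) t); last exact/funext.
  apply: cvgD; last exact: (sm_dq1 sZa).
  have c1 : (fun t => th (E t) (act (commutator Z Y) a)) @ 0^' --> act (commutator Z Y) a.
    exact: (orbit_cont alphaP iotaP hY (sm_dq1 sBa hY)).
  apply/cvg_normRP => e e0.
  have e2 : 0 < e / 2 by exact: divr_gt0.
  have P1 : 0 < P 1 a + 1 by rewrite ltr_wpDl//; exact: P_ge0.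
  have /cvg_normRP/(_ _ e2) k1 := c1.
  have /cvg_normRP/(_ _ (divr_gt0 e2 P1)) k2 := q0.
  apply: filterS2 k1 k2 => t h1 h2.
  have hc : lieO (conj_exp (t%:C *: Y) Z - Z) by apply: lieB => //; apply: conj_exp_lie => //;
    exact: lieZ.
  apply: (le_lt_trans (normR_dist3 _ (th (E t) (act (commutator Z Y) a)) _)).
  rewrite (_ : e = e / 2 + e / 2); last by field.
  apply: ltrD => //; rewrite -(thB iotaP)// (th_norm iotaP)//.
  have hs : lieO ((t%:C)^-1 *: (conj_exp (t%:C *: Y) Z - Z)) by rewrite -fmorphV; exact: lieZ.
  rewrite -fmorphV -(sm_scaleY iotaP)// fmorphV -(sm_subY alphaP iotaP)//.
  apply: (le_lt_trans (act_norm sa (lieB alphaP hs hB))).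
  apply: (@le_lt_trans _ _ (normR ((t%:C)^-1 *: (conj_exp (t%:C *: Y) Z - Z) - commutator Z Y) *
    (P 1 a + 1))).
    by apply: ler_wpM2l; [exact: normR_ge0|rewrite lerDl].
  by rewrite -ltr_pdivlMr.
have n1 : \forall t \near (0 : R)^', dq Z (x t) @ 0^' --> y t.
  by apply: filterE => t; exact: (sm_dq1 (sx t)).
have n2 : \forall t \near (0 : R)^', exists w : C, dq Z (y t) @ 0^' --> w.
  apply: filterE => t; exists (act Z (y t)).
  exact: (sm_dq1 (Sm_act alphaP iotaP (sx t) hZ) hZ).
by have /act_lim -> := act_closed alphaP iotaP (Proper_dnbhs_numFieldType _) hZ n1 n2
  (sm_dq1 sa hY) yc; rewrite addrK.
Qed.

(** By induction on n. Order 0 is [orbit_lip]. A further derivative Z of th (exp Y) a -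
    a is, by [th_expE], the orbit increment of Za plus a derivative of a in the
    direction conj_exp Y Z - Z, which has norm O(|Y|). *)
Lemma P_lip n : exists2 K : R, 0 <= K & forall Y a, Sm a -> lieO Y -> normR Y <= 1 ->
  P n (th (bop_exp Y) a - a) <= K * normR Y * P n.+1 a.
Proof.
have C0 := @expC_ge0 R.
elim: n => [|n [K K_0 IH]].
  exists 1 => // Y a sa hY Y1; have Oe := group_exp alphaP hY.
  rewrite P0E; last by apply: SmB => //; exact: (Smg alphaP iotaP).
  rewrite mul1r; apply: le_trans (act_norm sa hY).
  exact: (orbit_lip alphaP iotaP hY (sm_dq1 sa hY)).
exists (2 * (1 + K0) + K + 1); first by rewrite !addr_ge0// mulr_ge0// addr_ge0.
move=> Y a sa hY Y1; have Oe := group_exp alphaP hY.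
have sta : Sm (th (bop_exp Y) a) by exact: (Smg alphaP iotaP).
have P2 := P_ge0 n.+2 sa.
apply: P_S_le => //; first exact: SmB.
- apply: (le_trans (orbit_lip alphaP iotaP hY (sm_dq1 sa hY))).
  apply: (le_trans (act_norm sa hY)).
  apply: (@le_trans _ _ (normR Y * P n.+2 a)).
    by apply: ler_wpM2l; [exact: normR_ge0|exact: P_mono].
  rewrite -mulrA ler_peMl//; first by rewrite mulr_ge0// normR_ge0.
  by rewrite lerDr addr_ge0// mulr_ge0// addr_ge0.
- move=> Z hZ Z1; have hc := conj_exp_lie hY hZ.
  have sZa := Sm_act alphaP iotaP sa hZ.
  rewrite (act_B alphaP iotaP)// th_expE//.
  have hd : lieO (conj_exp Y Z - Z) by exact: lieB.
  have -> : th (bop_exp Y) (act (conj_exp Y Z) a) - act Z a =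
      th (bop_exp Y) (act (conj_exp Y Z - Z) a) + (th (bop_exp Y) (act Z a) - act Z a).
    by rewrite (sm_subY alphaP iotaP)// (thB iotaP)// subrKA.
  have s1 := Sm_act alphaP iotaP sa hd.
  have s2 : Sm (th (bop_exp Y) (act Z a)) by exact: (Smg alphaP iotaP).
  apply: (le_trans (PD alphaP iotaP _ (Smg alphaP iotaP Oe s1) (SmB alphaP iotaP s2 sZa))).
  have k1 : P n (th (bop_exp Y) (act (conj_exp Y Z - Z) a)) <= 2 * (1 + K0) * normR Y * P n.+2 a.
    apply: (le_trans (Pg alphaP iotaP n Oe s1)); apply: (le_trans (P_act alphaP iotaP n sa hd)).
    apply: ler_pM; [exact: normR_ge0|exact: P_ge0| |exact: P_mono].
    apply: (le_trans (conj_exp_near1 Z hY Y1)); apply: ler_piMr => //.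
    by apply: mulr_ge0; [rewrite mulr_ge0// addr_ge0|exact: normR_ge0].
  have k2 : P n (th (bop_exp Y) (act Z a) - act Z a) <= K * normR Y * P n.+2 a.
    apply: (le_trans (IH Y _ sZa hY Y1)); apply: ler_wpM2l; first by rewrite mulr_ge0// normR_ge0.
    exact: (P_actu alphaP iotaP).
  apply: (le_trans (lerD k1 k2)); rewrite -mulrDl -mulrDl.
  apply: ler_wpM2r => //; apply: ler_wpM2r; first exact: normR_ge0.
  by rewrite lerDl.
Qed.

(** As for [P_lip], starting from [orbit_taylor]. A further derivative Z involves
    conj_exp Y Z - Z up to second order in Y; the commutator terms cancel by
    [act_commutator] up to an orbit increment, which is O(|Y|) by [P_lip]. *)
Lemma P_taylor n : exists2 K : R, 0 <= K & forall Y a, Sm a -> lieO Y -> normR Y <= 1 ->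
  P n (th (bop_exp Y) a - a - act Y a) <= K * normR Y ^+ 2 * P n.+2 a.
Proof.
have C0 := @expC_ge0 R.
elim: n => [|n [K K_0 IH]].
  exists 1 => // Y a sa hY Y1; have Oe := group_exp alphaP hY.
  have sYa := Sm_act alphaP iotaP sa hY.
  have sta : Sm (th (bop_exp Y) a) by exact: (Smg alphaP iotaP).
  rewrite P0E; last by apply: SmB => //; exact: SmB.
  apply: (le_trans (orbit_taylor alphaP iotaP hY (sm_dq1 sa hY) (sm_dq1 sYa hY))).
  rewrite mul1r expr2 -mulrA; apply: (le_trans (act_norm sYa hY)).
  apply: ler_wpM2l; first exact: normR_ge0.
  exact: (P_act alphaP iotaP).
have [L L0 HL] := P_lip n.
pose K2 := 2 * (1 + K0) ^+ 2 + 2 * K0.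
have K20 : 0 <= K2 by rewrite addr_ge0// mulr_ge0// exprn_ge0// addr_ge0.
exists (K2 + 2 * L + K + 1); first by apply: addr_ge0 => //; apply: addr_ge0 => //;
  apply: addr_ge0 => //; apply: mulr_ge0.
move=> Y a sa hY Y1; have Oe := group_exp alphaP hY.
have sYa := Sm_act alphaP iotaP sa hY.
have sta : Sm (th (bop_exp Y) a) by exact: (Smg alphaP iotaP).
have P3 := P_ge0 n.+3 sa.
have YY : 0 <= normR Y ^+ 2 by apply: exprn_ge0; exact: normR_ge0.
apply: P_S_le => //; first by apply: SmB => //; exact: SmB.
- apply: (le_trans (orbit_taylor alphaP iotaP hY (sm_dq1 sa hY) (sm_dq1 sYa hY))).
  apply: (le_trans (act_norm sYa hY)).
  apply: (@le_trans _ _ (normR Y ^+ 2 * P n.+3 a)).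
    rewrite expr2 -mulrA; apply: ler_wpM2l; first exact: normR_ge0.
    apply: (le_trans (P_act alphaP iotaP 1 sa hY)).
    by apply: ler_wpM2l; [exact: normR_ge0|exact: P_mono].
  rewrite -mulrA ler_peMl//; first exact: mulr_ge0.
  rewrite lerDr; apply: addr_ge0 => //; apply: addr_ge0 => //; exact: mulr_ge0.
- move=> Z hZ Z1; have hc := conj_exp_lie hY hZ.
  have sZa := Sm_act alphaP iotaP sa hZ.
  have hb := commutator_lie hZ hY; have sb := Sm_act alphaP iotaP sa hb.
  have hd : lieO (conj_exp Y Z - Z) by exact: lieB.
  have hd2 : lieO (conj_exp Y Z - Z - commutator Z Y) by exact: lieB.
  have s1 := Sm_act alphaP iotaP sa hd2.
  have stZ : Sm (th (bop_exp Y) (act Z a)) by exact: (Smg alphaP iotaP).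
  have stb : Sm (th (bop_exp Y) (act (commutator Z Y) a)) by exact: (Smg alphaP iotaP).
  have sYZ := Sm_act alphaP iotaP sZa hY.
  rewrite (act_B alphaP iotaP)//; last exact: SmB.
  rewrite (act_B alphaP iotaP)// th_expE//.
  have -> : th (bop_exp Y) (act (conj_exp Y Z) a) - act Z a - act Z (act Y a) =
      th (bop_exp Y) (act (conj_exp Y Z - Z - commutator Z Y) a)
      + (th (bop_exp Y) (act (commutator Z Y) a) - act (commutator Z Y) a)
      + (th (bop_exp Y) (act Z a) - act Z a - act Y (act Z a)).
    rewrite (sm_subY alphaP iotaP sa hd hb) (sm_subY alphaP iotaP sa hc hZ).
    rewrite !(thB iotaP)//; [|exact: SmB..]; rewrite act_commutator//; exact: telescope.
  have q1 := Smg alphaP iotaP Oe s1.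
  have q2 := SmB alphaP iotaP stb sb.
  have q3 := SmB alphaP iotaP (SmB alphaP iotaP stZ sZa) sYZ.
  apply: (le_trans (PD alphaP iotaP n (SmD alphaP iotaP q1 q2) q3)).
  have k1 : P n (th (bop_exp Y) (act (conj_exp Y Z - Z - commutator Z Y) a))
    <= K2 * normR Y ^+ 2 * P n.+3 a.
    apply: (le_trans (Pg alphaP iotaP n Oe s1)); apply: (le_trans (P_act alphaP iotaP n sa hd2)).
    apply: ler_pM; [exact: normR_ge0|exact: P_ge0| |exact: (P_mono sa (leqW (leqnSn _)))].
    exact: (le_trans (conj_exp_near2 Z hY Y1) (ler_piMr (mulr_ge0 K20 YY) Z1)).
  have k2 : P n (th (bop_exp Y) (act (commutator Z Y) a) - act (commutator Z Y) a)
    <= 2 * L * normR Y ^+ 2 * P n.+3 a.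
    apply: (le_trans (HL Y _ sb hY Y1)).
    apply: (@le_trans _ _ (L * normR Y * (2 * normR Y * P n.+3 a))).
      apply: ler_wpM2l; first by rewrite mulr_ge0// normR_ge0.
      apply: (le_trans (P_act alphaP iotaP n.+1 sa hb)).
      apply: ler_pM; [exact: normR_ge0|exact: P_ge0| |exact: P_mono].
      apply: (le_trans (commutator_norm Z Y)); apply: ler_wpM2r; first exact: normR_ge0.
      exact: ler_piMr.
    by rewrite expr2 le_eqVlt; apply/orP; left; apply/eqP; ring.
  have k3 : P n (th (bop_exp Y) (act Z a) - act Z a - act Y (act Z a))
    <= K * normR Y ^+ 2 * P n.+3 a.
    apply: (le_trans (IH Y _ sZa hY Y1)); apply: ler_wpM2l; first exact: mulr_ge0.
    exact: (P_actu alphaP iotaP).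
  apply: (le_trans (lerD (PD alphaP iotaP n q1 q2) k3)).
  apply: (le_trans (lerD (lerD k1 k2) (lexx _))); rewrite -!mulrDl.
  by apply: ler_wpM2r => //; apply: ler_wpM2r => //; rewrite lerDl.
Qed.

End Estimates.

Section RealBounds.
Context {R : realType}.
Lemma curve_bound (n q wn K P2 k Q e Wn : R) : 0 <= K -> 0 <= P2 -> 0 <= Q -> 0 <= wn ->
  0 <= Wn -> 0 < e ->
  n <= K * (wn * q) * P2 -> 0 <= q -> q <= Wn + 1 ->
  wn < e / 2 / (K * (Wn + 1) * P2 + 1) -> k < e / 2 / (Q + 1) -> n + k * Q < e.
Proof.
move=> K0 P0 Q0 w0 W0 e0 hn q0 hq hw hk.
have M0 : 0 <= K * (Wn + 1) * P2 by rewrite !mulr_ge0// addr_ge0.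
have hn2 : n <= (K * (Wn + 1) * P2) * wn.
  apply: (le_trans hn); rewrite [X in _ <= X](_ : _ = K * (wn * (Wn + 1)) * P2); last ring.
  by apply: ler_wpM2r => //; apply: ler_wpM2l => //; apply: ler_wpM2l.
move: hw; rewrite ltr_pdivlMr ?ltr_wpDl// => hw.
move: hk; rewrite ltr_pdivlMr ?ltr_wpDl// => hk.
have hQ : k * Q < e / 2.
  have [k0|k0] := leP 0 k; first by apply: le_lt_trans hk; apply: ler_wpM2l => //; rewrite lerDl.
  by apply: (@le_lt_trans _ _ 0); [rewrite mulr_le0_ge0// ltW|rewrite divr_gt0].
have hN : n < e / 2.
  by apply: (le_lt_trans hn2); apply: le_lt_trans hw;
    rewrite [X in _ <= X]mulrDr mulr1 [X in X <= _]mulrC lerDl.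
by rewrite [X in _ < X](_ : e = e / 2 + e / 2); [exact: ltrD|field].
Qed.
End RealBounds.

Section Curves.
Context {R : realType} {V : hilbertSpace R} (alpha : V -> V).
Hypothesis alphaP : real_structure alpha.
Context {C : unitalCstarAlgebra R} (iota : V -> C).
Hypothesis iotaP : clifford_algebra alpha iota.
Local Notation lieO := (orthogonal_lie_algebra alpha).
Local Notation grpO := (orthogonal_group alpha).
Local Notation "x ** y" := (bop_comp x y) (at level 40, left associativity).
Local Notation one := (bop_id V).
Local Notation th := (bogoliubov iota).
Local Notation act := (lie_action iota).
Local Notation Sm := (lie_smooth alpha iota).
Local Notation P := (lie_norm alpha iota).
Implicit Types (X Y Z W : bop V) (a b : C).

Lemma P_curve_cvg n (T : Type) (F : set_system T) (FF : Filter F) (c : T -> bop V) a e :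
  Sm a -> c @ F --> one -> (\forall t \near F, grpO (c t)) -> 0 < e ->
  \forall t \near F, P n (th (c t) a - a) < e.
Proof.
move=> sa c1 Oc e0; have [w hw] := group_curve_log alphaP FF c1 Oc.
have w0 : w @ F --> (0 : bop V).
  by apply: log_curve_cvg c1 _; apply: filterS hw => t [].
have [K K0 HK] := P_lip alphaP iotaP n.
have Q0 := P_ge0 n.+1 sa.
have d0 : 0 < e / (K * P n.+1 a + 1) by rewrite divr_gt0// ltr_wpDl// mulr_ge0.
have /cvg_normRP/(_ _ ltr01) h1 := w0.
have /cvg_normRP/(_ _ d0) h2 := w0.
apply: filterS3 hw h1 h2 => t [lw ew _]; rewrite subr0 => /ltW w1.
rewrite ltr_pdivlMr ?ltr_wpDl ?mulr_ge0// -ew => w2.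
apply: (le_lt_trans (HK _ _ sa lw w1)); apply: le_lt_trans w2.
by rewrite mulrDr mulr1 mulrAC mulrC lerDl normR_ge0.
Qed.

(** Write c t = exp (w t) with w t / t tending to W; the remainder of [P_taylor] at w t
    is o(t). *)
Lemma P_curve_deriv n (c : R -> bop V) W a e : Sm a -> lieO W -> (forall t, grpO (c t)) ->
  c @ 0^' --> one -> (fun t : R => (t%:C)^-1 *: (c t - one)) @ 0^' --> W -> 0 < e ->
  \forall t \near (0 : R)^', P n ((t%:C)^-1 *: (th (c t) a - a) - act W a) < e.
Proof.
move=> sa hW Oc c1 cW e0.
have Oc' : \forall t \near (0 : R)^', grpO (c t) by exact: filterE.
have [w hw] := group_curve_log alphaP _ c1 Oc'.
have w0 : w @ 0^' --> (0 : bop V).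
  by apply: log_curve_cvg c1 _; apply: filterS hw => t [].
have wW := log_curve_deriv c1 cW hw.
have [K K0 HK] := P_taylor alphaP iotaP n.
have P2 := P_ge0 n.+2 sa; have Q0 := P_ge0 n.+1 sa.
have W0 := normR_ge0 W.
have d1 : 0 < e / 2 / (K * (normR W + 1) * P n.+2 a + 1).
  by rewrite !divr_gt0// ltr_wpDl// !mulr_ge0// addr_ge0.
have d2 : 0 < e / 2 / (P n.+1 a + 1) by rewrite !divr_gt0// ltr_wpDl.
have nw : \forall t \near (0 : R)^', normR (w t) < Num.min 1
  (e / 2 / (K * (normR W + 1) * P n.+2 a + 1)).
  have m0 : 0 < Num.min 1 (e / 2 / (K * (normR W + 1) * P n.+2 a + 1)) by rewrite lt_min ltr01.
  by have /cvg_normRP/(_ _ m0) := w0; apply: filterS => t; rewrite subr0.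
have nq : \forall t \near (0 : R)^', normR ((t%:C)^-1 *: w t - W) < Num.min 1
  (e / 2 / (P n.+1 a + 1)).
  by move/cvg_normRP: wW; apply; rewrite lt_min ltr01.
apply: filterS3 hw nw nq => t [lw ew _]; rewrite !lt_min => /andP[w1 w2] /andP[q1 q2].
have Oe := group_exp alphaP lw.
have lq : lieO ((t%:C)^-1 *: w t) by rewrite -fmorphV; exact: lieZ.
have lqW := lieB alphaP lq hW.
have swa := Sm_act alphaP iotaP sa lw.
have s1 : Sm (th (bop_exp (w t)) a - a - act (w t) a).
  exact: (SmB alphaP iotaP (SmB alphaP iotaP (Smg alphaP iotaP Oe sa) sa) swa).
have s2 := Sm_act alphaP iotaP sa lqW.
have -> : (t%:C)^-1 *: (th (c t) a - a) - act W a =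
   (t^-1)%:C *: (th (bop_exp (w t)) a - a - act (w t) a) + act ((t%:C)^-1 *: w t - W) a.
  rewrite ew (sm_subY alphaP iotaP sa lq hW) -fmorphV (sm_scaleY iotaP)//.
  by rewrite [in RHS]scalerBr subrKA.
apply: (le_lt_trans (PD alphaP iotaP n (SmZ alphaP iotaP _ s1) s2)).
apply: (le_lt_trans (lerD (lexx _) (P_act alphaP iotaP n sa lqW))).
apply: (@curve_bound _ _ (normR ((t%:C)^-1 *: w t)) (normR (w t)) K (P n.+2 a) _ _ _
  (normR W)) => //.
- exact: normR_ge0.
- rewrite (PZ alphaP iotaP)// Re_normr_real -[(t%:C)^-1]fmorphV normRZr.
  have k := HK _ _ sa lw (ltW w1).
  apply: (le_trans (ler_wpM2l (normr_ge0 _) k)); rewrite expr2.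
  by rewrite le_eqVlt; apply/orP; left; apply/eqP; ring.
- exact: normR_ge0.
- by rewrite -[X in normR X](subrK W); apply: (le_trans (normRD _ _)); rewrite addrC lerD// ltW.
Qed.

End Curves.

(** * Smooth vectors are Lie-smooth *)

Lemma cvg_pair0 (R : realType) (E F : tvsType R[i]) (f : R -> E) (g : R -> F) (x : E) (y : F) :
  f @ (0:R)^' --> x -> g @ (0:R)^' --> y -> (fun t => (f t, g t)) @ (0:R)^' --> (x, y).
Proof. by move=> fx gy; exact: cvg_pair. Qed.

Section SmoothFamilies.
Context {R : realType} {V : hilbertSpace R} (alpha : V -> V).
Hypothesis alphaP : real_structure alpha.
Context {C : unitalCstarAlgebra R} (iota : V -> C).
Hypothesis iotaP : clifford_algebra alpha iota.
Local Notation lieO := (orthogonal_lie_algebra alpha).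
Local Notation grpO := (orthogonal_group alpha).
Local Notation "x ** y" := (bop_comp x y) (at level 40, left associativity).
Local Notation one := (bop_id V).
Local Notation th := (bogoliubov iota).
Local Notation act := (lie_action iota).
Local Notation acts := (lie_actions iota).
Local Notation dq := (diff_quot iota).
Local Notation lies := (lie_seq alpha).
Local Notation units := (lie_unit_seq alpha).
Implicit Types (X Y Z W : bop V) (a b : C) (Ys : seq (bop V)) (E : tvsType R[i]).

(** The orbits of m y are smooth jointly in the group and the parameter y. Families, not
    single vectors, can be differentiated repeatedly in directions which are themselves
    parameters. *)
Definition smooth_family E (L : set E) (m : E -> C) := exists2 r : R, 0 < r &
  smooth_map (lieO `*` L) (lie_ball alpha r `*` L) (fun p : bop V * E => th (bop_exp p.1) (m p.2)).

Let m1 := @bop_comp1 R V.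
Let C_haus : hausdorff_space C := @norm_hausdorff _ C.

Lemma th_exp0 a : th (bop_exp (0 : bop V)) a = a.
Proof. by rewrite exp0 (th1 iotaP). Qed.

Lemma family_domain E (L : set E) r : real_domain L L ->
  real_domain (lieO `*` L) (lie_ball alpha r `*` L).
Proof. by move=> dL; apply: real_domainM => //; exact: lie_domain. Qed.

Lemma lie_ball0 r : 0 < r -> lie_ball alpha r 0.
Proof. by move=> r0; split; [exact: lie0|rewrite normR0]. Qed.

Lemma family_dq E (L : set E) (m : E -> C) r df Y y : 0 < r -> L 0 ->
  deriv_on (lieO `*` L) (lie_ball alpha r `*` L) (fun p : bop V * E =>
    th (bop_exp p.1) (m p.2)) df ->
  lieO Y -> L y -> dq Y (m y) @ 0^' --> df ((0, y), (Y, 0)).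
Proof.
move=> r0 L0 d hY hy; have := d (0, y) (Y, 0) (conj (lie_ball0 r0) hy) (conj hY L0).
apply: cvg_trans; apply: near_eq_cvg; apply: filterE => t /=.
by rewrite add0r scaler0 addr0 th_exp0.
Qed.

(** Near X the orbit is that of the curve exp (- X) exp (X + tZ) through 1, moved by th
    (exp X). The logarithm of this curve turns the derivative into one along the chart
    at 0, where [strict_derivative] applies. *)
Lemma family_deriv E (L : set E) (m : E -> C) r df X Z y : 0 < r -> real_domain L L ->
  deriv_on (lieO `*` L) (lie_ball alpha r `*` L) (fun p : bop V * E =>
    th (bop_exp p.1) (m p.2)) df ->
  cont_on ((lie_ball alpha r `*` L) `*` (lieO `*` L)) df ->
  lie_ball alpha r X -> lieO Z -> L y ->
  df ((X, y), (Z, 0)) = th (bop_exp X) (act (ldexp (X, Z)) (m y)).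
Proof.
move=> r0 dL d cd hX hZ hy; have [lX _] := hX; have OX := group_exp alphaP lX.
have L0 := rd0 dL; have lU := ldexp_lie alphaP lX hZ.
have c1 := @exp_curve_cvg _ _ X Z; have cU := @exp_curve_deriv _ _ X Z.
have Oc t : grpO (exp_curve X Z t) by exact: exp_curve_group.
have [w hw] := group_curve_log alphaP _ c1 (filterE _ Oc).
have w0 : w @ 0^' --> (0 : bop V).
  by apply: log_curve_cvg c1 _; apply: filterS hw => t [].
have wU := log_curve_deriv c1 cU hw.
have tn0 : \forall t \near (0 : R)^', t != 0 by apply/near0P; exists 1.
have k : (fun t : R => (t%:C)^-1 *: (th (exp_curve X Z t) (m y) - m y)) @ 0^' -->
  act (ldexp (X, Z)) (m y).
  rewrite (act_lim (family_dq r0 L0 d lU hy)).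
  have dom := family_domain r dL.
  have n1 : \forall t \near (0 : R)^', (lieO `*` L) ((0 : bop V), y).
    by apply: filterE => _; split => //; exact: lie0.
  pose u (t : R) : bop V * E := ((t%:C)^-1 *: w t, 0).
  have n2 : \forall t \near (0 : R)^', (lieO `*` L) (u t).
    by apply: filterS hw => t [lw _ _]; split => //=; rewrite -fmorphV; exact: lieZ.
  have x0 : (fun _ : R => ((0 : bop V), y)) @ 0^' --> ((0 : bop V), y) by exact: cvg_cst.
  have u0 : u @ 0^' --> ((ldexp (X, Z) : bop V), (0 : E)) by apply: (@cvg_pair0 R (bop V) E) =>
    //; exact: cvg_cst0.
  have b0 : (lie_ball alpha r `*` L) ((0 : bop V), y) by split => //; exact: lie_ball0.
  have bU : (lieO `*` L) ((ldexp (X, Z) : bop V), (0 : E)) by split.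
  have H := strict_derivative dom d cd b0 bU n1 n2 x0 u0.
  apply: cvg_trans H.
  apply: near_eq_cvg; apply: filterS2 hw tn0 => t [lw ew _] t0 /=.
  have tC : t%:C != 0 :> R[i] by rewrite realC_eq0.
  by rewrite add0r scaler0 addr0 th_exp0 scalerA mulfV// scale1r ew.
have k2 := th_cvg iotaP _ OX k.
have h : (fun t => th (bop_exp X) ((t%:C)^-1 *: (th (exp_curve X Z t) (m y) - m y))) @ (0 : R)^'
  --> df ((X, y), (Z, 0)).
  have := d (X, y) (Z, 0) (conj hX hy) (conj hZ L0).
  apply: cvg_trans; apply: near_eq_cvg; apply: filterE => t /=.
  by rewrite (thZ iotaP)// (thB iotaP)// scaler0 addr0 exp_curveE (thM iotaP).
by apply: (cvg_unique _ h (k2 _)); exact: C_haus.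
Qed.

(** th (exp X) (Y m y) is the derivative of the family at (X, y) in the direction Z with
    ldexp (X, Z) = Y, and this Z depends smoothly on (X, Y). Additivity in Y is the
    additivity of derivatives at the origin. *)
Lemma family_step E (L : set E) (m : E -> C) : real_domain L L -> smooth_family L m ->
  [/\ forall Y y, lieO Y -> L y -> dq Y (m y) @ 0^' --> act Y (m y),
      forall Y Y' y, lieO Y -> lieO Y' -> L y -> act (Y + Y') (m y) = act Y (m y) + act Y' (m y) &
      smooth_family (lieO `*` L) (fun q => act q.1 (m q.2))].
Proof.
move=> dL [r r0 sm]; have dom := family_domain r dL.
have [df d sdf] := smooth_deriv C_haus dom sm.
have cd : cont_on ((lie_ball alpha r `*` L) `*` (lieO `*` L)) df := Cn_cont (sdf 0%N).
have L0 := rd0 dL.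
have dqE Y y : lieO Y -> L y -> dq Y (m y) @ 0^' --> df ((0, y), (Y, 0)).
  by move=> hY hy; exact: family_dq d hY hy.
have actE Y y (hY : lieO Y) (hy : L y) := act_lim (dqE Y y hY hy).
split.
- by move=> Y y hY hy; rewrite actE//; exact: dqE.
- move=> Y Y' y hY hY' hy; rewrite !actE//; last exact: lieD.
  have := deriv_on_additive C_haus dom d cd (conj (lie_ball0 r0) hy : (lie_ball alpha r `*` L)
    (0, y)) (conj hY L0 : (lieO `*` L) (Y, 0)) (conj hY' L0 : (lieO `*` L) (Y', 0)).
  by move=> <-; congr (df (_, (_, _))); rewrite addr0.
have [s s0 [Psi [PsiE PsiC]]] := ldexp_inverse alphaP.
(* Both the family and the inverse of ldexp must be defined. *)
pose q := Num.min r s; have q0 : 0 < q by rewrite lt_min r0.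
have qr X : lie_ball alpha q X -> lie_ball alpha r X.
  by move=> [lX]; rewrite lt_min => /andP[].
have qs X : lie_ball alpha q X -> lie_ball alpha s X.
  by move=> [lX]; rewrite lt_min => /andP[].
exists q => // n.
have dlT := lie_domainT alphaP; have dq := lie_domain alphaP q.
have dlL : real_domain (lieO `*` L) (lieO `*` L) by exact: real_domainM.
have dD : real_domain (lieO `*` (lieO `*` L)) (lie_ball alpha q `*` (lieO `*` L))
  by exact: real_domainM.
pose g (p : bop V * (bop V * E)) := ((p.1, p.2.2), (Psi (p.1, p.2.1), 0 : E)).
have h1 : Cn n (lieO `*` (lieO `*` L)) (lie_ball alpha q `*` (lieO `*` L))
  (fst : bop V * (bop V * E) -> _) by exact: Cn_fst.
have h2 : Cn n (lieO `*` (lieO `*` L)) (lie_ball alpha q `*` (lieO `*` L))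
  (snd : bop V * (bop V * E) -> _) by exact: Cn_snd.
have h21 : Cn n (lieO `*` (lieO `*` L)) (lie_ball alpha q `*` (lieO `*` L))
  (fun p : bop V * (bop V * E) => p.2.1).
  by apply: (@Cn_comp _ _ _ _ _ _ _ (lieO `*` L) (lieO `*` L) fst snd) => //;
    [move=> p []|exact: Cn_fst].
have h22 : Cn n (lieO `*` (lieO `*` L)) (lie_ball alpha q `*` (lieO `*` L))
  (fun p : bop V * (bop V * E) => p.2.2).
  by apply: (@Cn_comp _ _ _ _ _ _ _ (lieO `*` L) (lieO `*` L) snd snd) => //;
    [move=> p []|exact: Cn_snd].
have hPsi : Cn n (lieO `*` (lieO `*` L)) (lie_ball alpha q `*` (lieO `*` L))
  (fun p : bop V * (bop V * E) => Psi (p.1, p.2.1)).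
  apply: (@Cn_comp _ _ _ _ _ _ _ (lieO `*` lieO) (lie_ball alpha s `*` lieO) Psi
    (fun p => (p.1, p.2.1))) => //.
  - by apply: real_domainM => //; exact: lie_domain.
  - by move=> [X [Y y]] [/= hX [hY hy]]; split => //; exact: qs.
  - exact: Cn_pair.
have hg : Cn n (lieO `*` (lieO `*` L)) (lie_ball alpha q `*` (lieO `*` L)) g.
  by apply: Cn_pair; apply: Cn_pair => //; exact: Cn_cst.
have gW p : (lie_ball alpha q `*` (lieO `*` L)) p ->
  ((lie_ball alpha r `*` L) `*` (lieO `*` L)) (g p).
  case: p => X [Y y] [/= hX [hY hy]]; split; split => //=; first exact: qr.
  by have [] := PsiE X Y (qs _ hX) hY.
apply: (@Cn_ext _ _ _ _ _ _ (df \o g)) => //.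
  move=> [X [Y y]] [/= hX [hY hy]]; have [lP eP] := PsiE X Y (qs _ hX) hY.
  by rewrite /g /= (family_deriv r0 dL d cd (qr _ hX) lP hy) eP.
apply: (@Cn_comp _ _ _ _ _ _ _ ((lieO `*` L) `*` (lieO `*` L))
  ((lie_ball alpha r `*` L) `*` (lieO `*` L))) => //.
by apply: real_domainM => //; exact: (family_domain r dL).
Qed.

(** By induction on n: the innermost direction Y becomes a parameter of the family, and
    the bound is obtained near Y = 0. *)
Lemma family_bound n : forall E (L : set E) (m : E -> C) y0, real_domain L L ->
  smooth_family L m -> L y0 ->
  exists2 d : R, 0 < d & exists2 N, nbhs y0 N & exists M, forall Ys y, size Ys = n ->
    (forall Y, Y \in Ys -> lieO Y /\ normR Y < d) -> N y -> L y -> normR (acts Ys (m y)) <= M.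
Proof.
elim: n => [|n IH] E L m y0 dL fm Ly0.
  have [r r0 sm] := fm.
  have cf := Cn_cont (sm 0%N) (conj (lie_ball0 r0) Ly0 : (lie_ball alpha r `*` L)
    ((0 : bop V), y0)).
  have /cvg_normRP/(_ _ ltr01) := cf; rewrite near_withinE => -[[A B] /= [A0 By0] AB].
  exists 1 => //; exists B => //; exists (normR (m y0) + 1) => Ys y /size0nil -> _ By Ly /=.
  have := AB (0, y) (conj (nbhs_singleton A0) By) (conj (lie_ball0 r0) Ly).
  rewrite /= !th_exp0 => /ltW h; rewrite -[X in normR X](subrK (m y0)).
  by apply: (le_trans (normRD _ _)); rewrite addrC lerD.
have [_ _ fm'] := family_step dL fm.
have dL' : real_domain (lieO `*` L) (lieO `*` L) by apply: real_domainM => //; exact: lie_domainT.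
have Ly' : (lieO `*` L) ((0 : bop V), y0) by split => //; exact: lie0.
have [d1 d10 [N1 [[A B] /= [A0 By0] AB] [M HM]]] := IH _ _ _ _ dL' fm' Ly'.
have /nbhs_normRP[d2 d20 HA] := A0.
exists (Num.min d1 d2); first by rewrite lt_min d10.
exists B => //; exists M => Ys y; case/lastP: Ys => // Zs Y; rewrite size_rcons => -[sz] hYs By Ly.
have [hY] : lieO Y /\ normR Y < Num.min d1 d2 by apply: hYs; rewrite mem_rcons mem_head.
rewrite lt_min => /andP[_ Y2]; rewrite acts_rcons.
apply: (HM Zs (Y, y)) => //.
- move=> Z hZ; have [] : lieO Z /\ normR Z < Num.min d1 d2.
    by apply: hYs; rewrite mem_rcons inE hZ orbT.
  by rewrite lt_min => lZ /andP[].
- by apply: AB; split => //=; apply: HA; rewrite subr0.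
Qed.

Let fconst a := smooth_family [set: C] (fun=> a).
Let dT := @real_domainT R C.

Lemma fconst_act a Y : fconst a -> lieO Y -> fconst (act Y a).
Proof.
move=> fa hY; have [_ _ [r r0 sm]] := family_step dT fa; exists r => // n.
have dl := lie_domain alphaP r; have dl1 := lie_domainT alphaP.
have d1 : real_domain (lieO `*` [set: C]) (lie_ball alpha r `*` [set: C]) by exact: real_domainM.
apply: (@Cn_comp _ _ _ _ _ _ _ _ _ _ (fun p : bop V * C => (p.1, (Y, p.2))) _ _ _ (sm n)) => //.
- by apply: real_domainM => //; exact: real_domainM.
- by move=> [X c] [].
- by apply: Cn_pair; [exact: Cn_fst|apply: Cn_pair; [exact: Cn_cst|exact: Cn_snd]].
Qed.

Lemma fconst_acts a Ys : fconst a -> lies Ys -> fconst (acts Ys a).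
Proof.
by move=> fa; elim: Ys => //= Y Ys IH /lies_cons[hY hYs]; apply: fconst_act => //; exact: IH.
Qed.

Lemma fconst_dq a Ys Y : fconst a -> lies Ys -> lieO Y -> dq Y (acts Ys a) @ 0^' -->
  acts (Y :: Ys) a.
Proof.
move=> fa hYs hY; have [h _ _] := family_step dT (fconst_acts fa hYs).
exact: (h Y 0).
Qed.

Lemma fconst_scale a (s : R) Ys : fconst a -> lies Ys ->
  acts (map (fun Y => s%:C *: Y) Ys) a = (s ^+ size Ys)%:C *: acts Ys a.
Proof.
move=> fa; elim: Ys => [|Y Ys IH]; first by rewrite /= expr0 rmorph1 scale1r.
move=> /lies_cons[hY hYs] /=; rewrite -/(lie_actions iota _ a) IH//.
have hsY : lieO (s%:C *: Y) by exact: lieZ.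
have h := dq_scale iotaP (s := s) (fconst_dq fa hYs hY).
(* Homogeneity of derivatives from their linearity in the form k u + v. *)
have kE (k : R[i]) (c : C) : k *: c = (k - 1) *: c + c by rewrite scalerBl scale1r subrK.
rewrite exprS rmorphM mulrC -scalerA.
apply: act_lim; rewrite kE [X in _ --> X]kE.
by apply: (dq_lin alphaP iotaP).
Qed.

(** The bounds of [family_bound] hold for directions in a small ball; homogeneity
    extends them to the unit ball. *)
Lemma fconst_Sm a : fconst a -> lie_smooth alpha iota a.
Proof.
move=> fa; split; first by move=> Ys Y hYs hY; exact: fconst_dq.
  move=> Ys Y Y' hYs hY hY'; have [_ h _] := family_step dT (fconst_acts fa hYs).
  exact: (h Y Y' 0).
move=> n; have [d d0 [N N0 [M HM]]] := family_bound n dT fa (I : [set: C] 0).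
(* Scaling by d / 2 moves the unit ball into the ball of radius d. *)
pose s := d / 2; have s0 : 0 < s by exact: divr_gt0.
have sn : 0 < s ^+ n by exact: exprn_gt0.
exists ((s ^+ n)^-1 * M) => Ys sz uYs; rewrite ler_pdivlMl//.
have := HM (map (fun Y => s%:C *: Y) Ys) 0; rewrite size_map fconst_scale//; last exact: units_lies.
rewrite normRZr sz (ger0_norm (ltW sn)); apply => //; last exact: nbhs_singleton.
move=> _ /mapP[Y /uYs[lY Y1] ->]; split; first exact: lieZ.
rewrite normRZr (ger0_norm (ltW s0)); apply: (@le_lt_trans _ _ s); first exact: (ler_piMr (ltW s0)).
by rewrite /s ltr_pdivrMr// ltr_pMr// ltr1n.
Qed.

(** Smoothness of the orbit map, read in the exponential chart at the identity, makes
    the constant family of a a smooth one. *)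
Lemma smooth_vectors_Sm a : smooth_vectors alpha iota a -> lie_smooth alpha iota a.
Proof.
move=> sa; apply: fconst_Sm; have [r r0 sm] := sa one (group1 alpha).
exists r => // n; have dl := lie_domain alphaP r.
have smn : Cn n lieO (lie_ball alpha r) (fun Y => th (bop_exp Y) a).
  by apply: (Cn_ext dl) (sm n) => Y _; rewrite m1.
apply: (@Cn_comp _ _ _ _ _ _ _ _ _ _ (fst : bop V * C -> bop V) _ _ _ smn) => //.
- exact: real_domainM.
- by move=> p [].
- exact: Cn_fst.
Qed.

End SmoothFamilies.

(** * The topology of an increasing sequence of seminorms *)

Section SeminormedSpace.
Context {R : realType} (E : lmodType R[i]) (p : nat -> E -> R).

Record increasing_seminorms : Prop := IncreasingSeminorms {
  isn_seminorm : forall n, is_seminorm (p n);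
  isn_mono : forall n m x, (n <= m)%N -> p n x <= p m x }.

(** A copy of E, so that the topology of the seminorms does not conflict with one that E
    may carry. *)
Definition seminormed (pP : increasing_seminorms) : Type := E.

Hypothesis pP : increasing_seminorms.
Local Notation T := (seminormed pP).

HB.instance Definition _ := GRing.Lmodule.on T.

Lemma sn0 n : p n 0 = 0.
Proof.
by have := seminormZ (isn_seminorm pP n) 0 0; rewrite scale0r normr0 mul0r.
Qed.
Lemma snN n x : p n (- x) = p n x.
Proof. by rewrite -scaleN1r (seminormZ (isn_seminorm pP n)) normrN1 mul1r. Qed.
Lemma sn_ge0 n x : 0 <= p n x.
Proof.
have := seminormD (isn_seminorm pP n) x (- x); rewrite subrr sn0 snN.
by rewrite -mulr2n -mulr_natl pmulr_rge0.
Qed.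
Lemma sn_dist n x y z : p n (x - z) <= p n (x - y) + p n (y - z).
Proof.
apply: le_trans (seminormD (isn_seminorm pP n) _ _).
by rewrite addrA subrK.
Qed.

Definition sn_ball n (e : R) (a : T) : set T := [set b | p n (b - a) < e].
(** Balls of single seminorms form a base of neighbourhoods because the sequence is
    increasing. *)
Definition sn_nbhs (a : T) : set_system T :=
  [set U | exists n, exists2 e, 0 < e & sn_ball n e a `<=` U].

Lemma sn_nbhs_ball n e a b : p n (b - a) < e -> sn_nbhs b (sn_ball n e a).
Proof.
move=> ba; exists n; exists (e - p n (b - a)); first by rewrite subr_gt0.
by move=> c /= cb; apply: (le_lt_trans (sn_dist n c b a)); rewrite -ltrBrDr.
Qed.

Lemma sn_nbhs_filter a : ProperFilter (sn_nbhs a).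
Proof.
split.
  by move=> [n [e e0 /(_ a)]]; apply; rewrite /sn_ball /= subrr sn0.
split.
- by exists 0%N; exists 1.
- move=> U W [n [e e0 Ue]] [m [d d0 Wd]]; exists (maxn n m); exists (Num.min e d).
    by rewrite lt_min e0.
  move=> b /=; rewrite /sn_ball /= lt_min => /andP[b1 b2]; split; [apply: Ue|apply: Wd] => /=.
    by apply: le_lt_trans b1; apply: (isn_mono pP); exact: leq_maxl.
  by apply: le_lt_trans b2; apply: (isn_mono pP); exact: leq_maxr.
- by move=> U W UW [n [e e0 Ue]]; exists n; exists e => //; exact: subset_trans UW.
Qed.

Lemma sn_nbhs_singleton a U : sn_nbhs a U -> U a.
Proof. by move=> [n [e e0]]; apply; rewrite /sn_ball /= subrr sn0. Qed.

Lemma sn_nbhs_nbhs a U : sn_nbhs a U -> sn_nbhs a (sn_nbhs^~ U).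
Proof.
move=> [n [e e0 Ue]]; exists n; exists e => // b /sn_nbhs_ball[m [d d0 h]].
by exists m; exists d => //; exact: subset_trans Ue.
Qed.

HB.instance Definition _ := hasNbhs.Build T sn_nbhs.
HB.instance Definition _ :=
  Nbhs_isNbhsTopological.Build T sn_nbhs_filter sn_nbhs_singleton sn_nbhs_nbhs.

Lemma sn_nbhsP (a : T) (U : set T) :
  nbhs a U <-> exists n, exists2 e, 0 < e & forall b, p n (b - a) < e -> U b.
Proof. by []. Qed.

Lemma sn_add_continuous : continuous (fun x : T * T => x.1 + x.2).
Proof.
move=> [a b] U /= /sn_nbhsP[n [e e0 Ue]].
have e2 : 0 < e / 2 by exact: divr_gt0.
exists (sn_ball n (e / 2) a, sn_ball n (e / 2) b).
  by split; exists n; exists (e / 2).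
move=> [c d] [/= ca db]; apply: Ue; rewrite opprD addrACA.
apply: (le_lt_trans (seminormD (isn_seminorm pP n) _ _)).
by rewrite [e](_ : _ = e / 2 + e / 2); [exact: ltrD|field].
Qed.

Lemma sn_scale_continuous : continuous (fun z : R[i]^o * T => z.1 *: z.2).
Proof.
move=> [k a] U /= /sn_nbhsP[n [e e0 Ue]].
have pa := sn_ge0 n a; have k0 := @Re_norm_ge0 _ k.
have d1 : 0 < e / 2 / (p n a + 1) by rewrite !divr_gt0// ltr_wpDl.
have d2 : 0 < e / 2 / (complex.Re `|k| + 1) by rewrite !divr_gt0// ltr_wpDl.
exists ([set l : R[i]^o | normR (l - (k : R[i]^o)) < Num.min 1 (e / 2 / (p n a + 1))],
        sn_ball n (e / 2 / (complex.Re `|k| + 1)) a).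
  split; last by exists n; eexists; first exact: d2.
  by apply/nbhs_normRP; exists (Num.min 1 (e / 2 / (p n a + 1))) => //; rewrite lt_min ltr01.
move=> [l b] [/=]; rewrite lt_min => /andP[l1 l2] ba; apply: Ue.
rewrite /= (_ : l *: b - k *: a = l *: (b - a) + (l - k) *: a); last first.
  by rewrite scalerBr scalerBl addrA subrK.
apply: (le_lt_trans (seminormD (isn_seminorm pP n) _ _)).
rewrite !(seminormZ (isn_seminorm pP n)).
rewrite [e](_ : _ = e / 2 + e / 2); last by field.
apply: ltrD.
  have hl : complex.Re `|l| <= complex.Re `|k| + 1.
    have := @normRD R (R[i]^o) (l - k) k; rewrite subrK => /le_trans; apply.
    by rewrite addrC lerD// ltW.
  apply: (le_lt_trans (ler_wpM2r (sn_ge0 _ _) hl)).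
  by rewrite mulrC -ltr_pdivlMr// ltr_wpDl.
apply: (@le_lt_trans _ _ (complex.Re `|l - k| * (p n a + 1))).
  by apply: ler_wpM2l; [exact: Re_norm_ge0|rewrite lerDl].
by rewrite -ltr_pdivlMr// ltr_wpDl.
Qed.

Lemma sn_ball_convex n e (a : T) : convex_set (sn_ball n e a : set (convex.convex_lmodType T)).
Proof.
move=> x y t /set_mem xa /set_mem ya; apply/mem_set; rewrite /sn_ball /=.
have s0 : 0 <= t%:num by exact: ge0.
have s1 : 0 <= 1 - t%:num by rewrite subr_ge0; exact: le1.
move: s0 s1; set s := t%:num => s0 s1.
change (p n (s *: (x : E) + (1 - s) *: (y : E) - a) < e).
have -> : s *: (x : E) + (1 - s) *: (y : E) - a = s *: (x - a) + (1 - s) *: (y - a).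
  by rewrite !scalerBr addrACA -opprD -scalerDl addrCA subrr addr0 scale1r.
apply: (le_lt_trans (seminormD (isn_seminorm pP n) _ _)).
rewrite !(seminormZ (isn_seminorm pP n)) !ger0_norm//.
have [r0 r1] : 0 <= complex.Re s /\ 0 <= complex.Re (1 - s).
  by move: s0 s1; rewrite !lecE /= => /andP[_ r0] /andP[_ r1]; split.
have rE : complex.Re (1 - s) = 1 - complex.Re s by case: (s).
have k1 : complex.Re s * p n (x - a) + complex.Re (1 - s) * p n (y - a) <=
          Num.max (p n (x - a)) (p n (y - a)).
  apply: (@le_trans _ _ (complex.Re s * Num.max (p n (x - a)) (p n (y - a)) + complex.Re
    (1 - s) * Num.max (p n (x - a)) (p n (y - a)))).
    by apply: lerD; apply: ler_wpM2l => //; rewrite le_max lexx ?orbT.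
  by rewrite -mulrDl rE addrCA subrr addr0 mul1r.
by apply: (le_lt_trans k1); rewrite gt_max xa.
Qed.

Lemma sn_locally_convex :
  exists2 B : set_system T, (forall b, b \in B -> convex_set b) & basis B.
Proof.
exists [set W | exists n e a, W = sn_ball n e a].
  by move=> W /set_mem[n [e [a ->]]]; exact: sn_ball_convex.
split.
  move=> W [n [e [a ->]]]; rewrite openE => b; exact: sn_nbhs_ball.
move=> a U /sn_nbhsP[n [e e0 Ue]]; exists (sn_ball n e a) => //; split.
  by exists n, e, a.
by rewrite /sn_ball /= subrr sn0.
Qed.

HB.instance Definition _ := PreTopologicalLmod_isTvs.Build R[i] T
  sn_add_continuous sn_scale_continuous sn_locally_convex.

HB.instance Definition _ := PreTopologicalNmodule_isTopologicalNmodule.Build T sn_add_continuous.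
HB.instance Definition _ :=
  TopologicalNmodule_isTopologicalLmodule.Build R[i] T sn_scale_continuous.
HB.instance Definition _ := Uniform_isTvs.Build R[i] T sn_locally_convex.

End SeminormedSpace.

(** * Closures of star subalgebras *)

Section ClosedSubalgebra.
Context {R : realType} (C : cstarAlgebra R) (S : set C).

Record closed_star_subalgebra : Prop := ClosedStarSubalgebra {
  subalg0 : S 0;
  subalgP : forall (k : R[i]) x y, S x -> S y -> S (k *: x + y);
  subalgM : forall x y, S x -> S y -> S (cs_mul x y);
  subalg_star : forall x, S x -> S (cs_star x);
  subalg_closed : closed S }.

(** The hypothesis is an argument so that the instances below can be inferred. *)
Definition subalg_pred (_ : closed_star_subalgebra) : {pred C} := fun x => `[< S x >].

Hypothesis SP : closed_star_subalgebra.

Lemma subalg_submod : submod_closed (subalg_pred SP).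
Proof.
split; first exact/asboolP/(subalg0 SP).
by move=> k x y /asboolP Sx /asboolP Sy; apply/asboolP; exact: subalgP.
Qed.

HB.instance Definition _ :=
  GRing.isSubmodClosed.Build R[i] C (subalg_pred SP) subalg_submod.

Record subalg := Subalg { subalg_val : C; subalg_valP : subalg_val \in subalg_pred SP }.

HB.instance Definition _ := [isSub for subalg_val].
HB.instance Definition _ := [Choice of subalg by <:].
HB.instance Definition _ := [SubChoice_isSubLmodule of subalg by <:].

Implicit Types x y : subalg.

Lemma subalg_in x : S (subalg_val x).
Proof. exact/asboolP/subalg_valP. Qed.

Definition subalg_make a (Sa : S a) : subalg :=
  Subalg (introT (asboolP (S a)) Sa : a \in subalg_pred SP).

Lemma subalg_normD x y : `|subalg_val (x + y)| <= `|subalg_val x| + `|subalg_val y|.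
Proof. exact: ler_normD. Qed.
Lemma subalg_normZ (k : R[i]) x : `|subalg_val (k *: x)| = `|k| * `|subalg_val x|.
Proof. exact: normrZ. Qed.
Lemma subalg_norm0_eq0 x : `|subalg_val x| = 0 -> x = 0.
Proof. by move=> /normr0_eq0 h; apply: val_inj. Qed.

HB.instance Definition _ :=
  Lmodule_isNormed.Build R[i] subalg subalg_normD subalg_normZ subalg_norm0_eq0.

(** A Cauchy filter converges in the ambient algebra, to a point of the closed set S. *)
Lemma subalg_cauchy_cvg (F : set_system subalg) : ProperFilter F -> cauchy F -> cvg F.
Proof.
move=> PF /cauchyP cF.
have : cauchy (subalg_val @ F).
  apply/cauchyP => e e0; have [x Fx] := cF e e0; exists (subalg_val x).
  change (F (subalg_val @^-1` ball (subalg_val x) e)); apply: filterS Fx => y.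
  by rewrite /= -!ball_normE.
move=> /cauchy_cvg cv; set l := lim (subalg_val @ F).
have Sl : S l.
  apply: (@closed_cvg _ _ (subalg_val @ F) _ id S (subalg_closed SP)) => //.
  by apply: (@filterE _ F _) => x; exact: subalg_in.
apply/cvg_ex; exists (subalg_make Sl); apply/cvg_normRP => e e0.
by have /cvg_normRP/(_ _ e0) := cv.
Qed.

HB.instance Definition _ := Uniform_isComplete.Build subalg subalg_cauchy_cvg.

Definition subalg_mul x y : subalg := subalg_make (subalgM SP (subalg_in x) (subalg_in y)).
Definition subalg_inv x : subalg := subalg_make (subalg_star SP (subalg_in x)).

Lemma subalg_mul_bilinear : bilinear_mul subalg_mul.
Proof.
have [l r] := @cs_mul_bilinear R C.
split=> [a|b] k x y; apply: val_inj; [exact: l|exact: r].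
Qed.
Lemma subalg_mulA : associative subalg_mul.
Proof. by move=> x y z; apply: val_inj; exact: cs_mulA. Qed.
Lemma subalg_invL : antilinear subalg_inv.
Proof. by move=> k x y; apply: val_inj; exact: cs_starL. Qed.
Lemma subalg_invK : involutive subalg_inv.
Proof. by move=> x; apply: val_inj; exact: cs_starK. Qed.
Lemma subalg_invM x y : subalg_inv (subalg_mul x y) = subalg_mul (subalg_inv y) (subalg_inv x).
Proof. by apply: val_inj; exact: cs_starM. Qed.

Definition subalg_algebra : cstarAlgebra R := @CstarAlgebra R subalg subalg_mul subalg_inv
  subalg_mul_bilinear subalg_mulA subalg_invL subalg_invK subalg_invM
  (fun x y => cs_normM (subalg_val x) (subalg_val y)) (fun x => cs_normE (subalg_val x)).

End ClosedSubalgebra.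

Section Closure.
Context {R : realType} (C : cstarAlgebra R) (S : set C).
Hypotheses (S0 : S 0) (SL : forall (k : R[i]) x y, S x -> S y -> S (k *: x + y)).
Hypotheses (SM : forall x y, S x -> S y -> S (cs_mul x y)) (SS : forall x, S x -> S (cs_star x)).

Lemma closure_seq (f : C * C -> C) x y : (forall a b, S a -> S b -> S (f (a, b))) ->
  f @ (x, y) --> f (x, y) -> closure S x -> closure S y -> closure S (f (x, y)).
Proof.
move=> Sf cf Sx Sy N /cf[[A B] [/= Ax By] AB].
have [a [Sa Aa]] := Sx A Ax; have [b [Sb Bb]] := Sy B By.
by exists (f (a, b)); split; [exact: Sf|exact: (AB (a, b))].
Qed.

(** The operations are continuous. *)
Lemma closure_subalgebra : closed_star_subalgebra (closure S).
Proof.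
split.
- exact: subset_closure.
- move=> k x y Sx Sy; apply: (@closure_seq (fun p => k *: p.1 + p.2) x y) => //.
    by move=> a b Sa Sb; exact: SL.
  apply: cvgD; last exact: cvg_snd.
  by apply: cvgZ; [exact: cvg_cst|exact: cvg_fst].
- move=> x y Sx Sy; apply: (@closure_seq (fun p => cs_mul p.1 p.2) x y) => //.
  exact: (mul_cont (@cs_bounded_mul R C)).
- move=> x Sx; apply: (@closure_seq (fun p => cs_star p.1) x x) => //.
    by move=> a b Sa _; exact: SS.
  by apply: cs_star_cvg; exact: cvg_fst.
- exact: closed_closure.
Qed.

End Closure.

(** * The rigged algebra of Lie-smooth vectors *)

Lemma cvg_real_at (R : realType) (T : topologicalType) (f : T -> R) (x : T) (l : R) :
  (forall e, 0 < e -> \forall t \near x, `|l - f t| < e) -> f @ x --> l.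
Proof. by move=> H; apply/cvgrPdist_lt => e e0; exact: H. Qed.

(** The radius d that makes the product continuous, where k is the constant 2^n of
    [P_mul]. *)
Lemma product_bound (R : realType) (k a b d e x y z : R) : 0 < k -> 0 <= a -> 0 <= b -> 0 < e ->
  d <= e / 2 / (k * (a + b + 1)) -> 0 <= x -> 0 <= y -> x < d -> z < d -> y <= b + 1 ->
  k * x * y + k * a * z < e.
Proof.
move=> k0 a0 b0 e0 hd x0 y0 xd zd yb.
have ab : 0 < a + b + 1 by rewrite ltr_wpDl// addr_ge0.
move: hd; rewrite ler_pdivlMr ?mulr_gt0// => hd.
have h1 : x * y <= d * (b + 1) by apply: ler_pM => //; exact: ltW.
have h2 : a * z <= d * a by rewrite mulrC; apply: ler_wpM2r => //; exact: ltW.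
apply: (@le_lt_trans _ _ (k * (d * (b + 1)) + k * (d * a))).
  by rewrite -!mulrA; apply: lerD; apply: ler_wpM2l => //; exact: ltW.
rewrite -mulrDr -mulrDr [b + 1 + a]addrC addrA mulrCA; apply: (le_lt_trans hd).
by rewrite ltr_pdivrMr// ltr_pMr// ltr1n.
Qed.

Section SmoothAlgebra.
Context {R : realType} {V : hilbertSpace R} (alpha : V -> V).
Context {C : unitalCstarAlgebra R} (iota : V -> C).
Local Notation lieO := (orthogonal_lie_algebra alpha).
Local Notation grpO := (orthogonal_group alpha).
Local Notation th := (bogoliubov iota).
Local Notation act := (lie_action iota).
Local Notation acts := (lie_actions iota).
Local Notation Sm := (lie_smooth alpha iota).
Local Notation P := (lie_norm alpha iota).
Local Notation units := (lie_unit_seq alpha).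

(** The hypotheses are arguments so that the instances below can be inferred. *)
Definition sm_pred (_ : real_structure alpha) (_ : clifford_algebra alpha iota) : {pred C} :=
  fun a => `[< Sm a >].

Hypothesis alphaP : real_structure alpha.
Hypothesis iotaP : clifford_algebra alpha iota.

Lemma sm_submod : submod_closed (sm_pred alphaP iotaP).
Proof.
split; first exact/asboolP/(Sm0 alphaP iotaP).
by move=> k x y /asboolP Sx /asboolP Sy; apply/asboolP; exact: Sm_lin.
Qed.

HB.instance Definition _ :=
  GRing.isSubmodClosed.Build R[i] C (sm_pred alphaP iotaP) sm_submod.

Record svec := Svec { sv_val : C; sv_valP : sv_val \in sm_pred alphaP iotaP }.

HB.instance Definition _ := [isSub for sv_val].
HB.instance Definition _ := [Choice of svec by <:].
HB.instance Definition _ := [SubChoice_isSubLmodule of svec by <:].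

Lemma sv_in (x : svec) : Sm (sv_val x).
Proof. exact/asboolP/sv_valP. Qed.

Definition sv_make a (Sa : Sm a) : svec :=
  Svec (introT (asboolP (Sm a)) Sa : a \in sm_pred alphaP iotaP).

Definition svP n (x : svec) : R := P n (sv_val x).

Lemma svP_seminorms : increasing_seminorms svP.
Proof.
split=> [n|n m x nm]; last exact: P_mono (sv_in x) nm.
split=> [x y|k x]; first exact: (PD alphaP iotaP n (sv_in x) (sv_in y)).
exact: (PZ alphaP iotaP n k (sv_in x)).
Qed.

Definition smoothA : tvsType R[i] := seminormed svP_seminorms.
Definition smooth_val (x : smoothA) : C := sv_val x.

Lemma smooth_val_in (x : smoothA) : Sm (smooth_val x).
Proof. exact: sv_in. Qed.
Lemma smooth_val_inj : injective smooth_val.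
Proof. exact: val_inj. Qed.
Lemma smooth_valB (x y : smoothA) : smooth_val (x - y) = smooth_val x - smooth_val y.
Proof. by []. Qed.
Lemma smooth_valD (x y : smoothA) : smooth_val (x + y) = smooth_val x + smooth_val y.
Proof. by []. Qed.
Lemma smooth_valZ (k : R[i]) (x : smoothA) : smooth_val (k *: x) = k *: smooth_val x.
Proof. by []. Qed.
Definition smoothA_make a (Sa : Sm a) : smoothA := sv_make Sa.

Lemma smoothA_nbhs (a : smoothA) (U : set smoothA) : nbhs a U <->
  exists n, exists2 e, 0 < e & forall b, P n (smooth_val b - smooth_val a) < e -> U b.
Proof. exact: sn_nbhsP. Qed.

Lemma smoothA_cvgP (T : Type) (F : set_system T) (FF : Filter F) (f : T -> smoothA) (a : smoothA) :
  f @ F --> a <-> forall n e, 0 < e -> \forall t \near F, P n (smooth_val (f t) - smooth_val a) < e.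
Proof.
split=> [fa n e e0|H U /smoothA_nbhs[n [e e0 Ue]]].
  apply: (fa [set b : smoothA | P n (smooth_val b - smooth_val a) < e]).
  by apply/smoothA_nbhs; exists n; exists e.
by have h := H n e e0; apply: (filterS _ h) => t; exact: Ue.
Qed.

Lemma smoothA_cvg_at (T : topologicalType) (f : T -> smoothA) (x : T) (a : smoothA) :
  (forall n e, 0 < e -> \forall t \near x, P n (smooth_val (f t) - smooth_val a) < e) ->
    f @ x --> a.
Proof. by move=> H; apply/smoothA_cvgP. Qed.

Lemma smoothA_hausdorff : hausdorff_space smoothA.
Proof.
move=> a b ab; apply: smooth_val_inj; apply/eqP; rewrite -subr_eq0; apply/eqP; apply: normR_eq0.
apply/eqP; rewrite eq_le normR_ge0 andbT; apply/ler_addgt0Pr => e e0; rewrite add0r.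
have e2 : 0 < e / 2 by exact: divr_gt0.
have nb (c : smoothA) : nbhs c [set d : smoothA | P 0 (smooth_val d - smooth_val c) < e / 2].
  by apply/smoothA_nbhs; exists 0%N; exists (e / 2).
have [c [/= ca cb]] := ab _ _ (nb a) (nb b).
have S x y : Sm (smooth_val x - smooth_val y) by exact: (SmB alphaP iotaP (smooth_val_in x)
  (smooth_val_in y)).
rewrite (P0E (S _ _)) in ca; rewrite (P0E (S _ _)) in cb.
rewrite (_ : e = e / 2 + e / 2); last by field.
apply: (le_trans (normR_dist3 _ (smooth_val c) _)); apply: lerD; last exact: ltW.
by rewrite normRBC ltW.
Qed.

Lemma smoothA_countable : exists B : nat -> set smoothA,
  (forall n, nbhs (0 : smoothA) (B n)) /\ forall U, nbhs (0 : smoothA) U -> exists n, B n `<=` U.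
Proof.
exists (fun n => [set b | P n (smooth_val b - smooth_val 0) < n.+1%:R^-1]); split.
  by move=> n; apply/smoothA_nbhs; exists n; exists n.+1%:R^-1 => //; rewrite invr_gt0 ltr0n.
move=> U /smoothA_nbhs[n [e e0 Ue]].
have [m _ hm] := near_infty_natSinv_lt (PosNum e0).
exists (maxn n m) => b /= hb; apply: Ue.
have Sb : Sm (smooth_val b - smooth_val 0) by exact: (SmB alphaP iotaP (smooth_val_in b)
  (smooth_val_in 0)).
apply: (le_lt_trans (P_mono Sb (leq_maxl n m))); apply: (lt_trans hb).
by apply: (hm (maxn n m)); exact: leq_maxr.
Qed.

(** A restatement of [Sm_limit]. *)
Lemma smoothA_complete (F : set_system smoothA) : ProperFilter F -> tvs_cauchy F ->
  exists x : smoothA, F --> x.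
Proof.
move=> PF cF; have [|x0 Sx0 H] := Sm_limit alphaP iotaP PF smooth_val_in.
  move=> n e e0; have /cF[[A B] [/= FA FB] AB] : nbhs (0 : smoothA) [set b : smoothA | P n
    (smooth_val b - smooth_val 0) < e].
    by apply/smoothA_nbhs; exists n; exists e.
  exists (A `&` B); first exact: filterI.
  by move=> s t [As _] [_ Bt]; have : P n (smooth_val (s - t) - smooth_val 0) < e :=
    AB (s, t) (conj As Bt); rewrite -smooth_valB subr0.
exists (smoothA_make Sx0); apply/smoothA_cvgP => n e e0; exact: H.
Qed.

Lemma smoothA_frechet : frechet_space smoothA.
Proof.
by split; [exact: smoothA_hausdorff|exact: smoothA_countable|exact: smoothA_complete].
Qed.

Definition smoothA_mul (x y : smoothA) : smoothA :=
  smoothA_make (Sm_mul alphaP iotaP (smooth_val_in x) (smooth_val_in y)).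
Definition smoothA_star (x : smoothA) : smoothA :=
  smoothA_make (Sm_star alphaP iotaP (smooth_val_in x)).
Definition smoothA_norm (x : smoothA) : R := normR (smooth_val x).

Lemma smoothA_mul_bilinear : bilinear_mul smoothA_mul.
Proof.
have [l r] := @cs_mul_bilinear R C.
split=> [a|b] k x y; apply: smooth_val_inj; [exact: l|exact: r].
Qed.
Lemma smoothA_mulA : associative smoothA_mul.
Proof. by move=> x y z; apply: smooth_val_inj; exact: cs_mulA. Qed.
Lemma smoothA_starL : antilinear smoothA_star.
Proof. by move=> k x y; apply: smooth_val_inj; exact: cs_starL. Qed.
Lemma smoothA_starK : involutive smoothA_star.
Proof. by move=> x; apply: smooth_val_inj; exact: cs_starK. Qed.

Lemma smoothA_star_continuous : continuous smoothA_star.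
Proof.
move=> a; apply: smoothA_cvg_at => n e e0.
have : nbhs a [set b : smoothA | P n (smooth_val b - smooth_val a) < e] by apply/smoothA_nbhs;
  exists n; exists e.
apply: filterS => b /= ba; rewrite /smoothA_star /smooth_val /= -cs_starB.
apply: le_lt_trans ba; apply: (P_star alphaP iotaP).
exact: (SmB alphaP iotaP (smooth_val_in b) (smooth_val_in a)).
Qed.

Lemma smoothA_norm_continuous : continuous smoothA_norm.
Proof.
move=> a; apply: cvg_real_at => e e0.
have : nbhs a [set b : smoothA | P 0 (smooth_val b - smooth_val a) < e] by apply/smoothA_nbhs;
  exists 0%N; exists e.
apply: filterS => b /=; rewrite P0E;
  last exact: (SmB alphaP iotaP (smooth_val_in b) (smooth_val_in a)).
by apply: le_lt_trans; rewrite ler_norml lerNl opprB normR_sub_le /= normRBC normR_sub_le.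
Qed.

Lemma smoothA_norm_seminorm : is_seminorm smoothA_norm.
Proof. by split=> [x y|k x]; [exact: normRD|exact: normRZ]. Qed.

Lemma smoothA_norm0 a : smoothA_norm a = 0 -> a = 0.
Proof. by move=> /normR_eq0 h; apply: smooth_val_inj. Qed.

Lemma smoothA_mul_continuous : continuous (fun p : smoothA * smoothA => smoothA_mul p.1 p.2).
Proof.
move=> [a b]; apply: smoothA_cvg_at => n e e0.
have SB (x y : smoothA) : Sm (smooth_val x - smooth_val y) by exact:
  (SmB alphaP iotaP (smooth_val_in x) (smooth_val_in y)).
have a0 := P_ge0 n (smooth_val_in a); have b0 := P_ge0 n (smooth_val_in b).
pose d := Num.min 1 (e / 2 / (2 ^+ n * (P n (smooth_val a) + P n (smooth_val b) + 1))).
have k0 : 0 < 2 ^+ n * (P n (smooth_val a) + P n (smooth_val b) + 1) :> R.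
  by rewrite mulr_gt0 ?exprn_gt0// ltr_wpDl// addr_ge0.
have d0 : 0 < d by rewrite lt_min ltr01 divr_gt0// divr_gt0.
have nb (c : smoothA) : nbhs c [set x : smoothA | P n (smooth_val x - smooth_val c) < d].
  by apply/smoothA_nbhs; exists n; exists d.
exists ([set x : smoothA | P n (smooth_val x - smooth_val a) < d],
  [set x : smoothA | P n (smooth_val x - smooth_val b) < d]) => //.
move=> [x y] [/= xa yb].
have -> : cs_mul (smooth_val x) (smooth_val y) - cs_mul (smooth_val a) (smooth_val b) =
    cs_mul (smooth_val x - smooth_val a) (smooth_val y) + cs_mul (smooth_val a)
      (smooth_val y - smooth_val b).
  by rewrite (mulbBl (@cs_bounded_mul R C)) (mulbBr (@cs_bounded_mul R C)) subrKA.
have S1 := Sm_mul alphaP iotaP (SB x a) (smooth_val_in y).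
have S2 := Sm_mul alphaP iotaP (smooth_val_in a) (SB y b).
apply: (le_lt_trans (PD alphaP iotaP n S1 S2)).
apply: (le_lt_trans (lerD (P_mul alphaP iotaP n (SB x a) (smooth_val_in y))
  (P_mul alphaP iotaP n (smooth_val_in a) (SB y b)))).
have y1 : P n (smooth_val y) <= P n (smooth_val b) + 1.
  rewrite -[smooth_val y](subrK (smooth_val b)) addrC.
  apply: (le_trans (PD alphaP iotaP n (smooth_val_in b) (SB y b))); rewrite lerD2l ltW//.
  by apply: (lt_le_trans yb); rewrite ge_min lexx.
apply: (@product_bound _ (2 ^+ n) (P n (smooth_val a)) (P n (smooth_val b)) d e) => //.
- by rewrite /d ge_min lexx orbT.
- exact: (P_ge0 n (SB x a)).
- exact: (P_ge0 n (smooth_val_in y)).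
Qed.

Let S : set C := [set a | Sm a].

Lemma closure_Sm : closed_star_subalgebra (closure S).
Proof.
apply: closure_subalgebra.
- exact: (Sm0 alphaP iotaP).
- by move=> k x y; exact: (Sm_lin alphaP iotaP).
- by move=> x y; exact: (Sm_mul alphaP iotaP).
- by move=> x; exact: (Sm_star alphaP iotaP).
Qed.

(** The closure of the Lie-smooth vectors in the Clifford algebra is complete and
    contains them as a dense subspace. *)
Lemma smoothA_completion : exists (B : cstarAlgebra R) (j : smoothA -> B),
  [/\ linear j, (forall a, normR (j a) = smoothA_norm a), closure (range j) = [set: B],
    (forall a b, j (smoothA_mul a b) = cs_mul (j a) (j b)) &
    (forall a, j (smoothA_star a) = cs_star (j a))].
Proof.
pose B := subalg_algebra closure_Sm.
have in_cl (a : smoothA) : closure S (smooth_val a) by apply: subset_closure; exact: smooth_val_in.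
pose j (a : smoothA) : B := subalg_make closure_Sm (in_cl a).
exists B, j; split => //.
- by move=> k x y; apply: val_inj.
- rewrite -subTset => x _ N /nbhs_normRP[e e0 Ne].
  have nb : nbhs (subalg_val x) [set y | normR (y - subalg_val x) < e].
    by apply/nbhs_normRP; exists e.
  have cx : closure S (subalg_val x) by exact: subalg_in.
  have [y [Sy ye]] := cx _ nb.
  exists (j (smoothA_make Sy)); split; first by exists (smoothA_make Sy).
  by apply: Ne; exact: ye.
- by move=> a b; apply: val_inj.
- by move=> a; apply: val_inj.
Qed.

Definition smooth_algebra : riggedCstarAlgebra R := @RiggedCstarAlgebra R smoothA
  smoothA_mul smoothA_norm smoothA_star smoothA_frechet smoothA_mul_bilinear smoothA_mulA
    smoothA_mul_continuous
  smoothA_norm_seminorm smoothA_norm0 smoothA_norm_continuous smoothA_starL smoothA_starK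
  smoothA_star_continuous smoothA_completion.

End SmoothAlgebra.

(** * The smooth representation of O(V) *)

Lemma cvg_norm_at (R : realType) (T : topologicalType) (E : normedModType R[i])
    (f : T -> E) (x : T) (l : E) :
  (forall e, 0 < e -> \forall t \near x, normR (f t - l) < e) -> f @ x --> l.
Proof. by move=> H; apply/cvg_normRP => e e0; exact: H. Qed.

Section Representation.
Context {R : realType} {V : hilbertSpace R} (alpha : V -> V).
Context {C : unitalCstarAlgebra R} (iota : V -> C).
Local Notation lieO := (orthogonal_lie_algebra alpha).
Local Notation grpO := (orthogonal_group alpha).
Local Notation "x ** y" := (bop_comp x y) (at level 40, left associativity).
Local Notation one := (bop_id V).
Local Notation th := (bogoliubov iota).
Local Notation act := (lie_action iota).
Local Notation acts := (lie_actions iota).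
Local Notation Sm := (lie_smooth alpha iota).
Local Notation P := (lie_norm alpha iota).
Local Notation units := (lie_unit_seq alpha).
Hypothesis alphaP : real_structure alpha.
Hypothesis iotaP : clifford_algebra alpha iota.
Local Notation A := (smoothA alphaP iotaP).
Local Notation mk Sa := (@smoothA_make R V alpha C iota alphaP iotaP _ Sa).
Local Notation j := (@smooth_val R V alpha C iota alphaP iotaP).
Implicit Types (X Y Z : bop V) (x y : A) (g h : bop V).

Let mA := @bop_compA R V.
Let m1 := @bop_comp1 R V.
Let mr1 := @bop_compr1 R V.

Let jS x : Sm (j x) := smooth_val_in x.
Let jSB x y : Sm (j x - j y) := SmB alphaP iotaP (jS x) (jS y).

(** Extended by the identity to operators which are not orthogonal. *)
Definition rho g x : A :=
  if pselect (grpO g) is left Og then mk (Smg alphaP iotaP Og (jS x)) else x.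
(** Extended by the identity to operators outside the Lie algebra. *)
Definition actA Y x : A :=
  if pselect (lieO Y) is left hY then mk (Sm_act alphaP iotaP (jS x) hY) else x.

Lemma rhoE g x : grpO g -> j (rho g x) = th g (j x).
Proof. by move=> Og; rewrite /rho; case: pselect. Qed.
Lemma actAE Y x : lieO Y -> j (actA Y x) = act Y (j x).
Proof. by move=> hY; rewrite /actA; case: pselect. Qed.

Lemma actA_bilinear : real_bilinear_on lieO [set: A] (fun p => actA p.1 p.2).
Proof.
split.
- move=> x _ Y Y' t hY hY' /=; have htY : lieO (t%:C *: Y') by exact: lieZ.
  have hs := lieD alphaP hY htY.
  apply: smooth_val_inj; rewrite smooth_valD smooth_valZ !actAE//.
  by rewrite (sm_addY (jS x))// (sm_scaleY iotaP t (jS x)).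
- move=> Y hY x y t _ _ /=; apply: smooth_val_inj; rewrite smooth_valD smooth_valZ !actAE//.
  rewrite smooth_valD smooth_valZ (act_D alphaP iotaP (jS x))//.
    by rewrite (act_Z alphaP iotaP _ (jS y)).
  exact: (SmZ alphaP iotaP _ (jS y)).
Qed.

(** Y b - Y0 a = Y (b - a) + (Y - Y0) a, with both terms estimated by [P_act]. *)
Lemma actA_cont : cont_on (lieO `*` [set: A]) (fun p => actA p.1 p.2).
Proof.
move=> [Y0 a] [/= hY0 _]; apply/smoothA_cvgP => n e e0.
have Q0 := P_ge0 n.+1 (jS a); have y0 := normR_ge0 Y0.
have e2 : 0 < e / 2 by exact: divr_gt0.
have d1 : 0 < Num.min 1 (e / 2 / (P n.+1 (j a) + 1)).
  by rewrite lt_min ltr01 divr_gt0// ltr_wpDl.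
have d2 : 0 < e / 2 / (normR Y0 + 1) by rewrite divr_gt0// ltr_wpDl.
rewrite near_withinE.
exists ([set Y | normR (Y - Y0) < Num.min 1 (e / 2 / (P n.+1 (j a) + 1))],
        [set b : A | P n.+1 (j b - j a) < e / 2 / (normR Y0 + 1)]).
  split; first by apply/nbhs_normRP; eexists; first exact: d1.
  by apply/smoothA_nbhs; exists n.+1; eexists; first exact: d2.
move=> [Y b] [/=]; rewrite lt_min => /andP[Y1 Y2] ba [hY _].
rewrite !actAE//.
have hD := lieB alphaP hY hY0.
have -> : act Y (j b) - act Y0 (j a) = act Y (j b - j a) + act (Y - Y0) (j a).
  by rewrite (act_B alphaP iotaP (jS b) (jS a) hY) (sm_subY alphaP iotaP (jS a) hY hY0) subrKA.
have S1 := Sm_act alphaP iotaP (jSB b a) hY; have S2 := Sm_act alphaP iotaP (jS a) hD.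
apply: (le_lt_trans (PD alphaP iotaP n S1 S2)).
apply: (le_lt_trans (lerD (P_act alphaP iotaP n (jSB b a) hY) (P_act alphaP iotaP n (jS a) hD))).
rewrite [X in _ < X](_ : e = e / 2 + e / 2); last by field.
apply: ltrD.
  have hl : normR Y <= normR Y0 + 1.
    by rewrite -[Y in normR Y](subrK Y0) addrC; apply: (le_trans (normRD _ _)); rewrite lerD2l ltW.
  apply: (le_lt_trans (ler_wpM2r (P_ge0 _ (jSB b a)) hl)).
  by rewrite mulrC -ltr_pdivlMr// ltr_wpDl.
apply: (@le_lt_trans _ _ (normR (Y - Y0) * (P n.+1 (j a) + 1))).
  by apply: ler_wpM2l; [exact: normR_ge0|rewrite lerDl].
by rewrite -ltr_pdivlMr// ltr_wpDl.
Qed.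

Local Notation SA := (smooth_algebra alphaP iotaP).

Lemma rho_isometric g : grpO g -> @isometric_rigged_morphism R SA SA (rho g).
Proof.
move=> Og; have um := theta_usm iotaP Og; split; last first.
  move=> x; change (normR (j (rho g x)) = normR (j x)).
  by rewrite rhoE// (th_norm iotaP).
split.
- by move=> k x y; apply: smooth_val_inj;
  rewrite [RHS]smooth_valD smooth_valZ !rhoE// [LHS](usm_linear um).
- move=> x y; apply: smooth_val_inj; rewrite rhoE//.
  change (th g (cs_mul (j x) (j y)) = cs_mul (j (rho g x)) (j (rho g y))).
  by rewrite !rhoE// (usm_mul um).
- move=> x; apply: smoothA_cvg_at => n e e0.
  have : nbhs x [set y : A | P n (j y - j x) < e] by apply/smoothA_nbhs; exists n; exists e.
  apply: filterS => y /=; rewrite !rhoE// -(thB iotaP)//; apply: le_lt_trans.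
  exact: (Pg alphaP iotaP n Og (jSB y x)).
- exists 1 => x; rewrite mul1r; change (normR (j (rho g x)) <= normR (j x)).
  by rewrite rhoE// (th_norm iotaP).
- move=> x; apply: smooth_val_inj; rewrite rhoE//.
  change (th g (cs_star (j x)) = cs_star (j (rho g x))).
  by rewrite rhoE// (usm_star um).
Qed.

Lemma rho_one x : rho one x = x.
Proof. by apply: smooth_val_inj; rewrite rhoE; [rewrite (th1 iotaP)|exact: group1]. Qed.

Lemma rho_mul g h x : grpO g -> grpO h -> rho (g ** h) x = rho g (rho h x).
Proof.
by move=> Og Oh; apply: smooth_val_inj; rewrite !rhoE//; [rewrite (thM iotaP)|exact: groupM].
Qed.

Section Smoothness.
Variable g : bop V.
Hypothesis Og : grpO g.
Local Notation L := (lieO `*` [set: A]).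
Local Notation U := (lie_ball alpha 1 `*` [set: A]).
Let f (p : bop V * A) : A := rho (g ** bop_exp p.1) p.2.
Let psi (q : (bop V * A) * (bop V * A)) : bop V * A :=
  (q.1.1, actA (ldexp (q.1.1, q.2.1)) q.1.2 + q.2.2).

Let dT := @real_domainT R A.
Let dL : real_domain L L.
Proof. by apply: real_domainM => //; exact: lie_domainT. Qed.
Let dU : real_domain L U.
Proof. by apply: real_domainM => //; exact: lie_domain. Qed.

Let OgX X : lieO X -> grpO (g ** bop_exp X).
Proof. by move=> hX; apply: groupM => //; exact: group_exp. Qed.

Let exp_sub X X0 : g ** bop_exp X = g ** bop_exp X0 ** (bop_exp (- X0) ** bop_exp X).
Proof. by rewrite mA -(mA g) expNr mr1. Qed.

(** Split the increment of th (g exp X) a at X0 and a: the first part is controlled by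
    invariance of the seminorms, the second by [P_curve_cvg] for the curve exp (- X0)
    exp X. *)
Lemma rho_cont : cont_on U f.
Proof.
move=> [X0 a] [/= [hX0 _] _]; apply/smoothA_cvgP => n e e0.
have e2 : 0 < e / 2 by exact: divr_gt0.
pose c X := bop_exp (- X0) ** bop_exp X.
have c1 : c @ within lieO (nbhs X0) --> one.
  rewrite -(expNl X0); apply: comp_cvg; first exact: cvg_cst.
  by apply: cvg_within_filter; exact: bop_exp_cont.
have Oc : \forall X \near within lieO (nbhs X0), grpO (c X).
  rewrite near_withinE; near=> X => hX; apply: groupM; apply: group_exp => //.
  exact: lieN.
have := P_curve_cvg alphaP iotaP n _ (jS a) c1 Oc e2.
rewrite !near_withinE => Hc.
exists ([set X | lieO X -> P n (th (c X) (j a) - j a) < e / 2],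
  [set b : A | P n (j b - j a) < e / 2]).
  by split; [exact: Hc|apply/smoothA_nbhs; exists n; exists (e / 2)].
move=> [X b] [/= cX ba] [[hX _] _]; have OX := OgX hX; have OX0 := OgX hX0.
rewrite /f !rhoE//=.
have OcX : grpO (c X) by apply: groupM; apply: group_exp => //; exact: lieN.
have -> : th (g ** bop_exp X) (j b) - th (g ** bop_exp X0) (j a) =
   th (g ** bop_exp X) (j b - j a) + th (g ** bop_exp X0) (th (c X) (j a) - j a).
  rewrite (thB iotaP)// [in X in _ = _ + X](thB iotaP)// -(thM iotaP)//.
  by rewrite -exp_sub subrKA.
have Sc := Smg alphaP iotaP OcX (jS a); have ScB := SmB alphaP iotaP Sc (jS a).
apply: (le_lt_trans (PD alphaP iotaP n (Smg alphaP iotaP OX (jSB b a)) (Smg alphaP iotaP OX0 ScB))).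
rewrite [X in _ < X](_ : e = e / 2 + e / 2); last by field.
apply: ltrD.
  exact: (le_lt_trans (Pg alphaP iotaP n OX (jSB b a))).
exact: (le_lt_trans (Pg alphaP iotaP n OX0 ScB) (cX hX)).
Unshelve. all: by end_near. Qed.

(** After moving by th (g exp X), the derivative is that of th (c t) (a + t b) along the
    curve c t = exp (- X) exp (X + tZ). *)
Lemma rho_deriv : deriv_on L U f (f \o psi).
Proof.
move=> [X a] [Z b] [/= [hX _] _] [/= hZ _]; apply/smoothA_cvgP => n e e0.
have e2 : 0 < e / 2 by exact: divr_gt0.
have hP := ldexp_lie alphaP hX hZ; have OX := OgX hX.
have Oc t : grpO (exp_curve X Z t) by exact: exp_curve_group.
have c1 := @exp_curve_cvg _ _ X Z; have cP := @exp_curve_deriv _ _ X Z.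
have k1 := P_curve_deriv alphaP iotaP n (jS a) hP Oc c1 cP e2.
have k2 := P_curve_cvg alphaP iotaP n _ (jS b) c1 (filterE _ Oc) e2.
have tn0 : \forall t \near (0 : R)^', t != 0 by apply/near0P; exists 1.
apply: filterS3 k1 (k2 _ _) tn0 => t h1 h2 t0.
have tC : t%:C != 0 :> R[i] by rewrite realC_eq0.
have hXt : lieO (X + t%:C *: Z) by apply: lieD => //; exact: lieZ.
set c := exp_curve X Z t in h1 h2; have Oct : grpO c := Oc t.
change (P n (j ((t%:C)^-1 *: (rho (g ** bop_exp (X + t%:C *: Z)) (a + t%:C *: b) -
  rho (g ** bop_exp X) a)) - j (rho (g ** bop_exp X) (actA (ldexp (X, Z)) a + b))) < e).
rewrite smooth_valZ smooth_valB !rhoE//; last exact: OgX.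
rewrite !smooth_valD smooth_valZ actAE// exp_curveE mA (thM iotaP)//.
have S1 := SmZ alphaP iotaP (t%:C)^-1 (SmB alphaP iotaP (Smg alphaP iotaP Oct (jS a)) (jS a)).
have S1' := SmB alphaP iotaP S1 (Sm_act alphaP iotaP (jS a) hP).
have S2 := SmB alphaP iotaP (Smg alphaP iotaP Oct (jS b)) (jS b).
have -> : (t%:C)^-1 *: (th (g ** bop_exp X) (th c (j a + t%:C *: j b)) - th (g ** bop_exp X) (j a))
    - th (g ** bop_exp X) (act (ldexp (X, Z)) (j a) + j b) =
  th (g ** bop_exp X) (((t%:C)^-1 *: (th c (j a) - j a) - act (ldexp (X, Z)) (j a))
    + (th c (j b) - j b)).
  rewrite -(thB iotaP)// -(thZ iotaP)// -(thB iotaP)//; congr (th _ _).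
  rewrite (thD iotaP)// (thZ iotaP)// addrAC scalerDr scalerA mulVf// scale1r.
  by rewrite opprD addrACA.
apply: (le_lt_trans (Pg alphaP iotaP n OX (SmD alphaP iotaP S1' S2))).
apply: (le_lt_trans (PD alphaP iotaP n S1' S2)).
by rewrite [X in _ < X](_ : e = e / 2 + e / 2); [exact: ltrD|field].
Qed.

Let LL := L `*` L.
Let UL := U `*` L.

Lemma psi_smooth : smooth_map LL UL psi.
Proof.
move=> n; have dUL : real_domain LL UL by exact: real_domainM.
have dl := lie_domainT alphaP.
have dLB : real_domain L (lie_ball alpha 1 `*` [set: A]) by exact: dU.
have F1 : Cn n LL UL (fst : (bop V * A) * (bop V * A) -> _) by exact: Cn_fst.
have F2 : Cn n LL UL (snd : (bop V * A) * (bop V * A) -> _) by exact: Cn_snd.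
have F11 : Cn n LL UL (fun q : (bop V * A) * (bop V * A) => q.1.1).
  apply: (@Cn_comp _ _ _ _ _ _ _ L U fst fst) => //; first by move=> q [].
  by apply: Cn_fst => //; exact: lie_domain.
have F12 : Cn n LL UL (fun q : (bop V * A) * (bop V * A) => q.1.2).
  apply: (@Cn_comp _ _ _ _ _ _ _ L U snd fst) => //; first by move=> q [].
  by apply: Cn_snd => //; exact: lie_domain.
have F21 : Cn n LL UL (fun q : (bop V * A) * (bop V * A) => q.2.1).
  by apply: (@Cn_comp _ _ _ _ _ _ _ L L fst snd) => //; [move=> q []|exact: Cn_fst].
have F22 : Cn n LL UL (fun q : (bop V * A) * (bop V * A) => q.2.2).
  by apply: (@Cn_comp _ _ _ _ _ _ _ L L snd snd) => //; [move=> q []|exact: Cn_snd].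
have dll : real_domain (lieO `*` lieO) (lieO `*` lieO) by exact: real_domainM.
have FP : Cn n LL UL (fun q : (bop V * A) * (bop V * A) => ldexp (q.1.1, q.2.1)).
  apply: (@Cn_comp _ _ _ _ _ _ _ (lieO `*` lieO) (lieO `*` lieO) (@ldexp R V)
    (fun q => (q.1.1, q.2.1))) => //.
  - by move=> q [[[hX _] _] [hZ _]]; split.
  - exact: ldexp_smooth.
  - exact: Cn_pair.
apply: Cn_pair => //; apply: Cn_add => //.
apply: (@Cn_comp _ _ _ _ _ _ _ L L (fun p => actA p.1 p.2)
  (fun q => (ldexp (q.1.1, q.2.1), q.1.2))) => //.
- by move=> q [[[hX _] _] [hZ _]]; split => //=; exact: ldexp_lie.
- apply: Cn_bilinear => //; [exact: actA_bilinear|exact: actA_cont].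
- exact: Cn_pair.
Qed.

(** The derivative of f is f composed with psi, which is smooth: one more derivative at
    each step. *)
Lemma rho_smooth_at : smooth_map L U f.
Proof.
elim=> [|n IH]; first by apply: Cn_0; exact: rho_cont.
apply/CnS; split; first exact: rho_cont.
exists (f \o psi); first exact: rho_deriv.
apply: (@Cn_comp _ _ _ _ _ _ _ L U f psi) => //; last exact: psi_smooth.
- exact: real_domainM.
- by move=> q [[[hX X1] _] [hZ _]]; split.
Qed.

End Smoothness.

Lemma rho_smooth : smooth_on_Ox alpha rho.
Proof. by move=> g Og; exists 1 => //; exact: rho_smooth_at. Qed.

Lemma rho_representation : @smooth_representation_of_O R V alpha SA rho.
Proof.
split; [exact: rho_one|exact: rho_mul|exact: rho_isometric|exact: rho_smooth].
Qed.

(** Restrict the smooth action to the fixed vector a and compose with the continuous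
    inclusion. *)
Lemma Sm_smooth_vectors a : Sm a -> smooth_vectors alpha iota a.
Proof.
move=> Sa g Og; exists 1 => // n; pose x : A := mk Sa.
have dl := lie_domain alphaP 1.
have dU : real_domain (lieO `*` [set: A]) (lie_ball alpha 1 `*` [set: A]).
  by apply: real_domainM => //; exact: real_domainT.
have h1 : Cn n lieO (lie_ball alpha 1) (fun Y => rho (g ** bop_exp Y) x).
  apply: (@Cn_comp _ _ _ _ _ _ _ (lieO `*` [set: A]) (lie_ball alpha 1 `*` [set: A])
     (fun p : bop V * A => rho (g ** bop_exp p.1) p.2) (fun Y => (Y, x))) => //.
    exact: rho_smooth_at.
  apply: Cn_pair; last exact: Cn_cst.
  by apply: Cn_linear => //; apply: continuous_cont_on => ?; exact: cvg_id.
have h2 : Cn n lieO (lie_ball alpha 1) (fun Y => j (rho (g ** bop_exp Y) x)).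
  apply: (@Cn_comp _ _ _ _ _ _ _ [set: A] [set: A] (fun x : A => j x)) => //;
    first exact: real_domainT.
  apply: Cn_linear; [exact: real_domainT| |].
    by move=> y z t _ _; rewrite smooth_valD smooth_valZ.
  apply: continuous_cont_on => y; apply: cvg_norm_at => e e0.
  have : nbhs y [set z : A | P 0 (j z - j y) < e] by apply/smoothA_nbhs; exists 0%N; exists e.
  by apply: filterS => z /=; rewrite (P0E (jSB z y)).
apply: (Cn_ext dl) h2 => Y [hY _]; rewrite rhoE//.
by apply: groupM => //; exact: group_exp.
Qed.

End Representation.

(** * The topology of smooth vectors *)

Section SmoothSeminorms.
Context {R : realType} {V : hilbertSpace R} (alpha : V -> V).
Context {C : unitalCstarAlgebra R} (iota : V -> C).
Hypothesis alphaP : real_structure alpha.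
Hypothesis iotaP : clifford_algebra alpha iota.
Local Notation acts := (lie_actions iota).
Local Notation Sm := (lie_smooth alpha iota).
Local Notation P := (lie_norm alpha iota).
Local Notation units := (lie_unit_seq alpha).
Local Notation snorm := (smooth_seminorm alpha iota).

Lemma smooth_seminorm_ub (r : C -> R) n a Ys : size Ys = n -> units Ys ->
  ((r (acts Ys a))%:E <= snorm r n a)%E.
Proof.
move=> sY uY; apply: ereal_sup_ubound; have sY' : size Ys == n by apply/eqP.
exists (Tuple sY') => // i; apply: uY; exact: mem_tnth.
Qed.

Lemma smooth_seminorm_le (r : C -> R) n a (M : R) :
  (forall Ys, size Ys = n -> units Ys -> r (acts Ys a) <= M) -> (snorm r n a <= M%:E)%E.
Proof.
move=> H; apply: ge_ereal_sup => _ [Ys hYs <-]; rewrite lee_fin.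
apply: H; first exact: size_tuple.
by move=> Y /tnthP[i ->]; exact: hYs.
Qed.

Lemma P_le_smooth_seminorm n a e : Sm a ->
  (forall i : 'I_n.+1, (snorm (@normR R C) i a < e%:E)%E) -> P n a <= e.
Proof.
move=> Sa H; apply: P_le => // Ys sY uY.
have := H (Ordinal (sY : (size Ys < n.+1)%N)) => /= /ltW; rewrite -lee_fin; apply: le_trans.
exact: smooth_seminorm_ub.
Qed.

(** A continuous seminorm is bounded by 1 on a ball around 0, and homogeneous. *)
Lemma continuous_seminorm_bounded (E : normedModType R[i]) (r : E -> R) :
  is_seminorm r -> continuous r -> exists2 K : R, 0 <= K & forall x, r x <= K * normR x.
Proof.
move=> [rD rZ] rc.
have r0 : r 0 = 0 by have := rZ 0 0; rewrite scale0r normr0 mul0r.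
have /cvgrPdist_lt/(_ _ ltr01) := rc 0; rewrite r0 => /nbhs_normRP[d d0 H].
exists (2 / d) => [|x]; first by rewrite divr_ge0// ltW.
have [x0|x0] := eqVneq (normR x) 0; first by rewrite (normR_eq0 x0) r0 normR0 mulr0.
have xp : 0 < normR x by rewrite lt_def x0 normR_ge0.
pose s := d / (2 * normR x); have s0 : 0 < s by rewrite divr_gt0// mulr_gt0.
have h : r (s%:C *: x) < 1.
  have := H (s%:C *: x); rewrite subr0 sub0r normrN normRZr gtr0_norm// => k.
  apply: le_lt_trans (ler_norm _) (k _).
  by rewrite /s invfM mulrA mulfVK// ltr_pdivrMr// ltr_pMr// ltr1n.
move: h; rewrite rZ Re_normr_real gtr0_norm// mulrC -ltr_pdivlMr// => /ltW /le_trans; apply.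
by rewrite /s div1r invf_div mulrAC.
Qed.

Lemma smooth_seminorm_lt (r : C -> R) n (K : R) a e : Sm a -> 0 <= K ->
  (forall x, r x <= K * normR x) ->
  0 < e -> P n a < e / (K + 1) -> (snorm r n a < e%:E)%E.
Proof.
move=> Sa K0 rK e0; rewrite ltr_pdivlMr ?ltr_wpDl// => Pa.
apply: (@le_lt_trans _ _ ((P n a * (K + 1))%:E)); last by rewrite lte_fin.
apply: smooth_seminorm_le => Ys sY uY; apply: (le_trans (rK _)).
have k : normR (acts Ys a) <= P n a by apply: P_ub => //; rewrite sY.
rewrite mulrC; apply: ler_pM => //; first exact: normR_ge0.
by rewrite lerDl.
Qed.

(** The norm of C is one of the continuous seminorms r, and generates all [lie_norm] n;
    conversely every continuous r is bounded by a multiple of the norm. *)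
Lemma smoothA_smooth_nbhs (a : smoothA alphaP iotaP) (U : set (smoothA alphaP iotaP)) : nbhs a U <->
  exists (m : nat) (r : 'I_m -> C -> R) (n : 'I_m -> nat) (e : R),
    [/\ 0 < e, (forall i, is_seminorm (r i) /\ continuous (r i)) &
      forall b, (forall i, (snorm (r i) (n i) (smooth_val b - smooth_val a)%R < e%:E)%E) -> U b].
Proof.
have SB (b : smoothA alphaP iotaP) : Sm (smooth_val b - smooth_val a) :=
  SmB alphaP iotaP (smooth_val_in b) (smooth_val_in a).
split=> [/smoothA_nbhs[n [e e0 Ue]]|[m [r [n [e [e0 rP Ue]]]]]].
  exists n.+1, (fun=> @normR R C), (fun i => nat_of_ord i), (e / 2).
  split; first exact: divr_gt0.
    move=> _; split; first by split=> [x y|k x]; [exact: normRD|exact: normRZ].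
    by move=> x; exact: normR_cvg.
  move=> b /(P_le_smooth_seminorm (SB b)) h; apply: Ue; apply: (le_lt_trans h).
  by rewrite ltr_pdivrMr// ltr_pMr// ltr1n.
have K_ i : exists2 K : R, 0 <= K & forall x, r i x <= K * normR x.
  by have [h1 h2] := rP i; exact: continuous_seminorm_bounded.
have h i : nbhs a [set b : smoothA alphaP iotaP |
  (snorm (r i) (n i) (smooth_val b - smooth_val a)%R < e%:E)%E].
  have [K K0 rK] := K_ i; apply/smoothA_nbhs; exists (n i); exists (e / (K + 1)).
    by rewrite divr_gt0// ltr_wpDl.
  by move=> b; exact: smooth_seminorm_lt.
by have := filter_forall (nbhs_filter a) h; apply: filterS => b; exact: Ue.
Qed.

End SmoothSeminorms.

Theorem proposition3p2p7 (R : realType) (V : hilbertSpace R) (alpha : V -> V)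
    (C : unitalCstarAlgebra R) (iota : V -> C) :
  real_structure alpha ->
  clifford_algebra alpha iota ->
  exists (A : riggedCstarAlgebra R) (j : A -> C),
    is_smooth_vector_algebra alpha iota j /\
    exists rho : bop V -> A -> A,
      (forall g a, orthogonal_group alpha g ->
         j (rho g a) = bogoliubov iota g (j a)) /\
      smooth_representation_of_O alpha rho.
Proof.
move=> alphaP iotaP.
exists (smooth_algebra alphaP iotaP), (@smooth_val _ _ _ _ _ alphaP iotaP); split; last first.
  exists (@rho R V alpha C iota alphaP iotaP); split; last exact: rho_representation.
  by move=> g a Og; exact: rhoE.
split => //.
- exact: smooth_val_inj.
- apply/seteqP; split=> [_ [x _ <-]|a sa].
    by apply: (Sm_smooth_vectors alphaP iotaP); exact: smooth_val_in.
  by exists (@smoothA_make R V alpha C iota alphaP iotaP a (smooth_vectors_Sm alphaP iotaP sa)).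
- exact: smoothA_smooth_nbhs.
Qed.
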